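(* Let $G$ be a homogeneous group with homogeneous dimension $Q$ and homogeneous norm $r$, let $0<\alpha<Q$ and $1<p\le q<\infty$, and let $v,w$ be weights on $G$ with $\int_G w(x)\,dx=\infty$. Suppose that either $w\in DC^{\alpha,p}(G)$ or $v\in DC(G)$. Then the Riesz potential operator $$(I_\alpha f)(x)=\int_G f(y)\,\big(r(xy^{-1})\big)^{\alpha-Q}\,dy$$ is bounded from $L^p_{dec,r}(w,G)$ to $L^q(v,G)$ if and only if the following three conditions hold: (i) $$\sup_{t>0}\bigg(\int_{B(e,t)}w(x)\,dx\bigg)^{-1/p}\bigg(\int_{B(e,t)}r^{\alpha q}(x)\,v(x)\,dx\bigg)^{1/q}<\infty;$$ (ii) $$\sup_{t>0}\bigg(\int_{B(e,t)}r^{p'Q}(x)\,W^{-p'}(r(x))\,w(x)\,dx\bigg)^{1/p'}\bigg(\int_{G\setminus B(e,t)}r^{(\alpha-Q)q}(x)\,v(x)\,dx\bigg)^{1/q}<\infty;$$ (iii) $$\sup_{t>0}\bigg(\int_{B(e,t)}v(x)\,dx\bigg)^{1/q}\bigg(\int_{G\setminus B(e,t)}r^{\alpha p'}(x)\,W^{-p'}(r(x))\,w(x)\,dx\bigg)^{1/p'}<\infty.$$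
   Context: Homogeneous group: a simply connected nilpotent Lie group $G$ with Lie algebra $\mathfrak g$ carrying dilations $\delta_t=\exp(A\log t)$, $t>0$, where $A$ is a diagonalizable linear operator on $\mathfrak g$ with positive eigenvalues, such that the maps $\exp\circ\,\delta_t\circ\exp^{-1}$ (again denoted $\delta_t$) are automorphisms of $G$. $Q=\operatorname{tr}A$ is the homogeneous dimension and $e$ the neutral element. $G$ is equipped with a homogeneous norm $r:G\to[0,\infty)$, continuous on $G$, smooth on $G\setminus\{e\}$, with: $r(x)=r(x^{-1})$; $r(\delta_t x)=t\,r(x)$; $r(x)=0$ iff $x=e$; and $r(xy)\le c_0(r(x)+r(y))$ for all $x,y\in G$, for some constant $c_0>0$. Balls: $B(a,t)=\{y\in G: r(ay^{-1})<t\}$. Haar measure (denoted $dx$ or $|\cdot|$) is normalized by $|B(e,1)|=1$, so $|B(x,t)|=t^Q$. A weight on $G$ is an everywhere positive (measurable) function. $p'=p/(p-1)$. $W(t)=\int_{B(e,t)}w(x)\,dx$, assumed finite for every $t>0$. Notation such as $r^{s}(x)$, $W^{s}(r(x))$ means $(r(x))^{s}$, $(W(r(x)))^{s}$. $L^p(\rho,G)$ is the space of measurable $f$ with $\|f\|_{L^p(\rho,G)}=(\int_G|f|^p\rho\,dx)^{1/p}<\infty$. $\mathcal{DR}(G)$ is the class of radially decreasing functions: $f:G\to[0,\infty)$ belongs to it if there is a decreasing (i.e. nonincreasing) function $\bar f$ with values in $[0,\infty)$ such that $f(x)=\bar f(r(x))$. An operator $T$ is bounded from $L^p_{dec,r}(w,G)$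 to $L^q(v,G)$ if there is $C>0$ with $\|Tf\|_{L^q(v,G)}\le C\|f\|_{L^p(w,G)}$ for all $f\in\mathcal{DR}(G)$. $v\in DC(G)$ means: $v$ is locally integrable, and there is $b>1$ such that $\int_{B(e,2t)}v(x)\,dx\le b\int_{B(e,t)}v(x)\,dx$ for all $t>0$. $w\in DC^{\gamma,p}(G)$, where $1<p<\infty$ and $0<\gamma<Q/p$ (the class is defined only for such $\gamma$), means: there is $b>0$ such that for all $t>0$ $$\int_{G\setminus B(e,t)}r^{\gamma p'}(x)W^{-p'}(r(x))w(x)\,dx\le b\int_{G\setminus B(e,2t)}r^{\gamma p'}(x)W^{-p'}(r(x))w(x)\,dx.$$ *)

(* Defs.v *)
From HB Require Import structures.
From mathcomp Require Import all_boot all_order all_algebra.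
From mathcomp Require Import all_classical all_reals all_analysis.

Set Implicit Arguments.
Unset Strict Implicit.
Unset Printing Implicit Defensive.

Import Order.TTheory GRing.Theory Num.Theory.
Import numFieldNormedType.Exports.

Local Open Scope classical_set_scope.
Local Open Scope ring_scope.

(* f is C^oo on the open set U: all its iterated directional derivatives exist
   and are continuous at every point of U. *)
Definition iter_derive (R : numFieldType) (V W : normedModType R)
    (f : V -> W) (s : seq V) : V -> W :=
  foldr (fun u g => 'D_u g) f s.

Definition smooth_on (R : numFieldType) (V W : normedModType R)
    (U : set V) (f : V -> W) : Prop :=
  forall (s : seq V) (x : V), U x ->
    {for x, continuous (iter_derive f s)} /\
    forall u, derivable (iter_derive f s) x u.

Definition expmx (R : realType) (n : nat) (M : 'M[R]_n) : 'M[R]_n :=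
  limn (series (fun k => (k`!%:R)^-1 *: M ^+ k)).

HB.structure Definition PointedTopGroup :=
  {G of Group G & PointedTopological G}.

Definition borel (G : ptopologicalType) := g_sigma_algebraType (@open G).

(* A simply connected nilpotent Lie group with dilations. The exponential map
   of such a group is a diffeomorphism from its Lie algebra onto the group, so
   the manifold structure is the one given by the single chart [logG]; the Lie
   algebra is identified with R^n by a choice of basis. In that chart,
   [expG_oneparam] says that [expG] is the Lie group exponential. Linear
   operators act on row vectors from the right. *)
Record homogeneous_group (R : realType) (n : nat) (G : PointedTopGroup.type) :=
  HomogeneousGroup {
  expG : 'rV[R]_n -> G;
  logG : G -> 'rV[R]_n;
  expGK : cancel expG logG;
  logGK : cancel logG expG;
  continuous_expG : continuous expG;
  continuous_logG : continuous logG;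
  smooth_mulG : smooth_on setT
    (fun XY : 'rV[R]_n * 'rV[R]_n => logG (expG XY.1 * expG XY.2)%g);
  smooth_invG : smooth_on setT (fun X => logG ((expG X)^-1)%g);
  expG_oneparam : forall (s t : R) (X : 'rV[R]_n),
    expG ((s + t) *: X) = (expG (s *: X) * expG (t *: X))%g;
  (* all left-normed commutators of some fixed length are trivial *)
  nilpotentG : exists k, forall (x : G) (s : seq G),
    size s = k -> foldl (@commg G) x s = 1%g;
  dil_gen : 'M[R]_n;
  dil_gen_diag : diagonalizable dil_gen;
  dil_gen_gt0 : forall a, eigenvalue dil_gen a -> 0 < a;
  dil_automorphism : forall t : R, 0 < t ->
    let d x := expG (logG x *m expmx (ln t *: dil_gen)) in
    bijective d /\ {morph d : x y / (x * y)%g}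
}.

Section homogeneous_group_notions.
Context {R : realType} {n : nat} {G : PointedTopGroup.type}.
Variable H : homogeneous_group R n G.
Implicit Types (r : G -> R) (t : R).

Definition dilation t (x : G) : G :=
  expG H (logG H x *m expmx (ln t *: dil_gen H)).

Definition hdim : R := \tr (dil_gen H).

Record homogeneous_norm r : Prop := HomogeneousNorm {
  hnorm_ge0 : forall x, 0 <= r x;
  continuous_hnorm : continuous r;
  smooth_hnorm : smooth_on [set X : 'rV[R]_n | expG H X <> 1%g]
    (fun X => r (expG H X) : R^o);
  hnormV : forall x, r (x^-1)%g = r x;
  hnorm_dilation : forall t x, 0 < t -> r (dilation t x) = t * r x;
  hnorm_eq0 : forall x, r x = 0 <-> x = 1%g;
  hnorm_quasi_triangle : exists2 c0 : R, 0 < c0 &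
    forall x y, r (x * y)%g <= c0 * (r x + r y)
}.

End homogeneous_group_notions.

Section weighted_notions.
Context {R : realType} {G : PointedTopGroup.type}.
Variables (r : G -> R) (mu : {measure set (borel G) -> \bar R}).
Implicit Types (t : R) (w v : G -> R).

Definition gball (a : G) t : set G := [set y | r (a * y^-1)%g < t].

(* Left Haar measure on the Borel sets, normalized on the unit ball. *)
Record normalized_haar : Prop := NormalizedHaar {
  haar_left_invariant : forall (x : G) (A : set (borel G)), measurable A ->
    mu [set (x * y)%g | y in A] = mu A;
  haar_compact : forall K : set G, compact K -> (mu K < +oo)%E;
  haar_unit_ball : mu (gball 1%g 1) = 1%E
}.

Definition weight w : Prop :=
  measurable_fun [set: borel G] w /\ forall x, 0 < w x.

Local Open Scope ereal_scope.

Definition wint w t : \bar R := \int[mu]_(x in gball 1%g t) (w x)%:E.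

Definition Lpnorm (rho : G -> R) (p : R) (f : G -> \bar R) : \bar R :=
  (\int[mu]_x (`|f x| `^ p * (rho x)%:E)) `^ p^-1.

Definition radially_decreasing (f : G -> R) : Prop :=
  exists fbar : R -> R,
    [/\ (forall s, (0 <= s)%R -> (0 <= fbar s)%R),
        (forall s t, (0 <= s)%R -> (s <= t)%R -> (fbar t <= fbar s)%R)
      & forall x, f x = fbar (r x)].

Definition bounded_dec (p q : R) w v (T : (G -> R) -> G -> \bar R) : Prop :=
  exists2 C : R, (0 < C)%R & forall f, radially_decreasing f ->
    Lpnorm v q (T f) <= C%:E * Lpnorm w p (EFin \o f).

Definition DC v : Prop :=
  (forall K : set G, compact K -> \int[mu]_(x in K) `|v x|%:E < +oo) /\
  exists2 b : R, (1 < b)%R & forall t, (0 < t)%R ->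
    \int[mu]_(x in gball 1%g (2 * t)) (v x)%:E
      <= b%:E * \int[mu]_(x in gball 1%g t) (v x)%:E.

(* At x = 1 the power W(r(x))^(-p') takes the junk value 0; this and the value
   of r^(alpha - Q) at 1 below only concern a null set. *)
Definition tail_int (gamma p : R) w t : \bar R :=
  let p' := (p / (p - 1))%R in
  \int[mu]_(x in ~` gball 1%g t)
    ((r x `^ (gamma * p'))%:E * wint w (r x) `^ (- p') * (w x)%:E).

Definition DC_tail (Q gamma p : R) w : Prop :=
  [/\ (1 < p)%R, (0 < gamma < Q / p)%R &
    exists2 b : R, (0 < b)%R & forall t, (0 < t)%R ->
      tail_int gamma p w t <= b%:E * tail_int gamma p w (2 * t)].

Definition riesz_potential (Q alpha : R) (f : G -> R) (x : G) : \bar R :=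
  \int[mu]_y (f y * r (x * y^-1)%g `^ (alpha - Q))%:E.

End weighted_notions.

(* Main.v *)
(** Let U(y) = W(r(y)). By Hardy's inequality a radially decreasing f satisfies
    f(x) <= 4 \int_{r(y) >= r(x)} h w / U for some h whose norm in L^p(w) is
    comparable with that of f. Inserting this in I_alpha f produces the integral
    of (h w / U)(y) K(x, r(y)), where K(x, s) = \int_{r <= s} r(x z^-1)^(alpha-Q) dz
    is comparable with r(x)^(alpha-Q) s^Q for s <= r(x) and with s^alpha for
    s >= r(x). The two resulting Hardy operators are bounded, for p <= q, under
    (ii) and (iii). Conversely, (i) follows by testing on balls, (ii) and (iii)
    by testing on f_E(x) = \int_{E, r(y) >= r(x)} kappa^(p'-1) U^(-p') w with
    kappa = r^Q or r^alpha and E an annulus; the norm of f_E is again controlled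
    by Hardy's inequality.

    The group enters through |{y : r(x y^-1) < t}| = t^Q. These balls are right
    translates whereas the Haar measure is only known to be left-invariant, so it
    is compared with the Lebesgue measure in the coordinates of an eigenbasis of
    the generator A: a multiplication that is C^1 and commutes with the dilations
    is unipotent triangular in these coordinates, ordered by eigenvalue. Hence
    iterated Lebesgue integration is bi-invariant, and Fubini's theorem yields
    uniqueness. *)
Require Import Defs.
From HB Require Import structures.
From mathcomp Require Import all_boot all_order all_algebra.
From mathcomp Require Import all_classical all_reals all_analysis.
From mathcomp Require Import measurable_realfun.
From mathcomp Require Import ring lra.
Import Order.TTheory GRing.Theory Num.Theory.
Import numFieldNormedType.Exports.
Local Open Scope classical_set_scope.
Local Open Scope ring_scope.
Local Open Scope ereal_scope.
Set Implicit Arguments.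
Unset Strict Implicit.
Unset Printing Implicit Defensive.

(** * Weighted Hardy inequality *)

(** No inverse of W and no density in the radial variable is used. Everything is phrased through
    sets cut out by r or by a tail integral Phi, and limits along such sets, whose extreme level may
    or may not be attained, are taken by [integral_upsets_le]. The main information on w is that the
    set where W(r) < c has w-mass c, so powers of W(r) integrate against w like powers on the
    half-line. Hardy's inequality is proved by cutting along dyadic values of Phi; p <= q enters as
    a^(q/p) <= s^(q/p-1) a for a <= s, which makes the pieces summable. The exponent p'-1 in f_E is
    the one for which, up to constants, the p-th power of the norm and the coefficient in the lower
    bound for the potential are the same integral N; comparing N with N^(1/p) leaves N^(1/p'). That
    division needs N finite, hence annuli. A real power of 0 with nonzero exponent is 0 by
    convention, so lower bounds for singular kernels hold only off null sets, which are removed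
    explicitly. *)

Section upsets.
Context d (T : measurableType d) (R : realType).
Variable mu : {measure set T -> \bar R}.
Implicit Types (rho : T -> R) (g : T -> \bar R) (E : set T).

Lemma measurable_ge_fun rho (a : R) : measurable_fun setT rho ->
  measurable [set y | (a <= rho y)%R].
Proof.
move=> mrho; rewrite -[X in measurable X]setTI.
rewrite (_ : [set y | _] = rho @^-1` `[a, +oo[%classic).
  exact: mrho.
by apply/seteqP; split => x /=; rewrite in_itv/= andbT.
Qed.

(** If [rho] has a minimum on [E], one of the sets in the hypothesis is already [E]. Otherwise [E]
    is a countable increasing union of subsets of such sets, cut at rational levels, and monotone
    convergence applies. This replaces the choice of a sequence of levels tending to the infimum,
    and serves below to pass from truncated to full domains. *)
Lemma integral_upsets_le rho g E (c : \bar R) :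
  measurable E -> measurable_fun setT rho -> measurable_fun E g ->
  (forall x, E x -> 0 <= g x) -> 0 <= c ->
  (forall x, E x ->
    \int[mu]_(y in E `&` [set y | (rho x <= rho y)%R]) g y <= c) ->
  \int[mu]_(y in E) g y <= c.
Proof.
move=> mE mrho mg g0 c0 H.
have [[x0 [Ex0 x0min]]|nomin] :=
    pselect (exists x0, E x0 /\ forall y, E y -> (rho x0 <= rho y)%R).
  by rewrite (_ : E = E `&` [set y | (rho x0 <= rho y)%R]) ?H//; apply/seteqP;
     split => [y Ey|y []//]; split => //; exact: x0min.
(* The [i]-th rational contributes only if some point of [E] has level at most that rational; then
   any finite union of the [P i] meets [E] inside the superlevel set of a single point of [E]. *)
pose P (i : nat) : set T := if unpickle i is Some q then
  [set y | (exists2 x, E x & (rho x <= ratr q)%R) /\ (ratr q <= rho y)%R]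
  else set0.
pose F n := E `&` \bigcup_(i in `I_n) P i.
have mP i : measurable (P i).
  rewrite /P; case: unpickle => [q|//].
  have [ex|nex] := pselect (exists2 x, E x & (rho x <= ratr q :> R)%R).
    rewrite (_ : [set y | _] = [set y | (ratr q <= rho y)%R]).
      exact: measurable_ge_fun.
    by apply/seteqP; split => [y []|y].
  by rewrite (_ : [set y | _] = set0)//; apply/seteqP; split => [y []|y].
have mF n : measurable (F n).
  by apply: measurableI => //; apply: bigcup_measurable => i _; exact: mP.
have ndF : nondecreasing_seq F.
  move=> m n mn; apply/subsetPset => y [Ey [i /= im Piy]]; split => //.
  by exists i => //=; exact: leq_trans im mn.
have EF : E = \bigcup_n F n.
  apply/seteqP; split => [y Ey|y [n _ []]//].
  have [x Ex xy] : exists2 x, E x & (rho x < rho y)%R.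
    apply: contrapT => nx; apply: nomin; exists y; split => // z Ez.
    by rewrite leNgt; apply/negP => zy; apply: nx; exists z.
  have [q] := rat_in_itvoo xy; rewrite in_itv/= => /andP[xq qy].
  have [m Em] : exists m, unpickle m = Some q by exists (pickle q); exact: pickleK.
  exists m.+1 => //; split => //; exists m => /=; first exact: ltnSn.
  by rewrite /P Em; split; [exists x => //|]; exact: ltW.
have [[x0 Ex0]|E0] := pselect (exists x, E x); last first.
  rewrite (_ : E = set0) ?integral_set0//.
  by apply/seteqP; split => // x Ex; apply: E0; exists x.
have Fsub n : exists2 x, E x & F n `<=` [set y | (rho x <= rho y)%R].
  elim: n => [|n [x Ex Fx]].
    by exists x0 => // y [_ [i]].
  pose S := [set y | P n y].
  have [[y [Ey Pny]]|nP] := pselect (exists y, E y /\ P n y).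
    move: (Pny); rewrite /P; case Eq : (unpickle n) => [q|//] [[z Ez zq] qy].
    exists (if (rho x <= rho z)%R then x else z); first by case: ifP.
    move=> u [Eu [i /=]]; rewrite ltnS leq_eqVlt => /predU1P[->|ni Piu].
      rewrite /P Eq => -[_ qu]; case: ifPn => [xz|_].
        exact: le_trans xz (le_trans zq qu).
      exact: le_trans zq qu.
    have xu : (rho x <= rho u)%R by apply: Fx; split => //; exists i.
    by case: ifPn => //; rewrite -ltNge => /ltW zx; exact: le_trans zx xu.
  exists x => // u [Eu [i /=]]; rewrite ltnS leq_eqVlt => /predU1P[-> Pnu|ni Piu].
    by case: nP; exists u.
  by apply: Fx; split => //; exists i.
have := @ge0_nondecreasing_set_cvg_integral _ _ _ F g mu ndF mF
  (fun i => measurable_funS mE (@subIsetl _ _ _) mg) (fun i x Fx => g0 x Fx.1).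
rewrite -EF => cvgF; rewrite -(cvg_lim _ cvgF)//; apply: lime_le.
  by apply/cvg_ex; eexists; exact: cvgF.
apply: nearW => n; have [x Ex Fx] := Fsub n.
apply: le_trans (H _ Ex); apply: ge0_subset_integral => //.
- apply: measurableI => //; exact: measurable_ge_fun.
- by apply: measurable_funS mg => //; exact: subIsetl.
- by move=> y []/g0.
- by move=> y Fy; split; [exact: Fy.1|exact: Fx].
Qed.

End upsets.

Section powR_monotone.
Context {R : realType}.
Implicit Types x y s : R.
Local Open Scope ring_scope.

Lemma powR_le x y s : 0 <= s -> 0 <= x -> x <= y -> x `^ s <= y `^ s.
Proof.
by move=> s0 x0 xy; apply: ge0_ler_powR; rewrite ?nnegrE// (le_trans x0).
Qed.

Lemma powR_le_neg x y s : s <= 0 -> 0 < x -> x <= y -> y `^ s <= x `^ s.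
Proof.
move=> s0 x0 xy; rewrite -[s]opprK !(powRN _ (- s)).
rewrite lef_pV2 ?posrE ?powR_gt0 ?(lt_le_trans x0)//.
by apply: powR_le; rewrite ?oppr_ge0// ltW.
Qed.

End powR_monotone.

Section power_rules.
Context d (T : measurableType d) (R : realType).
Variable mu : {measure set T -> \bar R}.
Implicit Types (f g h k w U : T -> R) (D : set T) (p : R).

Lemma measurable_fun_powR D f p : measurable_fun D f ->
  measurable_fun D (fun x => (f x `^ p)%R).
Proof. exact: (@measurableT_comp _ _ _ _ _ _ (@powR R ^~ p)). Qed.

Lemma integral_mul_indic D f :
  \int[mu]_x (f x * \1_D x)%:E = \int[mu]_(x in D) (f x)%:E.
Proof.
rewrite [RHS]integral_mkcond; apply: eq_integral => x _.
by rewrite patchE indicE; case: ifP => _; rewrite ?mulr1 ?mulr0.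
Qed.

(** Hoelder's inequality for [mu] applied to [h * w ^ (1/p)] and [k * w ^ (1/p')], both cut to [D];
    the powers of [w] multiply to [w] because [1/p + 1/p' = 1]. *)
Lemma weighted_hoelder D h k w p (p' := (p / (p - 1))%R) :
  measurable D -> measurable_fun setT h -> measurable_fun setT k ->
  measurable_fun setT w -> (forall x, 0 <= h x)%R -> (forall x, 0 <= k x)%R ->
  (forall x, 0 <= w x)%R -> (1 < p)%R ->
  \int[mu]_(x in D) (h x * k x * w x)%:E <=
    (\int[mu]_(x in D) (h x `^ p * w x)%:E) `^ p^-1 *
    (\int[mu]_(x in D) (k x `^ p' * w x)%:E) `^ p'^-1.
Proof.
move=> mD mh mk mw h0 k0 w0 p1.
have p0 : (0 < p)%R by lra.
have p10 : (0 < p - 1)%R by lra.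
have p'0 : (0 < p')%R by rewrite divr_gt0.
have pp' : (p^-1 + p'^-1 = 1)%R.
  by rewrite /p' invf_div; field; rewrite gt_eqF.
pose F x := (h x * w x `^ p^-1 * \1_D x)%R.
pose G x := (k x * w x `^ p'^-1 * \1_D x)%R.
have m1 : measurable_fun setT (\1_D : T -> R) by exact: measurable_indic.
have mF : measurable_fun setT F.
  by do 2?[apply: measurable_funM => //]; exact: measurable_fun_powR.
have mG : measurable_fun setT G.
  by do 2?[apply: measurable_funM => //]; exact: measurable_fun_powR.
have := hoelder mu mF mG p0 p'0 pp'.
have powE (u : T -> R) (s : R) x : (0 < s)%R -> (0 <= u x)%R ->
    (`|u x * w x `^ s^-1 * \1_D x| `^ s = u x `^ s * w x * \1_D x)%R.
  move=> s0 u0; rewrite ger0_norm ?mulr_ge0 ?powR_ge0//.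
  rewrite !powRM ?mulr_ge0 ?powR_ge0// -powRrM mulVf ?gt_eqF// powRr1//.
  by rewrite indicE; case: (_ \in _); rewrite ?powR1 ?powR0 ?gt_eqF.
have LE (u : T -> R) (s : R) : (0 < s)%R -> (forall x, 0 <= u x)%R ->
    Lnorm mu s%:E (EFin \o (fun x => u x * w x `^ s^-1 * \1_D x)%R) =
    (\int[mu]_(x in D) (u x `^ s * w x)%:E) `^ s^-1.
  move=> s0 u0; rewrite unlock -(integral_mul_indic D (fun x => u x `^ s * w x)%R).
  congr (_ `^ _).
  by apply: eq_integral => x _; rewrite /= powE.
rewrite [X in _ <= X * _](LE h) // [X in _ <= _ * X](LE k) //.
apply: le_trans.
rewrite Lnorm1 -(integral_mul_indic D (fun x => h x * k x * w x)%R).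
rewrite le_eqVlt; apply/orP; left; apply/eqP; apply: eq_integral => x _ /=.
rewrite /F /G ger0_norm ?mulr_ge0 ?powR_ge0//; congr EFin.
rewrite mulrACA (mulrACA (h x)) -powRD ?pp' ?powRr1 ?oner_eq0//.
by congr (_ * _)%R; rewrite indicE; case: (_ \in _); rewrite ?mulr1 ?mulr0.
Qed.

(* Dominate [U `^ theta] on [D] by the sum over the levels [a * eta ^+ j] of
   multiples of the indicators of sublevel sets of [U]. *)
Lemma integral_powR_levels D w U (K beta theta a eta : R)
    (z := (eta `^ (beta + theta))%R) :
  measurable D -> measurable_fun setT w -> measurable_fun setT U ->
  (forall x, 0 <= w x)%R ->
  (theta < 0)%R -> (0 <= K)%R -> (0 < a)%R -> (0 < eta)%R -> (z < 1)%R ->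
  (forall c, (0 < c)%R ->
     \int[mu]_(x in [set x | U x < c]%R) (w x)%:E <= (K * c `^ beta)%:E) ->
  (forall x, D x -> U x = 0%R \/
     exists j : nat, (a * eta ^+ j <= U x < 4 * (a * eta ^+ j))%R) ->
  \int[mu]_(x in D) (U x `^ theta * w x)%:E <=
    (K * 4 `^ beta * a `^ (beta + theta) / (1 - z))%:E.
Proof.
move=> mD mw mU w0 th0 K0 a0 eta0 z1 massU DU.
pose l (j : nat) := (a * eta ^+ j)%R.
have l0 j : (0 < l j)%R by rewrite mulr_gt0// exprn_gt0.
pose t (j : nat) (x : T) :=
  (l j `^ theta * (w x * \1_[set x | U x < 4 * l j]%R x))%:E.
have t0 j x : 0 <= t j x.
  by rewrite lee_fin mulr_ge0 ?powR_ge0// mulr_ge0.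
have mS c : measurable [set x | U x < c]%R.
  rewrite -[X in measurable X]setTI (_ : [set x | _] = U @^-1` `]-oo, c[%classic).
    exact: mU.
  by apply/seteqP; split => x /=; rewrite in_itv.
have mt j : measurable_fun setT (t j).
  by apply/measurable_EFinP; do 2?[apply: measurable_funM => //]; exact: measurable_indic.
have z0 : (0 <= z)%R by exact: powR_ge0.
apply: (@le_trans _ _ (\int[mu]_x (\sum_(j <oo) t j x))).
  apply: (@le_trans _ _ (\int[mu]_(x in D) (\sum_(j <oo) t j x))); last first.
    apply: ge0_subset_integral => //; first exact: ge0_emeasurable_sum.
    by move=> x _; apply: nneseries_ge0.
  apply: ge0_le_integral => //.
  - by move=> x _; rewrite lee_fin mulr_ge0// powR_ge0.
  - apply: measurable_funTS; apply/measurable_EFinP; apply: measurable_funM => //.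
    exact: measurable_fun_powR.
  - by apply: measurable_funTS; apply: ge0_emeasurable_sum.
  (* Where [U] vanishes the integrand is 0, since [powR] sends 0 to 0 for a nonzero exponent;
     elsewhere the one term of a level containing [x] is large enough. *)
  move=> x Dx; have [Ux0|[j /andP[lU Ul]]] := DU _ Dx.
    by rewrite Ux0 powR0 ?lt_eqF// mul0r nneseries_ge0.
  apply: (@le_trans _ _ (t j x)); last first.
    have := @nneseries_lim_ge _ (t ^~ x) xpredT 0 j.+1 (fun i _ _ => t0 i x).
    apply: le_trans; rewrite big_nat_recr//= leeDr// sume_ge0//.
  rewrite /t lee_fin indicE mem_set//= mulr1 ler_wpM2r//.
  have Up : (0 < U x)%R by exact: lt_le_trans (l0 j) lU.
  by apply: powR_le_neg; rewrite // ltW.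
rewrite integral_nneseries//.
(* Level [j] costs [l j ^ theta] times a mass of at most [K * (4 * l j) ^ beta], which is geometric
   in [j] with ratio [z]. *)
apply: (@le_trans _ _ (\sum_(j <oo) (geometric (K * 4 `^ beta * a `^ (beta + theta))%R z j)%:E)).
  apply: lee_nneseries => [j _ _|j _].
    exact: integral_ge0.
  rewrite /t; under eq_integral do rewrite EFinM.
  rewrite ge0_integralZl//; last 3 first.
  - by apply/measurable_EFinP; apply: measurable_funM => //; exact: measurable_indic.
  - by move=> x _; rewrite lee_fin mulr_ge0.
  - by rewrite lee_fin powR_ge0.
  rewrite integral_mul_indic.
  apply: le_trans (lee_wpmul2l _ (massU _ _)) _.
  - by rewrite lee_fin powR_ge0.
  - by rewrite mulr_gt0.
  have l0' := ltW (l0 j).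
  rewrite -EFinM lee_fin /geometric /= powRM//.
  rewrite (_ : (_ * (K * _) = K * 4 `^ beta * (l j `^ beta * l j `^ theta))%R); last by ring.
  rewrite -powRD; last by apply/implyP => _; rewrite gt_eqF.
  rewrite /l powRM ?(ltW a0) ?(ltW (exprn_gt0 _ _))// !mulrA.
  by rewrite -(powR_mulrn _ (ltW eta0)) powRAC powR_mulrn ?powR_ge0.
rewrite le_eqVlt; apply/orP; left; apply/eqP.
have : series (geometric (K * 4 `^ beta * a `^ (beta + theta))%R z) @ \oo -->
    (K * 4 `^ beta * a `^ (beta + theta) / (1 - z))%R.
  by apply: cvg_geometric_series; rewrite ger0_norm.
move=> cv; apply/cvg_lim => //; apply: cvg_EFin.
  by apply: nearW => n /=; rewrite sumEFin.
by apply: cvg_trans cv; apply: near_eq_cvg; apply: nearW => n /=; rewrite sumEFin.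
Qed.

Lemma dyadic_level (x : R) : (1 <= x)%R ->
  exists j : nat, ((2 ^+ j <= x) && (x < 2 * 2 ^+ j))%R.
Proof.
move=> x1; exists (trunc_log 2 (Num.truncn x)).
have x0 : (0 <= x)%R by lra.
have nx : (0 < Num.truncn x)%N by rewrite truncn_gt0.
have /andP[nx1 nx2] := truncn_itv x0; apply/andP; split.
  by apply: le_trans nx1; rewrite -natrX ler_nat trunc_logP.
by rewrite -exprS (lt_le_trans nx2)// -natrX ler_nat trunc_log_ltn.
Qed.

(** The levels descend by halving and the series converges because [beta + theta > 0]. It is used
    for the singular kernel on a ball, with [beta = Q] and [theta = alpha - Q]. *)
Lemma integral_powR_sublevel w U (K beta theta : R) :
  measurable_fun setT w -> measurable_fun setT U ->
  (forall x, 0 <= w x)%R -> (forall x, 0 <= U x)%R ->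
  (theta < 0)%R -> (0 < beta + theta)%R -> (0 <= K)%R ->
  (forall c, (0 < c)%R ->
     \int[mu]_(x in [set x | U x < c]%R) (w x)%:E <= (K * c `^ beta)%:E) ->
  forall a, (0 < a)%R ->
  \int[mu]_(x in [set x | U x < a]%R) (U x `^ theta * w x)%:E <=
    (K * 4 `^ beta / (1 - 2^-1 `^ (beta + theta)) * a `^ (beta + theta))%:E.
Proof.
move=> mw mU w0 U0 th0 bt0 K0 massU a a0.
have mS : measurable [set x | U x < a]%R.
  rewrite -[X in measurable X]setTI (_ : [set x | _] = U @^-1` `]-oo, a[%classic).
    exact: mU.
  by apply/seteqP; split => x /=; rewrite in_itv.
have z1 : (2^-1 `^ (beta + theta) < 1 :> R)%R.
  have := @gt0_ltr_powR R _ bt0 2^-1%R 1%R; rewrite !nnegrE powR1; apply; lra.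
have a20 : (0 < a / 2)%R by lra.
have e20 : (0 < 2^-1 :> R)%R by lra.
apply: le_trans (integral_powR_levels mS mw mU w0 th0 K0 a20 e20 z1 massU _) _.
  move=> x /= Ua; have := U0 x; rewrite le_eqVlt => /predU1P[<-|Up]; [by left|right].
  (* This puts [U x] above [(a / 2) * 2^-j] and at most [a * 2^-j]. The closed right end is why the
     levels start at [a / 2] with a window of ratio 4 rather than 2. *)
  have [|j /andP[j1 j2]] := @dyadic_level (a / U x)%R.
    by rewrite ler_pdivlMr// mul1r ltW.
  exists j; rewrite exprVn.
  have p2 : (0 < 2 ^+ j :> R)%R by rewrite exprn_gt0.
  rewrite ler_pdivlMr// in j1; rewrite ltr_pdivrMr// in j2.
  apply/andP; split; first by rewrite ler_pdivrMr//; nra.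
  by rewrite mulrA ltr_pdivlMr//; nra.
rewrite lee_fin [leRHS]mulrAC ler_wpM2r ?invr_ge0 ?subr_ge0 ?(ltW z1)//.
rewrite ler_wpM2l ?mulr_ge0 ?powR_ge0//.
by apply: powR_le; lra.
Qed.

(** Here the levels double upwards from [a], and [beta + theta < 0] makes the series converge. It is
    used for tails of negative powers of W(r), with [beta = 1]. *)
Lemma integral_powR_superlevel w U (K beta theta : R) :
  measurable_fun setT w -> measurable_fun setT U ->
  (forall x, 0 <= w x)%R ->
  (theta < 0)%R -> (beta + theta < 0)%R -> (0 <= K)%R ->
  (forall c, (0 < c)%R ->
     \int[mu]_(x in [set x | U x < c]%R) (w x)%:E <= (K * c `^ beta)%:E) ->
  forall a, (0 < a)%R ->
  \int[mu]_(x in [set x | a <= U x]%R) (U x `^ theta * w x)%:E <=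
    (K * 4 `^ beta / (1 - 2 `^ (beta + theta)) * a `^ (beta + theta))%:E.
Proof.
move=> mw mU w0 th0 bt0 K0 massU a a0.
have mS : measurable [set x | a <= U x]%R by exact: measurable_ge_fun.
have z1 : (2 `^ (beta + theta) < 1 :> R)%R.
  rewrite -[X in powR _ X]opprK powRN invf_lt1 ?powR_gt0//.
  have := @gt0_ltr_powR R (- (beta + theta))%R _ 1%R 2%R.
  by rewrite !nnegrE powR1; apply; lra.
have e20 : (0 < 2 :> R)%R by lra.
apply: le_trans (integral_powR_levels mS mw mU w0 th0 K0 a0 e20 z1 massU _) _.
  move=> x /= Ua; right.
  have [|j /andP[j1 j2]] := @dyadic_level (U x / a)%R.
    by rewrite ler_pdivlMr// mul1r.
  exists j; have p2 : (0 < 2 ^+ j :> R)%R by rewrite exprn_gt0.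
  rewrite ler_pdivlMr// in j1; rewrite ltr_pdivrMr// in j2.
  by apply/andP; split; nra.
by rewrite lee_fin [leRHS]mulrAC.
Qed.

End power_rules.

Section poweR_monotone.
Context {R : realType}.
Implicit Types (x y : \bar R) (s : R).

Lemma poweR_le x y s : (0 <= s)%R -> 0 <= x -> x <= y -> x `^ s <= y `^ s.
Proof.
move=> s0 x0 xy; apply: gt0_ler_poweR; rewrite // in_itv/= leey andbT//.
exact: le_trans xy.
Qed.

Lemma poweRK x s : s != 0%R -> 0 <= x -> (x `^ s) `^ s^-1 = x.
Proof. by move=> s0 x0; rewrite -poweRrM mulfV// poweRe1. Qed.

Lemma poweRVK x s : s != 0%R -> 0 <= x -> (x `^ s^-1) `^ s = x.
Proof. by move=> s0 x0; rewrite -poweRrM mulVf// poweRe1. Qed.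

End poweR_monotone.

Lemma nneseries_shift_le (R : realType) (u : (\bar R)^nat) :
  (forall n, 0 <= u n) -> \sum_(n <oo) u n.+1 <= \sum_(n <oo) u n.
Proof.
move=> u0; rewrite [leRHS]nneseries_recl// -(@nneseries_addn _ u 1)//.
rewrite [X in _ + X](eq_eseriesr (g := fun n => u n.+1)); first exact: leeDr.
by move=> n _; rewrite addn1.
Qed.

Section tail_integral.
Context d (T : measurableType d) (R : realType).
Variable mu : {sigma_finite_measure set T -> \bar R}.

Lemma measurable_xsection_integral d' (T' : measurableType d') (S : set (T' * T))
    (g : T -> R) :
  measurable S -> measurable_fun setT g -> (forall y, 0 <= g y)%R ->
  measurable_fun setT (fun x => \int[mu]_(y in [set y | S (x, y)]) (g y)%:E).
Proof.
move=> mS mg g0.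
pose F (z : T' * T) := (g z.2 * \1_S z)%:E.
have mF : measurable_fun setT F.
  apply/measurable_EFinP; apply: measurable_funM; last exact: measurable_indic.
  exact: measurableT_comp mg (@measurable_snd _ _ T' T).
have F0 z : 0 <= F z by rewrite lee_fin mulr_ge0.
have := @measurable_fun_fubini_tonelli_F _ _ _ _ _ mu F mF F0.
rewrite (_ : fubini_F mu F =
    fun x => \int[mu]_(y in [set y | S (x, y)]) (g y)%:E)//.
apply/funext => x; rewrite /fubini_F -[RHS]integral_mul_indic.
by apply: eq_integral => y _; rewrite /F /= !indicE.
Qed.

Lemma measurable_tail_integral (rho g : T -> R) :
  measurable_fun setT rho -> measurable_fun setT g -> (forall y, 0 <= g y)%R ->
  measurable_fun setT
    (fun x => \int[mu]_(y in [set y | rho x <= rho y]%R) (g y)%:E).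
Proof.
move=> mrho mg g0.
apply: (@measurable_xsection_integral _ _ [set z : T * T | rho z.1 <= rho z.2]%R) => //.
rewrite -[X in measurable X]setTI.
rewrite (_ : [set z | _] = (fun z : T * T => (rho z.1 <= rho z.2)%R) @^-1` [set true]).
  apply: measurable_fun_ler => //.
  - exact: measurableT_comp mrho (@measurable_fst _ _ T T).
  - exact: measurableT_comp mrho (@measurable_snd _ _ T T).
by apply/seteqP; split => x /=.
Qed.

End tail_integral.

(** * Hardy's inequality by dyadic levels of the tail integral *)

Section hardy.
Context d (T : measurableType d) (R : realType).
Variable mu : {sigma_finite_measure set T -> \bar R}.
Variables (rho h k w v : T -> R) (p q A : R).
Let p' := (p / (p - 1))%R.
Hypotheses (mrho : measurable_fun setT rho) (mh : measurable_fun setT h)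
  (mk : measurable_fun setT k) (mw : measurable_fun setT w)
  (mv : measurable_fun setT v).
Hypotheses (h0 : forall x, (0 <= h x)%R) (k0 : forall x, (0 <= k x)%R)
  (w0 : forall x, (0 <= w x)%R) (v0 : forall x, (0 <= v x)%R).
Hypotheses (p1 : (1 < p)%R) (pq : (p <= q)%R) (A0 : (0 < A)%R).
Hypothesis null_level : forall t, \int[mu]_(x in [set x | rho x = t]) (v x)%:E = 0.
Hypothesis muckenhoupt : forall t,
  (\int[mu]_(x in [set x | rho x < t]%R) (v x)%:E) `^ q^-1 *
  (\int[mu]_(x in [set x | t <= rho x]%R) (k x `^ p' * w x)%:E) `^ p'^-1 <= A%:E.

Let g x := (h x * k x * w x)%R.
Let Phi x := \int[mu]_(y in [set y | rho x <= rho y]%R) (g y)%:E.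

Let g0 x : (0 <= g x)%R. Proof. by rewrite !mulr_ge0. Qed.
Let mg : measurable_fun setT g.
Proof. by do 2?[apply: measurable_funM => //]. Qed.
Let mge a : measurable [set y | a <= rho y]%R.
Proof. exact: measurable_ge_fun. Qed.
Let mlt a : measurable [set y | rho y < a]%R.
Proof.
rewrite (_ : [set y | _] = ~` [set y | a <= rho y]%R); first exact: measurableC.
by apply/seteqP; split => x /=; rewrite ltNge => /negP.
Qed.
Let Phi0 x : 0 <= Phi x.
Proof. by apply: integral_ge0 => y _; rewrite lee_fin. Qed.
Let mPhi : measurable_fun setT Phi.
Proof. exact: measurable_tail_integral. Qed.
Let le_Phi x y : (rho x <= rho y)%R -> Phi y <= Phi x.
Proof.
move=> xy; apply: ge0_subset_integral => //.
- by apply: measurable_funTS; exact/measurable_EFinP.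
- by move=> z _; rewrite lee_fin.
- by move=> z /=; exact: le_trans.
Qed.
Let p0 : (0 < p)%R. Proof. exact: lt_trans p1. Qed.
Let q0 : (0 < q)%R. Proof. exact: lt_le_trans pq. Qed.
Let p'0 : (0 < p')%R. Proof. by rewrite divr_gt0// subr_gt0. Qed.

(** The exhaustion lemma for [- rho]. Its sets contain the level through [x], which [null_level]
    discards, so the open sublevel sets of the Muckenhoupt condition suffice. *)
Let integral_downset_le (E : set T) (c : \bar R) : measurable E -> 0 <= c ->
  (forall x, E x -> \int[mu]_(y in [set y | rho y < rho x]%R) (v y)%:E <= c) ->
  \int[mu]_(x in E) (v x)%:E <= c.
Proof.
move=> mE c0 H.
apply: (@integral_upsets_le _ _ _ _ (fun x => - rho x)%R) => //.
- exact: measurable_funN.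
- by apply: measurable_funTS; exact/measurable_EFinP.
- by move=> x _; rewrite lee_fin.
move=> x Ex; apply: le_trans (H _ Ex).
have meq : measurable [set y | rho y = rho x].
  by rewrite -[X in measurable X]setTI; exact: (mrho measurableT (measurable_set1 _)).
rewrite -[leRHS]adde0 -(null_level (rho x)) -ge0_integral_setU//.
- apply: ge0_subset_integral => //.
  + apply: measurableI => //.
    by apply: measurable_ge_fun; exact: measurable_funN.
  + exact: measurableU.
  + by apply: measurable_funTS; exact/measurable_EFinP.
  + by move=> y _; rewrite lee_fin.
  + move=> y [_ /=]; rewrite lerN2 le_eqVlt => /predU1P[->|]; first by right.
    by left.
- by apply: measurable_funTS; exact/measurable_EFinP.
- by move=> y _; rewrite lee_fin.
- by apply/disj_set2P/seteqP; split => // y [/= + E1]; rewrite E1 ltxx.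
Qed.

Let mle_Phi c : measurable [set x | c <= Phi x].
Proof. by rewrite -[X in measurable X]setTI; exact: emeasurable_fun_c_infty. Qed.
Let mlt_Phi c : measurable [set x | Phi x < c].
Proof. by rewrite -[X in measurable X]setTI; exact: emeasurable_fun_infty_o. Qed.

(** The points with [Phi < c] contribute at most [c]: beyond any such [y] the whole integral is
    [Phi y < c], and [integral_upsets_le] exhausts them. If the rest contributed less than [c], the
    total would stay below [2 * c]. *)
Let level_integral (c : R) x : (0 < c)%R -> (2 * c)%:E <= Phi x ->
  c%:E <= \int[mu]_(y in [set y | rho x <= rho y]%R `&` [set y | c%:E <= Phi y]) (g y)%:E.
Proof.
move=> c0 cPhi; set B := [set y | rho x <= rho y]%R.
have mB : measurable B by exact: mge.
have mgS S : measurable_fun S (EFin \o g).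
  by apply: measurable_funTS; exact/measurable_EFinP.
have small : \int[mu]_(y in B `&` [set y | Phi y < c%:E]) (g y)%:E <= c%:E.
  apply: (@le_trans _ _ (\int[mu]_(y in [set y | Phi y < c%:E]) (g y)%:E)).
    by apply: ge0_subset_integral => //; [exact: measurableI|move=> y _; rewrite lee_fin].
  apply: (@integral_upsets_le _ _ _ _ rho) => //.
  - by move=> y _; rewrite lee_fin.
  - by rewrite lee_fin ltW.
  move=> y /= yc; apply: (le_trans _ (ltW yc)).
  apply: ge0_subset_integral => //; first exact: measurableI.
  by move=> z _; rewrite lee_fin.
rewrite leNgt; apply/negP => lc; move: cPhi; rewrite leNgt => /negP; apply.
have -> : Phi x = \int[mu]_(y in B `&` [set y | c%:E <= Phi y]) (g y)%:E +
    \int[mu]_(y in B `&` [set y | Phi y < c%:E]) (g y)%:E.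
  rewrite -ge0_integral_setU//; try exact: measurableI.
  - rewrite -setIUr (_ : _ `|` _ = setT) ?setIT//.
    by apply/seteqP; split => // y _ /=; case: (leP c%:E (Phi y)) => ?; [left|right].
  - by move=> y _; rewrite lee_fin.
  - apply/disj_set2P/seteqP; split => // y [[_ /= H1] [_ /=]].
    by rewrite ltNge H1.
rewrite mulr_natl mulr2n EFinD; apply: lte_leD => //.
by rewrite ge0_fin_numE ?(le_lt_trans small) ?ltry// integral_ge0// => y _; rewrite lee_fin.
Qed.

Let hp_ge0 S : 0 <= \int[mu]_(y in S) (h y `^ p * w y)%:E.
Proof. by apply: integral_ge0 => y _; rewrite lee_fin mulr_ge0 ?powR_ge0. Qed.
Let kp_ge0 S : 0 <= \int[mu]_(y in S) (k y `^ p' * w y)%:E.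
Proof. by apply: integral_ge0 => y _; rewrite lee_fin mulr_ge0 ?powR_ge0. Qed.
Let v_ge0 S : 0 <= \int[mu]_(y in S) (v y)%:E.
Proof. by apply: integral_ge0 => y _; rewrite lee_fin. Qed.
Let mhp S : measurable_fun S (fun y => (h y `^ p * w y)%:E).
Proof.
apply: measurable_funTS; apply/measurable_EFinP; apply: measurable_funM => //.
exact: measurable_fun_powR.
Qed.
Let mkp S : measurable_fun S (fun y => (k y `^ p' * w y)%:E).
Proof.
apply: measurable_funTS; apply/measurable_EFinP; apply: measurable_funM => //.
exact: measurable_fun_powR.
Qed.

(** Hoelder's inequality keeps [h] on [G] only and extends [k] to the whole tail, where the
    Muckenhoupt condition applies. *)
Let tail_bound (G : set T) x : measurable G ->
  (\int[mu]_(y in [set y | rho x <= rho y]%R `&` G) (g y)%:E) *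
  (\int[mu]_(y in [set y | rho y < rho x]%R) (v y)%:E) `^ q^-1 <=
  (\int[mu]_(y in G) (h y `^ p * w y)%:E) `^ p^-1 * A%:E.
Proof.
move=> mG; set B := [set y | rho x <= rho y]%R.
have mB : measurable B by exact: mge.
have mBG : measurable (B `&` G) by exact: measurableI.
apply: (@le_trans _ _ ((\int[mu]_(y in G) (h y `^ p * w y)%:E) `^ p^-1 *
    (\int[mu]_(y in B) (k y `^ p' * w y)%:E) `^ p'^-1 *
    (\int[mu]_(y in [set y | rho y < rho x]%R) (v y)%:E) `^ q^-1)).
  apply: lee_wpmul2r; first exact: poweR_ge0.
  apply: le_trans (@weighted_hoelder _ _ _ mu (B `&` G) h k w p _ _ _ _ _ _ _ _) _ => //.
  apply: lee_pmul; rewrite ?poweR_ge0//; apply: poweR_le; rewrite ?invr_ge0 ?(ltW p0) ?(ltW p'0)//.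
  - apply: ge0_subset_integral => //.
    by move=> y _; rewrite lee_fin mulr_ge0 ?powR_ge0.
  - apply: ge0_subset_integral => //.
    by move=> y _; rewrite lee_fin mulr_ge0 ?powR_ge0.
rewrite -muleA; apply: lee_wpmul2l; first exact: poweR_ge0.
by rewrite muleC; exact: muckenhoupt.
Qed.

(** For [x] in the band, an integral of [g] of at least [c] is carried by the points beyond [x] in
    the wider band [c <= Phi < 4 * c]; the upper bound is automatic there because [Phi] decreases in
    [rho]. So [tail_bound] controls the [v]-mass before [x] uniformly in [x], and the band is
    exhausted. *)
Let level_mass (c : R) : (0 < c)%R ->
  \int[mu]_(x in [set x | (2 * c)%:E <= Phi x < (4 * c)%:E]) (v x)%:E <=
  (\int[mu]_(y in [set x | c%:E <= Phi x < (4 * c)%:E]) (h y `^ p * w y)%:E) `^ (q / p)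
    * ((A / c) `^ q)%:E.
Proof.
move=> c0.
have mband a b : measurable [set x | a <= Phi x < b].
  rewrite (_ : [set x | _] = [set x | a <= Phi x] `&` [set x | Phi x < b]).
    exact: measurableI.
  by apply/seteqP; split => x /= => [/andP[]|[-> ->]].
apply: integral_downset_le => //.
  by apply: mule_ge0; [exact: poweR_ge0|rewrite lee_fin powR_ge0].
move=> x /= /andP[x2c x4c].
set N := \int[mu]_(y in _) (v y)%:E.
have cN : c%:E * N `^ q^-1 <=
    (\int[mu]_(y in [set x | c%:E <= Phi x < (4 * c)%:E]) (h y `^ p * w y)%:E) `^ p^-1 * A%:E.
  apply: le_trans (tail_bound x (mband _ _)).
  apply: lee_wpmul2r; first exact: poweR_ge0.
  apply: (le_trans (level_integral c0 x2c)).
  apply: ge0_subset_integral => //.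
  - exact: measurableI.
  - exact: measurableI.
  - by apply: measurable_funTS; exact/measurable_EFinP.
  - by move=> y _; rewrite lee_fin.
  - move=> y /= [xy cy]; split => //; rewrite cy/=.
    exact: le_lt_trans (le_Phi xy) x4c.
have N0 : 0 <= N by exact: v_ge0.
have : (N `^ q^-1) `^ q <= ((\int[mu]_(y in [set x | c%:E <= Phi x < (4 * c)%:E])
    (h y `^ p * w y)%:E) `^ p^-1 * (A / c)%:E) `^ q.
  apply: poweR_le; rewrite ?(ltW q0) ?poweR_ge0//.
  by rewrite (EFinM A (c^-1)%R) muleA lee_pdivlMr// muleC.
rewrite poweRVK ?gt_eqF// poweRM ?poweR_ge0//; last first.
  by rewrite lee_fin divr_ge0 ?ltW.
by rewrite -poweRrM (mulrC (p^-1)%R).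
Qed.

(** If [v] had mass before a point where [Phi] is infinite, the left side of [tail_bound] would be
    infinite and its right side finite. *)
Let infinite_level : \int[mu]_y (h y `^ p * w y)%:E < +oo ->
  \int[mu]_(x in [set x | +oo <= Phi x]) (v x)%:E = 0.
Proof.
move=> hfin; apply/eqP; rewrite eq_le v_ge0 andbT.
apply: integral_downset_le => // x /=; rewrite leye_eq => /eqP Phiy.
rewrite leNgt; apply/negP => /(@poweR_gt0 _ _ (q^-1)%R) N0.
have := tail_bound x measurableT; rewrite setIT -/(Phi x) Phiy.
rewrite gt0_mulye// leye_eq => /eqP; apply/eqP; rewrite lt_eqF//.
by rewrite lte_mul_pinfty ?poweR_ge0 ?ltry// fin_num_poweR// ge0_fin_numE.
Qed.

(** The bound [Phi ^ q <= (4 * c) ^ q] cancels the [c] in [level_mass]. Since [q >= p] and the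
    integral over the band is at most [s], its power [q / p] is at most [s ^ (q / p - 1)] times the
    integral itself, which is additive over bands. *)
Let level_norm (s c : R) : (0 < c)%R ->
  \int[mu]_y (h y `^ p * w y)%:E = s%:E ->
  \int[mu]_(x in [set x | (2 * c)%:E <= Phi x < (4 * c)%:E]) (Phi x `^ q * (v x)%:E) <=
  ((4 * A) `^ q * s `^ (q / p - 1))%:E *
   \int[mu]_(y in [set x | c%:E <= Phi x < (4 * c)%:E]) (h y `^ p * w y)%:E.
Proof.
move=> c0 hs.
have mband a b : measurable [set x | a <= Phi x < b].
  rewrite (_ : [set x | _] = [set x | a <= Phi x] `&` [set x | Phi x < b]).
    exact: measurableI.
  by apply/seteqP; split => x /= => [/andP[]|[-> ->]].
have c4 : (0 <= 4 * c)%R by rewrite mulr_ge0 ?ltW.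
have mPv S : measurable_fun S (fun x => Phi x `^ q * (v x)%:E).
  apply: measurable_funTS; apply: emeasurable_funM; last exact/measurable_EFinP.
  exact: (@measurableT_comp _ _ _ _ _ _ (fun x => x `^ q) _ _ (measurable_poweR _)).
apply: (@le_trans _ _ (((4 * c) `^ q)%:E *
    \int[mu]_(x in [set x | (2 * c)%:E <= Phi x < (4 * c)%:E]) (v x)%:E)).
  rewrite -ge0_integralZl//; last 3 first.
  - by apply: measurable_funTS; exact/measurable_EFinP.
  - by move=> x _; rewrite lee_fin.
  - by rewrite lee_fin powR_ge0.
  apply: ge0_le_integral => //.
  - by move=> x _; rewrite mule_ge0 ?poweR_ge0 ?lee_fin.
  - apply: measurable_funTS; apply: emeasurable_funM => //; exact/measurable_EFinP.
  - move=> x /= /andP[_ x4c]; apply: lee_wpmul2r; rewrite ?lee_fin//.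
    by rewrite -poweR_EFin; apply: poweR_le; rewrite ?(ltW q0)// ltW.
apply: (le_trans (lee_wpmul2l _ (level_mass c0))); first by rewrite lee_fin powR_ge0.
set a := \int[mu]_(y in _) _.
have a0 : 0 <= a by exact: hp_ge0.
have as_ : a <= s%:E.
  rewrite -hs; apply: ge0_subset_integral => //.
  by move=> y _; rewrite lee_fin mulr_ge0 ?powR_ge0.
have afin : a \is a fin_num by rewrite ge0_fin_numE// (le_lt_trans as_)// ltry.
rewrite -(fineK afin) in a0 as_ *; move: (fine a) a0 as_ => {afin}b.
move=> b0 bs; rewrite lee_fin in b0; rewrite lee_fin in bs; rewrite poweR_EFin -!EFinM lee_fin mulrCA -powRM//.
  rewrite (_ : 4 * c * (A / c) = 4 * A)%R; last by field; rewrite gt_eqF.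
  rewrite mulrC -mulrA ler_wpM2l ?powR_ge0//.
  rewrite -mulr_powRB1 ?divr_gt0// mulrC ler_wpM2r//.
  by apply: powR_le => //; rewrite subr_ge0 ler_pdivlMr// mul1r.
by rewrite divr_ge0 ?ltW.
Qed.

Lemma trivIset_levels (c : R) : (0 < c)%R ->
  trivIset setT (fun j => [set x | (c * 2 ^+ j)%:E <= Phi x < (c * 2 ^+ j.+1)%:E]).
Proof.
move=> c0; apply: ltn_trivIset => i j ij; apply/seteqP; split => // x.
move=> [/andP[_ xi] /andP[jx _]]; have := le_lt_trans jx xi.
rewrite lte_fin ltr_pM2l// ltNge ler_weXn2l//; lra.
Qed.

(** Each level uses the integral of [h ^ p * w] over two consecutive dyadic bands, so every band is
    counted at most twice; this is the factor 2. *)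
Let truncated_norm (s c : R) : (0 < c)%R ->
  \int[mu]_y (h y `^ p * w y)%:E = s%:E ->
  \int[mu]_(x in [set x | (2 * c)%:E <= Phi x]) (Phi x `^ q * (v x)%:E) <=
  (2 * (4 * A) `^ q * s `^ (q / p))%:E.
Proof.
move=> c0 hs.
have mPv S : measurable_fun S (fun x => Phi x `^ q * (v x)%:E).
  apply: measurable_funTS; apply: emeasurable_funM; last exact/measurable_EFinP.
  exact: (@measurableT_comp _ _ _ _ _ _ (fun x => x `^ q) _ _ (measurable_poweR _)).
have Pv0 x : 0 <= Phi x `^ q * (v x)%:E by rewrite mule_ge0 ?poweR_ge0 ?lee_fin.
have mband a b : measurable [set x | a <= Phi x < b].
  rewrite (_ : [set x | _] = [set x | a <= Phi x] `&` [set x | Phi x < b]).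
    exact: measurableI.
  by apply/seteqP; split => x /= => [/andP[]|[-> ->]].
pose L j := [set x | (c * 2 ^+ j)%:E <= Phi x < (c * 2 ^+ j.+1)%:E].
have mL j : measurable (L j) by exact: mband.
have L2 j : L j.+1 = [set x | (2 * (c * 2 ^+ j))%:E <= Phi x < (4 * (c * 2 ^+ j))%:E].
  rewrite /L !exprS (_ : c * (2 * 2 ^+ j) = 2 * (c * 2 ^+ j))%R; last by ring.
  by rewrite (_ : c * (2 * (2 * 2 ^+ j)) = 4 * (c * 2 ^+ j))%R; last by ring.
have dec : [set x | (2 * c)%:E <= Phi x] =
    (\bigcup_j L j.+1) `|` [set x | +oo <= Phi x].
  apply/seteqP; split => x /=.
    case: (ltP (Phi x) +oo) => [fx cx|fx _]; [left|by right].
    have ffx : Phi x \is a fin_num by rewrite ge0_fin_numE.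
    rewrite -(fineK ffx) lee_fin in cx.
    have [|j /andP[j1 j2]] := @dyadic_level _ (fine (Phi x) / (2 * c))%R.
      by rewrite ler_pdivlMr ?mul1r// mulr_gt0.
    rewrite ler_pdivlMr ?mulr_gt0// in j1; rewrite ltr_pdivrMr ?mulr_gt0// in j2.
    exists j => //; rewrite L2/= -(fineK ffx) lee_fin lte_fin; apply/andP; split; nra.
  case=> [[j _]|]; last by rewrite leye_eq => /eqP ->; rewrite leey.
  rewrite L2 => /andP[+ _]; apply: le_trans; rewrite lee_fin.
  have : (1 <= 2 ^+ j :> R)%R by rewrite exprn_ege1//; lra.
  by move=> ?; nra.
have s0 : (0 <= s)%R by rewrite -lee_fin -hs.
have qp : (0 < q / p)%R by rewrite divr_gt0.
have bL : \sum_(j <oo) \int[mu]_(y in L j) (h y `^ p * w y)%:E <= s%:E.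
  rewrite -ge0_integral_bigcup//; last 2 first.
  - by move=> y _; rewrite lee_fin mulr_ge0 ?powR_ge0.
  - exact: trivIset_levels.
  rewrite -hs; apply: ge0_subset_integral => //.
    exact: bigcup_measurable.
  by move=> y _; rewrite lee_fin mulr_ge0 ?powR_ge0.
rewrite dec ge0_integral_setU//; last 2 first.
- by apply: bigcup_measurable => j _.
- apply/disj_set2P/seteqP; split => // x [[j _ /andP[_ H1]] /=].
  by rewrite leye_eq => /eqP H2; move: H1; rewrite H2.
rewrite [X in _ + X](_ : _ = 0) ?adde0; last first.
  rewrite (eq_integral (fun x => +oo * (v x)%:E)); last first.
    by move=> x; rewrite inE /= leye_eq => /eqP ->; rewrite poweRyr// gt_eqF.
  rewrite ge0_integralZl//; last 2 first.
  - by apply: measurable_funTS; exact/measurable_EFinP.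
  - by move=> x _; rewrite lee_fin.
  by rewrite infinite_level ?mule0// hs ltry.
rewrite ge0_integral_bigcup//; last first.
  move=> i j _ _ ij; have := @trivIset_levels c c0 i.+1 j.+1 Logic.I Logic.I ij.
  by case.
apply: (@le_trans _ _ (\sum_(j <oo) ((4 * A) `^ q * s `^ (q / p - 1))%:E *
   (\int[mu]_(y in L j) (h y `^ p * w y)%:E + \int[mu]_(y in L j.+1) (h y `^ p * w y)%:E))).
  apply: lee_nneseries => [j _ _|j _]; first by apply: integral_ge0.
  rewrite L2; apply: (le_trans (level_norm _ hs)); first by rewrite mulr_gt0// exprn_gt0.
  apply: lee_wpmul2l; first by rewrite lee_fin mulr_ge0 ?powR_ge0.
  rewrite -L2 -ge0_integral_setU//; last 2 first.
  - by move=> y _; rewrite lee_fin mulr_ge0 ?powR_ge0.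
  - apply/disj_set2P/seteqP; split => // x [/andP[_ H1] /andP[H2 _]].
    by have := le_lt_trans H2 H1; rewrite ltxx.
  apply: ge0_subset_integral => //; first exact: measurableU.
  - by move=> y _; rewrite lee_fin mulr_ge0 ?powR_ge0.
  - rewrite /L => x /= /andP[H1 H2].
    have e4 : (4 * (c * 2 ^+ j) = c * 2 ^+ j.+2)%R by rewrite !exprS; ring.
    rewrite e4 in H2; case: (ltP (Phi x) (c * 2 ^+ j.+1)%:E) => H3; [left|right].
      by rewrite andbT.
    exact: H2.
rewrite nneseriesZl//; last by move=> j _; rewrite adde_ge0.
rewrite nneseriesD// (_ : 2 * _ * _ = ((4 * A) `^ q * s `^ (q / p - 1)) * (s + s))%R.
  rewrite [leRHS]EFinM; apply: lee_wpmul2l; first by rewrite lee_fin mulr_ge0 ?powR_ge0.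
  rewrite [leRHS]EFinD; apply: leeD; first exact: bL.
  apply: (le_trans _ bL).
  exact: (nneseries_shift_le (fun j => hp_ge0 (L j))).
by rewrite -(mulr_powRB1 s0 qp); ring.
Qed.

(** Applied below with [rho = r] and [rho = - r]: with exponents [p = q] to control averages with
    respect to [w], and with [p <= q] for the two halves of the Riesz potential. *)
Theorem hardy_inequality :
  \int[mu]_x ((\int[mu]_(y in [set y | rho x <= rho y]%R)
                  (h y * k y * w y)%:E) `^ q * (v x)%:E) <=
  (2 * (4 * A) `^ q)%:E * (\int[mu]_x (h x `^ p * w x)%:E) `^ (q / p).
Proof.
have qp : (0 < q / p)%R by rewrite divr_gt0.
have [hy|hfin] := eqVneq (\int[mu]_x (h x `^ p * w x)%:E) +oo.
  by rewrite hy poweRyr ?gt_eqF// gt0_muley ?leey// lte_fin mulr_gt0// powR_gt0// mulr_gt0.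
have hf : \int[mu]_x (h x `^ p * w x)%:E \is a fin_num.
  by rewrite ge0_fin_numE// ltey.
have hs := esym (fineK hf); move: (fine _) hs => s hs.
rewrite hs poweR_EFin -EFinM.
have mPv S : measurable_fun S (fun x => Phi x `^ q * (v x)%:E).
  apply: measurable_funTS; apply: emeasurable_funM; last exact/measurable_EFinP.
  exact: (@measurableT_comp _ _ _ _ _ _ (fun x => x `^ q) _ _ (measurable_poweR _)).
have Pv0 x : 0 <= Phi x `^ q * (v x)%:E by rewrite mule_ge0 ?poweR_ge0 ?lee_fin.
(* The height of truncation tends to 0. Points with [Phi = 0] contribute nothing because [q > 0]. *)
pose F n := [set x | (2 * n.+1%:R^-1)%:E <= Phi x].
have ndF : nondecreasing_seq F.
  move=> m n mn; apply/subsetPset => x; apply: le_trans.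
  by rewrite lee_fin ler_pM2l// lef_pV2 ?posrE// ler_nat.
have Fpos : \bigcup_n F n = [set x | 0 < Phi x].
  apply/seteqP; split => x /=.
    by move=> [n _]; apply: lt_le_trans; rewrite lte_fin mulr_gt0.
  move=> x0; pose e := fine (mine (Phi x) 1).
  have mfin : mine (Phi x) 1 \is a fin_num.
    by rewrite ge0_fin_numE ?le_min ?Phi0 ?lee01// gt_min ltry orbT.
  have e0 : (0 < e)%R by rewrite fine_gt0// lt_min x0 lte01 gt_min ltry orbT.
  have eP : e%:E <= Phi x by rewrite fineK// ge_min lexx.
  exists (Num.truncn (2 / e)) => //=; apply: le_trans eP; rewrite lee_fin.
  rewrite ler_pdivrMr// mulrC -ler_pdivrMr//; apply: ltW; exact: truncnS_gt.
have cvgF := @ge0_nondecreasing_set_cvg_integral _ _ _ F _ mu ndF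
  (fun n => mle_Phi _) (fun n => mPv (F n)) (fun n x _ => Pv0 x).
apply: (@le_trans _ _ (\int[mu]_(x in \bigcup_n F n) (Phi x `^ q * (v x)%:E))).
  rewrite Fpos; apply: (@le_trans _ _ (\int[mu]_(x in [set x | 0 < Phi x] `|` [set x | Phi x = 0]) (Phi x `^ q * (v x)%:E))).
    rewrite (_ : _ `|` _ = setT)//; apply/seteqP; split => // x _ /=.
    by have := Phi0 x; rewrite le_eqVlt => /predU1P[|]; [right|left].
  rewrite ge0_integral_setU//.
  - rewrite [X in _ + X]integral0_eq ?adde0// => x /= ->.
    by rewrite poweR0r ?gt_eqF// mul0e.
  - by rewrite -Fpos; apply: bigcup_measurable => n _; exact: mle_Phi.
  - by rewrite -[X in measurable X]setTI; exact: (mPhi measurableT (emeasurable_set1 _)).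
  - by apply/disj_set2P/seteqP; split => // x /= [+ H]; rewrite H ltxx.
rewrite -(cvg_lim _ cvgF)//; apply: lime_le; first by apply/cvg_ex; eexists; exact: cvgF.
by apply: nearW => n; apply: truncated_norm.
Qed.

End hardy.

(** * Radial weights *)

Section nonneg_integrals.
Context d (T : measurableType d) (R : realType).
Variable mu : {measure set T -> \bar R}.
Implicit Types (f g : T -> R) (A B : set T).

Lemma le_integral_subset f A B : measurable A -> measurable B ->
  measurable_fun setT f -> (forall x, 0 <= f x)%R -> A `<=` B ->
  \int[mu]_(x in A) (f x)%:E <= \int[mu]_(x in B) (f x)%:E.
Proof.
move=> mA mB mf f0 AB; apply: ge0_subset_integral => //.
- by apply: measurable_funTS; exact/measurable_EFinP.
- by move=> x _; rewrite lee_fin.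
Qed.

Lemma integral_split f A B : measurable A -> measurable B ->
  measurable_fun setT f -> (forall x, 0 <= f x)%R ->
  \int[mu]_(x in A) (f x)%:E =
  \int[mu]_(x in A `&` B) (f x)%:E + \int[mu]_(x in A `&` ~` B) (f x)%:E.
Proof.
move=> mA mB mf f0; rewrite -ge0_integral_setU//.
- by rewrite -setIUr setUCr setIT.
- exact: measurableI.
- by apply: measurableI => //; exact: measurableC.
- by apply: measurable_funTS; exact/measurable_EFinP.
- by move=> x _; rewrite lee_fin.
- by apply/disj_set2P; rewrite setIACA setICr setI0.
Qed.

Lemma le_integral_fun f g A : measurable A ->
  measurable_fun setT f -> measurable_fun setT g -> (forall x, 0 <= f x)%R ->
  (forall x, A x -> f x <= g x)%R ->
  \int[mu]_(x in A) (f x)%:E <= \int[mu]_(x in A) (g x)%:E.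
Proof.
move=> mA mf mg f0 fg; apply: ge0_le_integral => //.
- by move=> x _; rewrite lee_fin.
- by apply: measurable_funTS; exact/measurable_EFinP.
- by apply: measurable_funTS; exact/measurable_EFinP.
Qed.

Lemma integralZ_EFin f A (c : R) : measurable A ->
  measurable_fun setT f -> (forall x, 0 <= f x)%R -> (0 <= c)%R ->
  \int[mu]_(x in A) (c * f x)%:E = c%:E * \int[mu]_(x in A) (f x)%:E.
Proof.
move=> mA mf f0 c0; under eq_integral do rewrite EFinM.
rewrite ge0_integralZl//.
- by apply: measurable_funTS; exact/measurable_EFinP.
- by move=> x _; rewrite lee_fin.
Qed.

Lemma measurable_lt_fun f (a : R) : measurable_fun setT f ->
  measurable [set y | (f y < a)%R].
Proof.
move=> mf; rewrite (_ : [set y | _] = ~` [set y | a <= f y]%R).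
  by apply: measurableC; exact: measurable_ge_fun.
by apply/seteqP; split => x /=; rewrite ltNge => /negP.
Qed.

Lemma measurable_eq_fun f (a : R) : measurable_fun setT f ->
  measurable [set y | f y = a].
Proof.
move=> mf; rewrite -[X in measurable X]setTI.
exact: (mf measurableT _ (measurable_set1 a)).
Qed.

End nonneg_integrals.

Section radial_weight.
Context d (T : measurableType d) (R : realType).
Variable mu : {sigma_finite_measure set T -> \bar R}.
Variables (r w : T -> R).
Hypotheses (mr : measurable_fun setT r) (mw : measurable_fun setT w).
Hypotheses (r0 : forall x, (0 <= r x)%R) (w0 : forall x, (0 <= w x)%R).
Hypothesis null_sphere : forall t, mu [set x | r x = t] = 0.
Hypothesis W_lty : forall t, \int[mu]_(x in [set x | r x < t]%R) (w x)%:E < +oo.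
Hypothesis W_gt0 : forall t, (0 < t)%R ->
  0 < \int[mu]_(x in [set x | r x < t]%R) (w x)%:E.
Hypothesis w_infinite : \int[mu]_x (w x)%:E = +oo.

Definition wmass (t : R) : R := fine (\int[mu]_(x in [set x | r x < t]%R) (w x)%:E).
Let U x := wmass (r x).

Let mlt a : measurable [set y | r y < a]%R. Proof. exact: measurable_lt_fun. Qed.
Let mge a : measurable [set y | a <= r y]%R. Proof. exact: measurable_ge_fun. Qed.
Let meq a : measurable [set y | r y = a]. Proof. exact: measurable_eq_fun. Qed.
Let mwS S : measurable_fun S (fun x => (w x)%:E).
Proof. by apply: measurable_funTS; exact/measurable_EFinP. Qed.
Let wS_ge0 S : 0 <= \int[mu]_(x in S) (w x)%:E.
Proof. by apply: integral_ge0 => x _; rewrite lee_fin. Qed.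

Lemma wmassE t : \int[mu]_(x in [set x | r x < t]%R) (w x)%:E = (wmass t)%:E.
Proof. by rewrite fineK// ge0_fin_numE. Qed.

Lemma wmass_ge0 t : (0 <= wmass t)%R.
Proof. by rewrite fine_ge0. Qed.

Lemma wmass_gt0 t : (0 < t)%R -> (0 < wmass t)%R.
Proof. by move=> t0; rewrite -lte_fin -wmassE W_gt0. Qed.

Lemma wmass_le s t : (s <= t)%R -> (wmass s <= wmass t)%R.
Proof.
move=> st; rewrite -lee_fin -!wmassE; apply: le_integral_subset => //.
by move=> x /= /lt_le_trans; exact.
Qed.

Let U_gt0 x : (0 < r x)%R -> (0 < U x)%R. Proof. exact: wmass_gt0. Qed.

Lemma measurable_wmass : measurable_fun setT (fun x => wmass (r x)).
Proof.
apply: measurableT_comp mr; apply: nondecreasing_measurable => //.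
by move=> s t; exact: wmass_le.
Qed.
Let mU : measurable_fun setT U := measurable_wmass.
Let mUp s : measurable_fun setT (fun x => U x `^ s)%R.
Proof. exact: measurable_fun_powR. Qed.

Let sphere_integral (g : T -> R) t : measurable_fun setT g ->
  \int[mu]_(x in [set x | r x = t]) (g x)%:E = 0.
Proof.
move=> mg; apply: null_set_integral => //.
  by apply: measurable_funTS; exact/measurable_EFinP.
exact: null_sphere.
Qed.

Lemma integral_closed_ball (g : T -> R) t :
  measurable_fun setT g -> (forall x, 0 <= g x)%R ->
  \int[mu]_(x in [set x | r x <= t]%R) (g x)%:E =
  \int[mu]_(x in [set x | r x < t]%R) (g x)%:E.
Proof.
move=> mg g0; rewrite -[RHS]adde0 -(sphere_integral t mg) -ge0_integral_setU//.
- congr (integral _ _ _); apply/seteqP; split => x /=.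
    by rewrite le_eqVlt => /predU1P[|]; [right|left].
  by case=> [/ltW|->].
- by apply: measurable_funTS; exact/measurable_EFinP.
- by move=> x _; rewrite lee_fin.
- by apply/disj_set2P/seteqP; split => // x [/= + E1]; rewrite E1 ltxx.
Qed.

(** Up to any point [x] of the set the mass is [U x < c], spheres being null, and such balls exhaust
    the set. *)
Lemma wmass_sublevel_le (c : R) : (0 < c)%R ->
  \int[mu]_(x in [set x | U x < c]%R) (w x)%:E <= c%:E.
Proof.
move=> c0; apply: (@integral_upsets_le _ _ _ _ (fun x => - r x)%R) => //.
- exact: measurable_lt_fun.
- exact: measurable_funN.
- by move=> x _; rewrite lee_fin.
- by rewrite lee_fin ltW.
move=> x /= Uc.
apply: (@le_trans _ _ (\int[mu]_(y in [set y | r y <= r x]%R) (w y)%:E)).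
  apply: le_integral_subset => //.
  - apply: measurableI; first exact: measurable_lt_fun.
    by apply: measurable_ge_fun; exact: measurable_funN.
  - rewrite (_ : [set y | _] = [set y | - r x <= - r y]%R).
      by apply: measurable_ge_fun; exact: measurable_funN.
    by apply/seteqP; split => y /=; rewrite lerN2.
  - by move=> y [_ /=]; rewrite lerN2.
by rewrite integral_closed_ball// wmassE lee_fin ltW.
Qed.

(** If [U] reaches [c] at some [y1], the complement is estimated instead: the points before [y1]
    with [U >= c] have mass at most [U y1 - c], so the others have at least [c]. If [c] is never
    reached, the set is the whole space, of infinite mass. No intermediate value of W is taken. *)
Lemma wmass_sublevel_ge (c : R) : (0 < c)%R ->
  c%:E <= \int[mu]_(x in [set x | U x < c]%R) (w x)%:E.
Proof.
move=> c0.
have mS : measurable [set x | U x < c]%R by exact: measurable_lt_fun.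
have [[y1 y1c]|ny] := pselect (exists y, (c <= U y)%R); last first.
  rewrite (_ : [set x | _] = setT) ?w_infinite ?leey//.
  apply/seteqP; split => // y _ /=; rewrite ltNge; apply/negP => cy.
  by apply: ny; exists y.
pose E := [set y | c <= U y]%R `&` [set y | r y < r y1]%R.
have mE : measurable E by apply: measurableI => //; exact: measurable_ge_fun.
have small : \int[mu]_(y in E) (w y)%:E <= (U y1 - c)%:E.
  apply: (@integral_upsets_le _ _ _ _ r) => //.
  - by move=> x _; rewrite lee_fin.
  - by rewrite lee_fin subr_ge0.
  move=> y [/= cy yy1].
  apply: (@le_trans _ _ (\int[mu]_(x in [set x | r x < r y1]%R `&` ~` [set x | r x < r y]%R) (w x)%:E)).
    apply: le_integral_subset => //.
    - exact: measurableI.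
    - by apply: measurableI => //; exact: measurableC.
    - by move=> z [[/= _ zy1] yz]; split => //=; apply/negP; rewrite -leNgt.
  have := @integral_split _ _ _ mu w _ _ (mlt (r y1)) (mlt (r y)) mw w0.
  rewrite (_ : _ `&` _ = [set x | r x < r y]%R); last first.
    by apply/seteqP; split => x /= => [[]//|xy]; split => //; exact: lt_trans yy1.
  rewrite !wmassE => /esym => Eq.
  rewrite -(leeD2lE (x := (U y)%:E))// Eq -EFinD lee_fin -/(U y1); lra.
have := @integral_split _ _ _ mu w _ _ (mlt (r y1)) mS mw w0.
rewrite wmassE (_ : [set y | (r y < r y1)%R] `&` ~` _ = E); last first.
  apply/seteqP; split => x /= => [[xy /negP]|[cx xy]]; first by rewrite -leNgt.
  by split => //; apply/negP; rewrite -leNgt.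
move=> Eq; apply: (@le_trans _ _ (\int[mu]_(x in [set y | (r y < r y1)%R] `&` [set x | (U x < c)%R]) (w x)%:E)).
  move: Eq small; case: (\int[mu]_(y in E) _) (wS_ge0 E) => [e| |]//.
  case: (\int[mu]_(x in _ `&` _) _) => [a| |]//= _ [] + .
  by rewrite /U !lee_fin; lra.
by apply: le_integral_subset => //; exact: measurableI.
Qed.

Let tailC (s : R) : R := (4 `^ 1 / (1 - 2 `^ (1 - s)))%R.

(** Under [w] the function [U] is distributed like the variable u on the half-line, so this is the
    integral of u^(-s) beyond W(t), up to the constant lost in the dyadic summation. *)
Lemma wmass_tail (s t : R) : (1 < s)%R -> (0 < t)%R ->
  \int[mu]_(x in [set x | t <= r x]%R) (U x `^ (- s) * w x)%:E <=
  (tailC s * wmass t `^ (1 - s))%:E.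
Proof.
move=> s1 t0.
apply: (@le_trans _ _ (\int[mu]_(x in [set x | wmass t <= U x]%R) (U x `^ (- s) * w x)%:E)).
  apply: le_integral_subset => //.
  - exact: measurable_ge_fun.
  - exact: measurable_funM.
  - by move=> x; rewrite mulr_ge0 ?powR_ge0.
  - by move=> x /= tx; exact: wmass_le.
have := @integral_powR_superlevel _ _ _ mu w U 1 1 (- s)%R mw mU w0 _ _ ler01 _ _ (wmass_gt0 t0).
rewrite mul1r; apply; [lra|lra|].
by move=> c c0; rewrite mul1r powRr1 ?(ltW c0)//; exact: wmass_sublevel_le.
Qed.

Lemma tailC_gt0 s : (1 < s)%R -> (0 < tailC s)%R.
Proof.
move=> s1; rewrite divr_gt0 ?powR_gt0// subr_gt0.
have -> : (1 - s = - (s - 1))%R by ring.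
rewrite powRN invf_lt1 ?powR_gt0//.
have := @gt0_ltr_powR R (s - 1)%R _ 1%R 2%R.
by rewrite !nnegrE powR1; apply; lra.
Qed.

Variable p : R.
Hypothesis p1 : (1 < p)%R.
Let p' := (p / (p - 1))%R.
Let p0 : (0 < p)%R. Proof. exact: lt_trans p1. Qed.
Let p'1 : (1 < p')%R. Proof. by rewrite ltr_pdivlMr ?subr_gt0//; lra. Qed.
Let p'0 : (0 < p')%R. Proof. exact: lt_trans p'1. Qed.
Let conj_pp' : (p^-1 + p'^-1 = 1)%R.
Proof.
rewrite /p' invf_div; field; rewrite gt_eqF//; exact: lt_trans p1.
Qed.

Let wS (v : T -> R) t : measurable_fun setT v ->
  \int[mu]_(x in [set x | r x < t]%R) (v x)%:E = 0 \/ (0 < t)%R.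
Proof.
case: (ltP 0 t)%R => t0 mv; [by right|left].
rewrite (_ : [set x | _] = set0) ?integral_set0//.
by apply/seteqP; split => // x /= xt; have := lt_le_trans xt t0; rewrite ltNge r0.
Qed.

(** Hardy's inequality with [v = w], [q = p] and [k = 1 / U]. By [wmass_tail] the Muckenhoupt
    product is a constant times W(t) to the power [1/p + (1 - p')/p'], which is 0. *)
Lemma tail_average_bound (h : T -> R) :
  measurable_fun setT h -> (forall x, 0 <= h x)%R ->
  \int[mu]_x ((\int[mu]_(y in [set y | r x <= r y]%R)
                  (h y * U y `^ (- 1) * w y)%:E) `^ p * (w x)%:E) <=
  (2 * (4 * tailC p' `^ p'^-1) `^ p)%:E * \int[mu]_x (h x `^ p * w x)%:E.
Proof.
move=> mh h0; rewrite -[X in _ * X]poweRe1; last first.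
  by apply: integral_ge0 => x _; rewrite lee_fin mulr_ge0 ?powR_ge0.
rewrite -[X in _ `^ X](@divff _ p) ?gt_eqF//.
apply: hardy_inequality => //.
- by move=> x; exact: powR_ge0.
- by rewrite powR_gt0 ?tailC_gt0.
- by move=> t; exact: sphere_integral.
move=> t; have [->|t0] := wS t mw.
  by rewrite poweR0r ?invr_neq0 ?gt_eqF// mul0e lee_fin powR_ge0.
rewrite wmassE -/p'.
under eq_integral do rewrite -powRrM mulN1r.
apply: (@le_trans _ _ ((wmass t)%:E `^ p^-1 * (tailC p' * wmass t `^ (1 - p'))%:E `^ p'^-1)).
  apply: lee_wpmul2l; first exact: poweR_ge0.
  apply: poweR_le; rewrite ?invr_ge0 ?(ltW p'0) ?wmass_tail//.
  by apply: integral_ge0 => x _; rewrite lee_fin mulr_ge0 ?powR_ge0.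
rewrite !poweR_EFin -EFinM lee_fin powRM ?powR_ge0 ?(ltW (tailC_gt0 _))//.
rewrite -powRrM mulrCA -powRD; last by rewrite (gt_eqF (wmass_gt0 t0)) implybT.
rewrite (_ : p^-1 + _ = 0)%R ?powRr0 ?mulr1//.
by rewrite mulrBl mul1r mulfV ?gt_eqF// addrA conj_pp' subrr.
Qed.

(** The dual case: Hardy's inequality for [- r] with [k = 1] and the outer weight [U ^ (- p) * w].
    The powers of W(t) cancel again, now as [(1 - p)/p + 1/p' = 0]. *)
Lemma head_average_bound (f : T -> R) :
  measurable_fun setT f -> (forall x, 0 <= f x)%R ->
  \int[mu]_x ((\int[mu]_(y in [set y | - r x <= - r y]%R)
                  (f y * cst 1%R y * w y)%:E) `^ p * (U x `^ (- p) * w x)%:E) <=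
  (2 * (4 * tailC p `^ p^-1) `^ p)%:E * \int[mu]_x (f x `^ p * w x)%:E.
Proof.
move=> mf f0; rewrite -[X in _ * X]poweRe1; last first.
  by apply: integral_ge0 => x _; rewrite lee_fin mulr_ge0 ?powR_ge0.
rewrite -[X in _ `^ X](@divff _ p) ?gt_eqF//.
apply: hardy_inequality => //.
- exact: measurable_funN.
- exact: measurable_funM.
- by move=> x; rewrite mulr_ge0 ?powR_ge0.
- by rewrite powR_gt0 ?tailC_gt0.
- move=> t; rewrite (_ : [set x | _] = [set x | r x = (- t)%R]).
    by apply: sphere_integral; exact: measurable_funM.
  by apply/seteqP; split => x /= => [<-|->]; rewrite opprK.
move=> t; rewrite -/p' [X in _ * X `^ _](_ : _ = \int[mu]_(x in [set x | r x < - t]%R) (w x)%:E); last first.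
  rewrite -integral_closed_ball//; under eq_integral do rewrite powR1 mul1r.
  by congr (integral _ _ _); apply/seteqP; split => x /=; rewrite lerNr.
have [->|t0] := wS (- t)%R mw.
  by rewrite (@poweR0r _ p'^-1%R) ?invr_neq0 ?gt_eqF// mule0 lee_fin powR_ge0.
rewrite wmassE.
apply: (@le_trans _ _ ((tailC p * wmass (- t) `^ (1 - p))%:E `^ p^-1 * (wmass (- t))%:E `^ p'^-1)).
  apply: lee_wpmul2r; first exact: poweR_ge0.
  apply: poweR_le; rewrite ?invr_ge0 ?(ltW p0)//.
    by apply: integral_ge0 => x _; rewrite lee_fin mulr_ge0 ?powR_ge0.
  apply: le_trans (wmass_tail p1 t0); apply: le_integral_subset => //.
  - by apply: measurable_lt_fun; exact: measurable_funN.
  - exact: measurable_funM.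
  - by move=> x; rewrite mulr_ge0 ?powR_ge0.
  - by move=> x /= xt; rewrite lerNl ltW.
rewrite !poweR_EFin -EFinM lee_fin powRM ?powR_ge0 ?(ltW (tailC_gt0 _))//.
rewrite -powRrM -mulrA -powRD; last by rewrite (gt_eqF (wmass_gt0 t0)) implybT.
rewrite (_ : _ + p'^-1 = 0)%R ?powRr0 ?mulr1//.
by rewrite mulrBl mul1r mulfV ?gt_eqF// addrAC conj_pp' subrr.
Qed.

(* A radially decreasing function is dominated by the tail average of its
   head averages [h], and [h] has comparable norm by Hardy's inequality. *)
Lemma decreasing_le_tail_average : exists2 C : R, (0 < C)%R &
  forall (f : T -> R) (M : R), measurable_fun setT f ->
  (forall x, 0 <= f x <= M)%R -> (forall x y, (r x <= r y)%R -> (f y <= f x)%R) ->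
  exists h : T -> R, [/\ measurable_fun setT h, forall x, (0 <= h x)%R,
    forall x, (0 < r x)%R -> (f x)%:E <=
      4%:E * \int[mu]_(y in [set y | r x <= r y]%R) (h y * U y `^ (- 1) * w y)%:E &
    \int[mu]_x (h x `^ p * w x)%:E <= C%:E * \int[mu]_x (f x `^ p * w x)%:E].
Proof.
exists (2 * (4 * tailC p `^ p^-1) `^ p)%R.
  by rewrite mulr_gt0// powR_gt0// mulr_gt0// powR_gt0// tailC_gt0.
move=> f M mf fM f_dec.
have f0 x : (0 <= f x)%R by have /andP[] := fM x.
pose Phi x := \int[mu]_(y in [set y | - r x <= - r y]%R) (f y * cst 1%R y * w y)%:E.
have Phi0 x : 0 <= Phi x.
  by apply: integral_ge0 => y _; rewrite lee_fin !mulr_ge0.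
have mfw : measurable_fun setT (fun y => f y * cst 1%R y * w y)%R.
  by do 2?[apply: measurable_funM => //].
have PhiE x : Phi x = \int[mu]_(y in [set y | r y < r x]%R) (f y * w y)%:E.
  rewrite -integral_closed_ball//; last 2 first.
  - exact: measurable_funM.
  - by move=> y; rewrite mulr_ge0.
  rewrite /Phi (_ : [set y | _] = [set y | r y <= r x]%R).
    by apply: eq_integral => y _; rewrite mulr1.
  by apply/seteqP; split => y /=; rewrite lerN2.
have Phi_fin x : Phi x \is a fin_num.
  rewrite ge0_fin_numE// PhiE.
  apply: (@le_lt_trans _ _ (\int[mu]_(y in [set y | r y < r x]%R) (M * w y)%:E)).
    apply: le_integral_fun => //.
    - exact: measurable_funM.
    - exact: measurable_funM.
    - by move=> y; rewrite mulr_ge0.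
    - by move=> y _; rewrite ler_wpM2r//; have /andP[] := fM y.
  rewrite integralZ_EFin ?wmassE ?ltry//.
  by have /andP[+ +] := fM x; exact: le_trans.
have mPhi : measurable_fun setT Phi.
  apply: (@measurable_tail_integral _ _ _ mu (fun x => - r x)%R
    (fun y => f y * cst 1%R y * w y)%R) => //.
  - exact: measurable_funN.
  - by move=> y; rewrite !mulr_ge0.
exists (fun x => fine (Phi x) * U x `^ (- 1))%R; split.
- apply: measurable_funM => //.
  exact: measurableT_comp (fine_measurable measurableT) mPhi.
- by move=> x; rewrite mulr_ge0 ?powR_ge0 ?fine_ge0.
- move=> x rx; pose a := U x.
  have a0 : (0 < a)%R by exact: U_gt0.
  (* [Y] begins at the radius of [x] and stops before [U] doubles; its mass is at least
     [2 * a - a = a]. On [Y] the head integral is at least [f x * a] and [U < 2 * a], so [h / U] is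
     at least [f x / (4 * a)]. This is the origin of the constant 4. *)
  pose Y := [set y | U y < 2 * a]%R `&` ~` [set y | r y < r x]%R.
  have mU2 : measurable [set y | U y < 2 * a]%R by exact: measurable_lt_fun.
  have mY : measurable Y by apply: measurableI => //; exact: measurableC.
  have wY : a%:E <= \int[mu]_(y in Y) (w y)%:E.
    have := @wmass_sublevel_ge (2 * a)%R _; rewrite mulr_gt0// => /(_ erefl).
    rewrite (@integral_split _ _ _ mu w _ _ mU2 (mlt (r x)) mw w0).
    rewrite (_ : _ `&` _ = [set y | r y < r x]%R); last first.
      apply/seteqP; split => y /= => [[]//|xy]; split => //.
      by apply: (@le_lt_trans _ _ a); [exact/wmass_le/ltW|lra].
    rewrite wmassE -/(U x) -/a -/Y mulr_natl mulr2n EFinD.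
    by rewrite leeD2lE.
  apply: (@le_trans _ _ (4%:E * \int[mu]_(y in Y) (f x / (4 * a) * w y)%:E)).
    have c0 : (0 <= f x / (4 * a))%R by rewrite divr_ge0// mulr_ge0// ltW.
    rewrite integralZ_EFin// muleA -EFinM.
    apply: le_trans (lee_wpmul2l _ wY); last by rewrite lee_fin mulr_ge0.
    by rewrite -EFinM lee_fin le_eqVlt; apply/orP; left; apply/eqP; field; rewrite gt_eqF.
  apply: lee_wpmul2l; first by rewrite lee_fin.
  apply: (@le_trans _ _ (\int[mu]_(y in Y) (fine (Phi y) * U y `^ (- 1) * U y `^ (- 1) * w y)%:E)); last first.
    apply: le_integral_subset => //.
    + do 3?[apply: measurable_funM => //].
      exact: measurableT_comp (fine_measurable measurableT) mPhi.
    + by move=> y; rewrite !mulr_ge0 ?powR_ge0 ?fine_ge0.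
    + by move=> y [_ /= /negP]; rewrite -leNgt.
  apply: le_integral_fun => //.
  + exact: measurable_funM.
  + do 3?[apply: measurable_funM => //].
    exact: measurableT_comp (fine_measurable measurableT) mPhi.
  + by move=> y; rewrite !mulr_ge0 ?invr_ge0 ?mulr_ge0 ?(ltW a0).
  move=> y [/= Uy2 /negP]; rewrite -leNgt => xy; rewrite ler_wpM2r//.
  have Uy : (a <= U y)%R by exact: wmass_le.
  have Uy0 : (0 < U y)%R by exact: lt_le_trans Uy.
  rewrite !powR_inv1 ?(ltW Uy0)//.
  have fPhi : (f x * a <= fine (Phi y))%R.
    rewrite -lee_fin fineK// PhiE EFinM -wmassE -integralZ_EFin//.
    apply: (@le_trans _ _ (\int[mu]_(z in [set z | r z < r x]%R) (f z * w z)%:E)).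
      apply: le_integral_fun => //.
      - exact: measurable_funM.
      - exact: measurable_funM.
      - by move=> z; rewrite mulr_ge0.
      - by move=> z /= zx; rewrite ler_wpM2r// f_dec// ltW.
    apply: le_integral_subset => //.
    - exact: measurable_funM.
    - by move=> z; rewrite mulr_ge0.
    - by move=> z /= zx; exact: lt_le_trans xy.
  rewrite ler_pdivrMr ?mulr_gt0// mulrAC ler_pdivlMr// mulrAC ler_pdivlMr//.
  have UU : (U y * U y <= 2 * a * (2 * a))%R by apply: ler_pM => //; exact: ltW.
  rewrite -mulrA (le_trans (ler_wpM2l (f0 x) UU))//.
  rewrite (_ : f x * (2 * a * (2 * a)) = f x * a * (4 * a))%R; last by ring.
  by rewrite ler_wpM2r ?mulr_ge0 ?(ltW a0).
- have := head_average_bound mf f0; apply: le_trans.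
  rewrite le_eqVlt; apply/orP; left; apply/eqP; apply: eq_integral => x _.
  rewrite -/(Phi x) -[in RHS](fineK (Phi_fin x)) poweR_EFin -EFinM; congr EFin.
  by rewrite powRM ?powR_ge0 ?fine_ge0// -powRrM mulN1r mulrA.
Qed.

End radial_weight.

(** * Riesz potentials of radially decreasing functions *)

Section power_distribution.
Context d (T : measurableType d) (R : realType).
Variable mu : {measure set T -> \bar R}.
Variables (g : T -> R) (Q : R).
Hypotheses (mg : measurable_fun setT g) (g0 : forall x, (0 <= g x)%R).
Hypotheses (Q0 : (0 < Q)%R)
  (mu_lt : forall a, (0 < a)%R -> mu [set x | g x < a]%R = (a `^ Q)%:E).

Lemma mu_lt_ge0 a : (0 <= a)%R -> mu [set x | g x < a]%R = (a `^ Q)%:E.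
Proof.
rewrite le_eqVlt => /predU1P[<-|]; last exact: mu_lt.
rewrite powR0 ?gt_eqF// (_ : [set x | _] = set0) ?measure0//.
by apply/seteqP; split => // x /=; rewrite ltNge g0.
Qed.

(** A level of mass [m > 0] would make the continuous function [a ^ Q] jump by [m] at [t]; the
    contradiction is read off at the radius where [a ^ Q] equals [t ^ Q + m / 2]. *)
Lemma mu_level t : mu [set x | g x = t] = 0.
Proof.
have [t0|t0] := ltP t 0%R.
  rewrite (_ : [set x | _] = set0) ?measure0//.
  by apply/seteqP; split => // x /= gx; have := g0 x; rewrite gx leNgt t0.
have le e : (0 < e)%R -> mu [set x | g x = t] <= ((t + e) `^ Q - t `^ Q)%:E.
  move=> e0; rewrite EFinB leeBrDr//.
  rewrite -mu_lt_ge0// -mu_lt ?ltr_wpDl// -measureU; last 3 first.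
  - exact: measurable_eq_fun.
  - exact: measurable_lt_fun.
  - by apply/seteqP; split => // x [/= ->]; rewrite ltxx.
  apply: le_measure; rewrite ?inE.
  - by apply: measurableU; [exact: measurable_eq_fun|exact: measurable_lt_fun].
  - exact: measurable_lt_fun.
  - by move=> x [/= ->|/= xt]; [rewrite ltrDl|exact: ltr_wpDr (ltW e0) xt].
have fin : mu [set x | g x = t] \is a fin_num.
  by rewrite ge0_fin_numE// (le_lt_trans (le 1%R ltr01)) ?ltry.
apply/eqP; rewrite eq_le measure_ge0 andbT leNgt; apply/negP => m0.
rewrite -(fineK fin) in m0 le; move: (fine _) m0 le => m; rewrite lte_fin => m0 le.
have s0 : (0 <= t `^ Q + m / 2)%R by rewrite addr_ge0 ?powR_ge0 ?divr_ge0 ?(ltW m0).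
have tlt : (t < (t `^ Q + m / 2) `^ Q^-1)%R.
  rewrite [ltLHS](_ : t = (t `^ Q) `^ Q^-1)%R; last first.
    by rewrite -powRrM mulfV ?gt_eqF// powRr1.
  by apply: gt0_ltr_powR; rewrite ?invr_gt0 ?nnegrE ?powR_ge0// ltrDl divr_gt0.
have := le ((t `^ Q + m / 2) `^ Q^-1 - t)%R; rewrite subr_gt0 => /(_ tlt).
rewrite (addrC t) subrK -powRrM mulVf ?gt_eqF// powRr1// lee_fin; lra.
Qed.

Lemma mu_le a : (0 <= a)%R -> mu [set x | g x <= a]%R = (a `^ Q)%:E.
Proof.
move=> a0; rewrite -(mu_lt_ge0 a0) -[RHS]adde0 -(mu_level a) -measureU.
- congr (mu _); apply/seteqP; split => x /=.
    by rewrite le_eqVlt => /predU1P[|]; [right|left].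
  by case=> [/ltW|->].
- exact: measurable_lt_fun.
- exact: measurable_eq_fun.
- by apply/seteqP; split => // x [/= + xa]; rewrite xa ltxx.
Qed.

End power_distribution.

Lemma integral_gt0 d (T : measurableType d) (R : realType)
    (mu : {measure set T -> \bar R}) (D : set T) (f : T -> R) :
  measurable D -> measurable_fun setT f -> (forall x, 0 < f x)%R -> 0 < mu D ->
  0 < \int[mu]_(x in D) (f x)%:E.
Proof.
move=> mD mf f0 muD.
have f0' x : (0 <= f x)%R by exact: ltW.
rewrite lt0e integral_ge0 ?andbT; last by move=> x _; rewrite lee_fin.
apply/eqP => I0.
have mf' : measurable_fun D (EFin \o f).
  by apply: measurable_funTS; exact/measurable_EFinP.
have : \int[mu]_(x in D) `|(EFin \o f) x| = 0.
  by rewrite -[RHS]I0; apply: eq_integral => x _; rewrite gee0_abs// lee_fin.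
move/(ae_eq_integral_abs mu mD mf') => [N [mN N0 DN]].
move: muD; rewrite lt_neqAle measure_ge0 andbT => /eqP; apply; apply/esym.
apply: (subset_measure0 mD mN _ N0) => x Dx; apply: DN => /= H.
by have := H Dx; move: (f0 x) => + [] => /[swap] ->; rewrite ltxx.
Qed.

(** * Two-sided bounds for the Riesz potential of a ball *)

Section kernel_bounds.
Context d (T : measurableType d) (R : realType).
Variable mu : {sigma_finite_measure set T -> \bar R}.
Variables (r : T -> R) (rho : T -> T -> R) (Q alpha c0 : R).
Hypotheses (mr : measurable_fun setT r)
  (mrho : measurable_fun setT (fun z : T * T => rho z.1 z.2)).
Hypotheses (r0 : forall x, (0 <= r x)%R) (rho0 : forall x y, (0 <= rho x y)%R).
Hypotheses (a0 : (0 < alpha)%R) (aQ : (alpha < Q)%R) (c00 : (0 < c0)%R).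
Hypotheses
  (mu_ball : forall a, (0 < a)%R -> mu [set x | r x < a]%R = (a `^ Q)%:E)
  (mu_rball : forall x a, (0 < a)%R -> mu [set y | rho x y < a]%R = (a `^ Q)%:E).
Hypotheses (tri1 : forall x y, (rho x y <= c0 * (r x + r y))%R)
  (tri2 : forall x y, (r x <= c0 * (rho x y + r y))%R).

Let Q0 : (0 < Q)%R. Proof. exact: lt_trans aQ. Qed.

Lemma measurable_rho x : measurable_fun setT (rho x).
Proof.
exact: (measurableT_comp mrho (pair1_measurable x)).
Qed.

Let kernel_ge0 x z : (0 <= rho x z `^ (alpha - Q))%R. Proof. exact: powR_ge0. Qed.
Let mkernel x : measurable_fun setT (fun z => rho x z `^ (alpha - Q))%R.
Proof. by apply: measurable_fun_powR; exact: measurable_rho. Qed.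

Definition ball_potential x s :=
  \int[mu]_(z in [set z | r z <= s]%R) (rho x z `^ (alpha - Q))%:E.

Let mle s : measurable [set z | r z <= s]%R.
Proof.
rewrite (_ : [set z | _] = ~` [set z | s < r z]%R).
  apply: measurableC; rewrite (_ : [set z | _] = ~` [set z | r z <= s]%R).
    apply: measurableC; rewrite (_ : [set z | _] = [set z | - s <= - r z]%R).
      by apply: measurable_ge_fun; exact: measurable_funN.
    by apply/seteqP; split => z /=; rewrite lerN2.
  by apply/seteqP; split => z /=; rewrite ltNge => /negP.
by apply/seteqP; split => z /=; rewrite leNgt => /negP.
Qed.

(** The kernel is at least [m ^ (alpha - Q)] on the ball except where [rho x z = 0], since [powR]
    gives 0 there; that set is null and is cut out. *)
Lemma ball_potential_ge x s m : (0 < m)%R -> (0 <= s)%R ->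
  (forall z, (r z <= s)%R -> (rho x z <= m)%R) ->
  (m `^ (alpha - Q) * s `^ Q)%:E <= ball_potential x s.
Proof.
move=> m0 s0 H; pose N := [set z | rho x z = 0]%R.
have mN : measurable N by apply: measurable_eq_fun; exact: measurable_rho.
have muN : mu N = 0.
  by apply: (@mu_level _ _ _ _ _ Q) => //; [exact: measurable_rho|exact: mu_rball].
apply: (@le_trans _ _ (\int[mu]_(z in [set z | r z <= s]%R `\` N) (m `^ (alpha - Q))%:E)).
  rewrite integral_cst; last exact: measurableD.
  rewrite EFinM; apply: lee_wpmul2l; first by rewrite lee_fin powR_ge0.
  suff -> : (s `^ Q)%:E = mu ([set z | r z <= s]%R `\` N) by [].
  apply: etrans (esym (mu_le mr r0 Q0 mu_ball s0)) _.
  rewrite -[RHS]adde0 -[X in _ = _ + X](_ : mu ([set z | r z <= s]%R `&` N) = 0).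
    rewrite -measureU.
    - by congr (mu _); rewrite setDE -setIUr setUC setUCr setIT.
    - exact: measurableD.
    - exact: measurableI.
    - by apply/seteqP; split => // z [[_ h1] [_ h2]].
  by apply: (subset_measure0 _ mN) => //; exact: measurableI.
apply: (@le_trans _ _ (\int[mu]_(z in [set z | r z <= s]%R `\` N) (rho x z `^ (alpha - Q))%:E)).
  apply: le_integral_fun => //; first exact: measurableD.
  - by move=> z; rewrite powR_ge0.
  move=> z [/= zs /eqP z0]; apply: powR_le_neg; rewrite ?H//.
    by rewrite subr_le0 ltW.
  by rewrite lt_neqAle eq_sym z0 rho0.
apply: le_integral_subset => //; first exact: measurableD.
Qed.

Let C1 : R := (1 * 4 `^ Q / (1 - 2^-1 `^ (Q + (alpha - Q))))%R.

Let C10 : (0 < C1)%R.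
Proof.
rewrite /C1 mul1r divr_gt0 ?powR_gt0// subr_gt0 (_ : Q + _ = alpha)%R; last by ring.
have := @gt0_ltr_powR R _ a0 2^-1%R 1%R; rewrite !nnegrE powR1; apply; lra.
Qed.

Let rball_potential x a : (0 < a)%R ->
  \int[mu]_(z in [set z | rho x z < a]%R) (rho x z `^ (alpha - Q))%:E <=
    (C1 * a `^ alpha)%:E.
Proof.
move=> a_gt0.
have := @integral_powR_sublevel _ _ _ mu (cst 1%R) (rho x) 1 Q (alpha - Q)%R _
  (measurable_rho x) _ (rho0 x) _ _ ler01 _ a a_gt0.
rewrite -/C1 (_ : Q + _ = alpha)%R; last by ring.
under eq_integral do rewrite mulr1.
apply => //.
- by rewrite subr_lt0.
- move=> c c_gt0; rewrite (eq_integral (cst 1))// integral_cst.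
    by rewrite mul1e mul1r le_eqVlt; apply/orP; left; apply/eqP; exact: mu_rball.
  by apply: measurable_lt_fun; exact: measurable_rho.
Qed.

Let ball_potential_le x s m : (0 < m)%R ->
  (forall z, (r z <= s)%R -> (rho x z <= m)%R) ->
  ball_potential x s <= (C1 * (2 * m) `^ alpha)%:E.
Proof.
move=> m0 H.
have m2 : (0 < 2 * m)%R by rewrite mulr_gt0.
apply: le_trans (rball_potential x m2).
apply: le_integral_subset => //.
- by apply: measurable_lt_fun; exact: measurable_rho.
- by move=> z /= /H zm; lra.
Qed.

(** If [s] is small against [r x], the second quasi-triangle inequality keeps the ball at
    [rho]-distance at least [r x / (2 * c0)] from [x], where the kernel is bounded by a constant.
    Otherwise the ball lies in a [rho]-ball of radius comparable to the larger of [r x] and [s],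
    over which the kernel integrates to a multiple of that radius to the power [alpha]. *)
Lemma ball_potential_upper : exists2 C : R, (0 < C)%R & forall x s, (0 < r x)%R -> (0 <= s)%R ->
  ((s < r x)%R -> ball_potential x s <= (C * (r x `^ (alpha - Q) * s `^ Q))%:E) /\
  ((r x <= s)%R -> ball_potential x s <= (C * s `^ alpha)%:E).
Proof.
pose Ca := (C1 * (4 * c0) `^ alpha)%R.
have Ca0 : (0 < Ca)%R by rewrite mulr_gt0// powR_gt0// mulr_gt0.
have le_near x s M : (0 < M)%R -> (r x <= M)%R -> (s <= M)%R ->
    ball_potential x s <= (Ca * M `^ alpha)%:E.
  move=> M0 xM sM; have c0M : (0 < 2 * c0 * M)%R by rewrite !mulr_gt0.
  have := @ball_potential_le x s _ c0M; rewrite (_ : 2 * (2 * c0 * M) = 4 * c0 * M)%R; last by ring.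
  rewrite powRM ?mulr_ge0 ?(ltW c00) ?(ltW M0)// mulrA; apply => z zs.
  apply: (le_trans (tri1 x z)); rewrite (_ : 2 * c0 * M = c0 * (2 * M))%R; last by ring.
  by rewrite ler_wpM2l ?(ltW c00)//; lra.
pose Cb := ((2 * c0) `^ (Q - alpha) + Ca * (2 * c0) `^ Q)%R.
have c02 : (0 < 2 * c0)%R by rewrite mulr_gt0.
have Cb0 : (0 < Cb)%R by rewrite addr_gt0 ?powR_gt0// mulr_gt0 ?powR_gt0.
exists (Ca + Cb)%R; first by rewrite addr_gt0.
move=> x s rx s0; split => [sx|xs]; last first.
  apply: (le_trans (le_near x s s (lt_le_trans rx xs) xs (lexx _))).
  by rewrite lee_fin ler_wpM2r ?powR_ge0// lerDl ltW.
apply: (@le_trans _ _ (Cb * (r x `^ (alpha - Q) * s `^ Q))%:E); last first.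
  by rewrite lee_fin ler_wpM2r ?mulr_ge0 ?powR_ge0// lerDr ltW.
have [sfar|snear] := ltP s (r x / (2 * c0))%R.
  pose l := (r x / (2 * c0))%R.
  have l0 : (0 < l)%R by rewrite divr_gt0// mulr_gt0.
  apply: (@le_trans _ _ (\int[mu]_(z in [set z | r z <= s]%R) (l `^ (alpha - Q))%:E)).
    apply: le_integral_fun => // z /= zs.
    apply: powR_le_neg => //; first by rewrite subr_le0 ltW.
    have := tri2 x z.
    move: sfar; rewrite /l !ltr_pdivlMr ?ler_pdivrMr ?mulr_gt0// => sfar.
    have : (r z * c0 <= s * c0)%R by rewrite ler_wpM2r// ltW.
    by lra.
  rewrite integral_cst// (mu_le mr r0 Q0 mu_ball s0) -EFinM lee_fin.
  rewrite /l powRM ?invr_ge0 ?mulr_ge0 ?(ltW c00) ?(ltW rx)//.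
  rewrite -powR_inv1 ?mulr_ge0 ?(ltW c00)// -powRrM mulN1r opprB.
  rewrite [X in (X * _ <= _)%R]mulrC -mulrA.
  by rewrite ler_wpM2r ?mulr_ge0 ?powR_ge0// lerDl mulr_ge0 ?powR_ge0 ?ltW.
(* In this intermediate range [r x <= 2 * c0 * s], so bounding the second factor of [r x ^ alpha = r
   x ^ (alpha - Q) * r x ^ Q] gives the required form. *)
apply: (le_trans (le_near x s (r x) rx (lexx _) (ltW sx))).
rewrite lee_fin; apply: (@le_trans _ _ (Ca * (2 * c0) `^ Q * (r x `^ (alpha - Q) * s `^ Q)))%R; last first.
  by rewrite ler_wpM2r ?mulr_ge0 ?powR_ge0// lerDr powR_ge0.
rewrite -mulrA ler_wpM2l ?(ltW Ca0)// mulrCA.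
rewrite -powRM ?mulr_ge0 ?(ltW c00)//.
rewrite -{1}(subrK Q alpha) [leLHS]powRD; last by rewrite (gt_eqF rx) implybT.
rewrite ler_wpM2l ?powR_ge0//; apply: powR_le; rewrite ?(ltW Q0) ?(ltW rx)//.
by move: snear; rewrite ler_pdivrMr ?mulr_gt0//; lra.
Qed.

(** Exchanging the integrals turns the potential of a tail integral into a superposition of
    potentials of balls; both directions of the characterization start from this identity. *)
Lemma riesz_tail_fubini (g : T -> R) x :
  measurable_fun setT g -> (forall y, 0 <= g y)%R ->
  \int[mu]_z ((\int[mu]_(y in [set y | r z <= r y]%R) (g y)%:E) *
     (rho x z `^ (alpha - Q))%:E) =
  \int[mu]_y ((g y)%:E * ball_potential x (r y)).
Proof.
move=> mg g0; pose S := [set u : T * T | r u.1 <= r u.2]%R.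
have mS : measurable S.
  rewrite -[X in measurable X]setTI.
  rewrite (_ : S = (fun z : T * T => (r z.1 <= r z.2)%R) @^-1` [set true]).
    apply: measurable_fun_ler => //.
    - exact: measurableT_comp mr (@measurable_fst _ _ T T).
    - exact: measurableT_comp mr (@measurable_snd _ _ T T).
  by apply/seteqP; split => u /=.
pose F (u : T * T) := (g u.2 * rho x u.1 `^ (alpha - Q) * \1_S u)%:E.
have F0 u : 0 <= F u by rewrite lee_fin !mulr_ge0 ?powR_ge0.
have mF : measurable_fun setT F.
  apply/measurable_EFinP; apply: measurable_funM; last exact: measurable_indic.
  apply: measurable_funM; first exact: measurableT_comp mg (@measurable_snd _ _ T T).
  exact: measurableT_comp (mkernel x) (@measurable_fst _ _ T T).
have mge a : measurable [set y | a <= r y]%R by exact: measurable_ge_fun.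
have := @fubini_tonelli _ _ _ _ _ mu mu F mF F0.
congr (_ = _); apply: eq_integral => z _.
  rewrite [RHS]muleC -(integralZ_EFin mu) // -[RHS]integral_mul_indic.
  apply: eq_integral => y _; rewrite /F /= !indicE; congr EFin.
  by rewrite (mulrC (g y)).
rewrite -(integralZ_EFin mu) // -[RHS]integral_mul_indic.
by apply: eq_integral => y _; rewrite /F /= !indicE.
Qed.

Lemma measurable_ball_potential x : measurable_fun setT (fun y => ball_potential x (r y)).
Proof.
apply: (@measurable_xsection_integral _ _ _ _ _ _ [set u : T * T | r u.2 <= r u.1]%R) => //.
rewrite -[X in measurable X]setTI.
rewrite (_ : [set u | _] = (fun z : T * T => (r z.2 <= r z.1)%R) @^-1` [set true]).
  apply: measurable_fun_ler => //.
  - exact: measurableT_comp mr (@measurable_snd _ _ T T).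
  - exact: measurableT_comp mr (@measurable_fst _ _ T T).
by apply/seteqP; split => u /=.
Qed.

End kernel_bounds.

Lemma poweR_add_le (R : realType) (a b : \bar R) (q : R) : (0 <= q)%R ->
  0 <= a -> 0 <= b -> (a + b) `^ q <= (2 `^ q)%:E * (a `^ q + b `^ q).
Proof.
move=> q0; wlog ab : a b / a <= b => [H a0 b0|a0 b0].
  by case: (leP a b) => [|/ltW] ab; [|rewrite addeC [X in _ * X]addeC]; exact: H.
apply: (@le_trans _ _ ((2%:E * b) `^ q)).
  apply: poweR_le; rewrite ?adde_ge0//.
  by rewrite (_ : 2%:E = 1 + 1) // ge0_muleDl// mul1e leeD.
rewrite poweRM// poweR_EFin; apply: lee_wpmul2l; first by rewrite lee_fin powR_ge0.
by rewrite leeDr ?poweR_ge0.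
Qed.

(** Turns a bound on a product with a fixed, possibly zero or infinite, factor into a bound on a
    single integral, the form that [integral_upsets_le] requires. The threshold is [+oo] for [X = 0]
    and [0] for [X = +oo]. *)
Lemma le_poweR_mul_bound (R : realType) (X : \bar R) (A s : R) :
  0 <= X -> (0 <= A)%R -> (0 < s)%R ->
  exists2 c : \bar R, 0 <= c &
    forall N, 0 <= N -> (N `^ s * X <= A%:E) <-> (N <= c).
Proof.
move=> X0 A0 s0; have s_neq0 : s != 0%R by rewrite gt_eqF.
move: X X0 => [x| |//] X0.
- move: X0; rewrite lee_fin le_eqVlt => /predU1P[<-|x0].
    by exists +oo; rewrite ?leey// => N N0; rewrite mule0 leey lee_fin A0.
  have Ax : (0 <= A / x)%R by rewrite divr_ge0 ?(ltW x0).
  exists ((A / x)%:E `^ s^-1); first exact: poweR_ge0.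
  move=> N N0; rewrite -lee_pdivlMr// -EFinM; split => H.
    by rewrite -[N](@poweRK _ _ s)//; apply: poweR_le; rewrite ?poweR_ge0// invr_ge0 ltW.
  rewrite -[leRHS](@poweRVK _ _ s)//; apply: poweR_le => //; exact: ltW.
- exists 0 => // N N0; split=> [|N_le0]; last first.
    have -> : N = 0 by apply/eqP; rewrite eq_le N_le0.
    by rewrite poweR0r// mul0e lee_fin.
  move: N0; rewrite le_eqVlt => /predU1P[<-//|N0].
  by rewrite gt0_muley ?poweR_gt0.
Qed.

Section radial_riesz.
Context d (T : measurableType d) (R : realType).
Variable mu : {sigma_finite_measure set T -> \bar R}.
Variables (r w v : T -> R) (rho : T -> T -> R) (Q alpha c0 p q : R).
Hypotheses (mr : measurable_fun setT r)
  (mrho : measurable_fun setT (fun z : T * T => rho z.1 z.2)).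
Hypotheses (r0 : forall x, (0 <= r x)%R) (rho0 : forall x y, (0 <= rho x y)%R).
Hypotheses (a0 : (0 < alpha)%R) (aQ : (alpha < Q)%R) (c00 : (0 < c0)%R).
Hypotheses
  (mu_ball : forall a, (0 < a)%R -> mu [set x | r x < a]%R = (a `^ Q)%:E)
  (mu_rball : forall x a, (0 < a)%R -> mu [set y | rho x y < a]%R = (a `^ Q)%:E).
Hypotheses (tri1 : forall x y, (rho x y <= c0 * (r x + r y))%R)
  (tri2 : forall x y, (r x <= c0 * (rho x y + r y))%R).
Hypotheses (mw : measurable_fun setT w) (w_gt0 : forall x, (0 < w x)%R)
  (mv : measurable_fun setT v) (v_gt0 : forall x, (0 < v x)%R).
Hypotheses (p1 : (1 < p)%R) (pq : (p <= q)%R).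
Hypothesis w_fin : forall t, (0 < t)%R ->
  \int[mu]_(x in [set x | r x < t]%R) (w x)%:E < +oo.
Hypothesis w_infinite : \int[mu]_x (w x)%:E = +oo.
Let p' := (p / (p - 1))%R.
Let U x := wmass mu r w (r x).

Definition riesz (f : T -> R) x :=
  \int[mu]_y (f y * rho x y `^ (alpha - Q))%:E.

Let Q0 : (0 < Q)%R. Proof. exact: lt_trans aQ. Qed.
Let p0 : (0 < p)%R. Proof. exact: lt_trans p1. Qed.
Let q0 : (0 < q)%R. Proof. exact: lt_le_trans pq. Qed.
Let p10 : (0 < p - 1)%R. Proof. by rewrite subr_gt0. Qed.
Let p'1 : (1 < p')%R. Proof. by rewrite ltr_pdivlMr ?subr_gt0//; lra. Qed.
Let p'0 : (0 < p')%R. Proof. exact: lt_trans p'1. Qed.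
Let w0 x : (0 <= w x)%R. Proof. exact: ltW. Qed.
Let v0 x : (0 <= v x)%R. Proof. exact: ltW. Qed.
Let mlt a : measurable [set y | r y < a]%R. Proof. exact: measurable_lt_fun. Qed.
Let mge a : measurable [set y | a <= r y]%R. Proof. exact: measurable_ge_fun. Qed.
Let ball_neg t : (t <= 0)%R -> [set x | r x < t]%R = set0.
Proof.
by move=> t0; apply/seteqP; split => // x /= xt; have := lt_le_trans xt t0; rewrite ltNge r0.
Qed.
Let null_sphere t : mu [set x | r x = t] = 0.
Proof. exact: mu_level mu_ball t. Qed.
Let W_lty t : \int[mu]_(x in [set x | r x < t]%R) (w x)%:E < +oo.
Proof.
by have [t0|/w_fin//] := leP t 0%R; rewrite ball_neg// integral_set0.
Qed.
Let W_gt0 t : (0 < t)%R -> 0 < \int[mu]_(x in [set x | r x < t]%R) (w x)%:E.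
Proof.
move=> t0; apply: integral_gt0 => //.
apply: (@lt_le_trans _ _ (t `^ Q)%:E); first by rewrite lte_fin powR_gt0.
by rewrite le_eqVlt; apply/orP; left; apply/eqP; exact: (esym (mu_ball t0)).
Qed.
Let U0 x : (0 <= U x)%R. Proof. exact: wmass_ge0. Qed.
Let mU : measurable_fun setT U. Proof. exact: measurable_wmass. Qed.
Let mUp s : measurable_fun setT (fun x => U x `^ s)%R.
Proof. exact: measurable_fun_powR. Qed.
Let mrp s : measurable_fun setT (fun x => r x `^ s)%R.
Proof. exact: measurable_fun_powR. Qed.
Let sphere_integral (g : T -> R) t : measurable_fun setT g ->
  \int[mu]_(x in [set x | r x = t]) (g x)%:E = 0.
Proof.
move=> mg; apply: null_set_integral => //.
- exact: measurable_eq_fun.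
- by apply: measurable_funTS; exact/measurable_EFinP.
- exact: null_sphere.
Qed.
Let compl_ball t : ~` [set x | r x < t]%R = [set x | t <= r x]%R.
Proof. by apply/seteqP; split => x /=; rewrite leNgt => /negP. Qed.

Lemma measurable_riesz (f : T -> R) : measurable_fun setT f -> (forall x, 0 <= f x)%R ->
  measurable_fun setT (riesz f).
Proof.
move=> mf f0; pose F (z : T * T) := (f z.2 * rho z.1 z.2 `^ (alpha - Q))%:E.
apply: (@measurable_fun_fubini_tonelli_F _ _ _ _ _ mu F).
  apply/measurable_EFinP; apply: measurable_funM.
    exact: measurableT_comp mf (@measurable_snd _ _ T T).
  exact: measurable_fun_powR.
by move=> z; rewrite lee_fin mulr_ge0 ?powR_ge0.
Qed.

(** * Sufficiency: reduction to two Hardy operators *)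

Section sufficiency.
Variable A : R.
Hypothesis A0 : (0 < A)%R.
Hypothesis cond2 : forall t, (0 < t)%R ->
  (\int[mu]_(x in [set x | r x < t]%R) (r x `^ (p' * Q) * U x `^ (- p') * w x)%:E) `^ p'^-1 *
  (\int[mu]_(x in ~` [set x | r x < t]%R) (r x `^ ((alpha - Q) * q) * v x)%:E) `^ q^-1 <= A%:E.
Hypothesis cond3 : forall t, (0 < t)%R ->
  (\int[mu]_(x in [set x | r x < t]%R) (v x)%:E) `^ q^-1 *
  (\int[mu]_(x in ~` [set x | r x < t]%R) (r x `^ (alpha * p') * U x `^ (- p') * w x)%:E) `^ p'^-1 <= A%:E.

Variable h : T -> R.
Hypotheses (mh : measurable_fun setT h) (h0 : forall x, (0 <= h x)%R).
Let T1 x := \int[mu]_(y in [set y | - r x <= - r y]%R)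
  (h y * (r y `^ Q * U y `^ (- 1)) * w y)%:E.
Let T2 x := \int[mu]_(y in [set y | r x <= r y]%R)
  (h y * (r y `^ alpha * U y `^ (- 1)) * w y)%:E.

Let mk1 s : measurable_fun setT (fun y => h y * (r y `^ s * U y `^ (- 1)) * w y)%R.
Proof. by do 3?[apply: measurable_funM => //]. Qed.
Let k10 s y : (0 <= h y * (r y `^ s * U y `^ (- 1)) * w y)%R.
Proof. by rewrite !mulr_ge0 ?powR_ge0. Qed.
Let mT1 : measurable_fun setT T1.
Proof. by apply: (measurable_tail_integral mu _ (mk1 Q)) => //; exact: measurable_funN. Qed.
Let mT2 : measurable_fun setT T2.
Proof. exact: (measurable_tail_integral mu mr (mk1 alpha)). Qed.
Let T10 x : 0 <= T1 x. Proof. by apply: integral_ge0 => y _; rewrite lee_fin. Qed.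
Let T20 x : 0 <= T2 x. Proof. by apply: integral_ge0 => y _; rewrite lee_fin. Qed.

(** Hardy's inequality for [- r] with [k = r ^ Q / U], the power of [r x] being moved into the outer
    weight. Since spheres are null, its Muckenhoupt condition follows from [cond2]. *)
Let T1_bound : \int[mu]_x (T1 x `^ q * (r x `^ ((alpha - Q) * q) * v x)%:E) <=
  (2 * (4 * A) `^ q)%:E * (\int[mu]_x (h x `^ p * w x)%:E) `^ (q / p).
Proof.
apply: hardy_inequality => //.
- exact: measurable_funN.
- exact: measurable_funM.
- exact: measurable_funM.
- by move=> x; rewrite mulr_ge0 ?powR_ge0.
- by move=> x; rewrite mulr_ge0 ?powR_ge0.
- move=> t; rewrite (_ : [set x | _] = [set x | r x = (- t)%R]).
    by apply: sphere_integral; exact: measurable_funM.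
  by apply/seteqP; split => x /= => [<-|->]; rewrite opprK.
move=> t; rewrite -/p'.
rewrite [X in _ * X `^ _](_ : _ = \int[mu]_(x in [set x | r x < - t]%R) (r x `^ (p' * Q) * U x `^ (- p') * w x)%:E); last first.
  rewrite -(integral_closed_ball mr null_sphere)//; last 2 first.
  - by do 2?[apply: measurable_funM => //].
  - by move=> x; rewrite !mulr_ge0 ?powR_ge0.
  rewrite (_ : [set x | (t <= - r x)%R] = [set x | (r x <= - t)%R]); last first.
    by apply/seteqP; split => x /=; rewrite lerNr.
  apply: eq_integral => x _; congr ((_ * _)%:E).
  by rewrite powRM ?powR_ge0// -!powRrM mulN1r mulrC (mulrC Q) mulrC.
have [t0|t0] := leP (- t)%R 0%R.
  by rewrite ball_neg// integral_set0 (@poweR0r _ p'^-1%R) ?invr_neq0 ?gt_eqF// mule0 lee_fin ltW.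
apply: le_trans (cond2 t0); rewrite muleC; apply: lee_wpmul2l; first exact: poweR_ge0.
apply: poweR_le; rewrite ?invr_ge0 ?(ltW q0)//.
  by apply: integral_ge0 => x _; rewrite lee_fin mulr_ge0 ?powR_ge0.
apply: le_integral_subset => //.
- by apply: measurable_lt_fun; exact: measurable_funN.
- exact: measurableC.
- exact: measurable_funM.
- by move=> x; rewrite mulr_ge0 ?powR_ge0.
- by move=> x /= xt; apply/negP; rewrite -leNgt lerNl ltW.
Qed.

Let T2_bound : \int[mu]_x (T2 x `^ q * (v x)%:E) <=
  (2 * (4 * A) `^ q)%:E * (\int[mu]_x (h x `^ p * w x)%:E) `^ (q / p).
Proof.
apply: hardy_inequality => //.
- exact: measurable_funM.
- by move=> x; rewrite mulr_ge0 ?powR_ge0.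
- by move=> t; exact: sphere_integral.
move=> t; rewrite -/p'; have [t0|t0] := leP t 0%R.
  by rewrite ball_neg// integral_set0 poweR0r ?invr_neq0 ?gt_eqF// mul0e lee_fin ltW.
rewrite [X in _ * X `^ _](_ : _ = \int[mu]_(x in ~` [set x | r x < t]%R) (r x `^ (alpha * p') * U x `^ (- p') * w x)%:E).
  exact: cond3.
rewrite compl_ball; apply: eq_integral => x _; congr ((_ * _)%:E).
by rewrite powRM ?powR_ge0// -!powRrM mulN1r.
Qed.

Let tail x := \int[mu]_(y in [set y | r x <= r y]%R) (h y * U y `^ (- 1) * w y)%:E.

(** Cutting the integral in [y] at [r y = r x] selects the branch of the kernel bound and so
    produces [T1] and [T2]. *)
Let riesz_tail_le (C : R) x : (0 < C)%R -> (0 < r x)%R ->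
  (forall s, (0 <= s)%R ->
  ((s < r x)%R -> ball_potential mu r rho Q alpha x s <= (C * (r x `^ (alpha - Q) * s `^ Q))%:E) /\
  ((r x <= s)%R -> ball_potential mu r rho Q alpha x s <= (C * s `^ alpha)%:E)) ->
  \int[mu]_z (tail z * (rho x z `^ (alpha - Q))%:E) <=
  C%:E * ((r x `^ (alpha - Q))%:E * T1 x + T2 x).
Proof.
move=> C0 rx KC; pose gh y := (h y * U y `^ (- 1) * w y)%R.
have gh0 y : (0 <= gh y)%R by rewrite !mulr_ge0 ?powR_ge0.
have mgh : measurable_fun setT gh by do 2?[apply: measurable_funM => //].
rewrite (riesz_tail_fubini mu Q alpha mr mrho x mgh gh0).
have K0 y : 0 <= ball_potential mu r rho Q alpha x (r y).
  by apply: integral_ge0 => z _; rewrite lee_fin powR_ge0.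
have mK S : measurable_fun S (fun y => (gh y)%:E * ball_potential mu r rho Q alpha x (r y)).
  apply: measurable_funTS; apply: emeasurable_funM; first exact/measurable_EFinP.
  exact: measurable_ball_potential.
rewrite (_ : \int[mu]_y _ = \int[mu]_(y in [set y | r y < r x]%R `|` [set y | r x <= r y]%R)
    ((gh y)%:E * ball_potential mu r rho Q alpha x (r y))); last first.
  congr (integral _ _ _); apply/seteqP; split => // y _ /=.
  by case: (ltP (r y) (r x)) => ?; [left|right].
rewrite ge0_integral_setU//; last 2 first.
- by move=> y _; rewrite mule_ge0// lee_fin.
- by apply/disj_set2P/seteqP; split => // y [/= h1]; rewrite leNgt h1.
rewrite ge0_muleDr ?mule_ge0// ?lee_fin ?powR_ge0//; apply: leeD.
  rewrite muleA -EFinM -(integralZ_EFin mu) //; last 2 first.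
  - by apply: measurable_ge_fun; exact: measurable_funN.
  - by rewrite mulr_ge0 ?powR_ge0 ?(ltW C0).
  apply: (@le_trans _ _ (\int[mu]_(y in [set y | r y < r x]%R)
     (C * r x `^ (alpha - Q) * (h y * (r y `^ Q * U y `^ (- 1)) * w y))%:E)).
    apply: ge0_le_integral => //.
    + by move=> y _; rewrite mule_ge0// lee_fin.
    + by apply: measurable_funTS; apply/measurable_EFinP; apply: measurable_funM.
    + move=> y /= yx; have [/(_ yx) KC1 _] := KC _ (r0 y).
      apply: (le_trans (lee_wpmul2l _ KC1)); first by rewrite lee_fin.
      by rewrite -EFinM lee_fin /gh le_eqVlt; apply/orP; left; apply/eqP; ring.
  apply: le_integral_subset => //.
  - by apply: measurable_ge_fun; exact: measurable_funN.
  - exact: measurable_funM.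
  - by move=> y; rewrite mulr_ge0// mulr_ge0 ?powR_ge0 ?(ltW C0).
  - by move=> y /= yx; rewrite lerN2 ltW.
rewrite -(integralZ_EFin mu) ?(ltW C0)//.
apply: ge0_le_integral => //.
+ by move=> y _; rewrite mule_ge0// lee_fin.
+ by apply: measurable_funTS; apply/measurable_EFinP; apply: measurable_funM.
+ move=> y /= yx; have [_ /(_ yx) KC2] := KC _ (r0 y).
  apply: (le_trans (lee_wpmul2l _ KC2)); first by rewrite lee_fin.
  by rewrite -EFinM lee_fin /gh le_eqVlt; apply/orP; left; apply/eqP; ring.
Qed.

(** In the constant, 8 is the 4 of the tail average bound times the 2 of [poweR_add_le], and each of
    the two Hardy operators contributes [2 * (4 * A) ^ q]. *)
Lemma riesz_tail_bound (C : R) (f : T -> R) : (0 < C)%R ->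
  measurable_fun setT f -> (forall x, 0 <= f x)%R ->
  (forall x, (0 < r x)%R -> (f x)%:E <= 4%:E * tail x) ->
  (forall x s, (0 < r x)%R -> (0 <= s)%R ->
  ((s < r x)%R -> ball_potential mu r rho Q alpha x s <= (C * (r x `^ (alpha - Q) * s `^ Q))%:E) /\
  ((r x <= s)%R -> ball_potential mu r rho Q alpha x s <= (C * s `^ alpha)%:E)) ->
  \int[mu]_x (riesz f x `^ q * (v x)%:E) <=
  ((8 * C) `^ q * (2 * (2 * (4 * A) `^ q)))%:E * (\int[mu]_x (h x `^ p * w x)%:E) `^ (q / p).
Proof.
(* The pointwise bounds hold only where [r > 0]. The exceptional set is null and is removed twice,
   from the integral defining the potential and from the outer one. *)
move=> C0 mf f0 f_tail KC; pose N := [set x | r x = 0]%R.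
have mN : measurable N by exact: measurable_eq_fun.
have muN : mu N = 0 by exact: null_sphere.
have mTN : measurable (setT `\` N) by exact: measurableD.
have mq (F : T -> \bar R) : measurable_fun setT F -> measurable_fun setT (fun x => F x `^ q).
  exact: (@measurableT_comp _ _ _ _ _ _ (fun x => x `^ q) _ _ (measurable_poweR _)).
have mev S : measurable_fun S (fun x => (v x)%:E).
  by apply: measurable_funTS; exact/measurable_EFinP.
have rTN x : (setT `\` N) x -> (0 < r x)%R.
  by move=> [_ /eqP xN]; rewrite lt_neqAle eq_sym xN r0.
have mtail : measurable_fun setT tail.
  apply: (measurable_tail_integral mu mr).
    by do 2?[apply: measurable_funM => //].
  by move=> y; rewrite !mulr_ge0 ?powR_ge0.
have tail0 x : 0 <= tail x.
  by apply: integral_ge0 => y _; rewrite lee_fin !mulr_ge0 ?powR_ge0.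
have mkx x S : measurable_fun S (fun z => (rho x z `^ (alpha - Q))%:E).
  apply: measurable_funTS; apply/measurable_EFinP; apply: measurable_fun_powR.
  exact: measurable_rho.
have If x : (0 < r x)%R -> riesz f x <= (4 * C)%:E * ((r x `^ (alpha - Q))%:E * T1 x + T2 x).
  move=> rx; rewrite EFinM -muleA.
  apply: le_trans (lee_wpmul2l _ (riesz_tail_le C0 rx (KC x ^~ rx))); last by rewrite lee_fin.
  rewrite -ge0_integralZl//; last 2 first.
  - exact: emeasurable_funM.
  - by move=> z _; rewrite mule_ge0// lee_fin powR_ge0.
  rewrite /riesz [leLHS](ge0_negligible_integral mN) //; last 2 first.
  - apply/measurable_EFinP; apply: measurable_funM => //.
    by apply: measurable_fun_powR; exact: measurable_rho.
  - by move=> y _; rewrite lee_fin mulr_ge0 ?powR_ge0.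
  apply: (@le_trans _ _ (\int[mu]_(z in setT `\` N) (4%:E * (tail z * (rho x z `^ (alpha - Q))%:E)))).
    apply: ge0_le_integral => //.
    - by move=> y _; rewrite lee_fin mulr_ge0 ?powR_ge0.
    - apply: measurable_funTS; apply/measurable_EFinP; apply: measurable_funM => //.
      by apply: measurable_fun_powR; exact: measurable_rho.
    - apply: measurable_funTS; apply: emeasurable_funM => //; exact: emeasurable_funM.
    - move=> z /rTN rz; rewrite EFinM muleA; apply: lee_wpmul2r; last exact: f_tail.
      by rewrite lee_fin powR_ge0.
  apply: ge0_subset_integral => //.
  - by apply: emeasurable_funM => //; exact: emeasurable_funM.
  - by move=> z _; rewrite mule_ge0 ?lee_fin// mule_ge0// lee_fin powR_ge0.
have mT1' : measurable_fun setT (fun x => T1 x `^ q * (r x `^ ((alpha - Q) * q) * v x)%:E).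
  apply: emeasurable_funM; first exact: mq.
  by apply/measurable_EFinP; exact: measurable_funM.
have mT2' : measurable_fun setT (fun x => T2 x `^ q * (v x)%:E).
  by apply: emeasurable_funM => //; exact: mq.
have T1'0 x : 0 <= T1 x `^ q * (r x `^ ((alpha - Q) * q) * v x)%:E.
  by rewrite mule_ge0 ?poweR_ge0// lee_fin mulr_ge0 ?powR_ge0.
have T2'0 x : 0 <= T2 x `^ q * (v x)%:E.
  by rewrite mule_ge0 ?poweR_ge0// lee_fin.
have rf0 x : 0 <= riesz f x.
  by apply: integral_ge0 => y _; rewrite lee_fin mulr_ge0 ?powR_ge0.
rewrite [leLHS](ge0_negligible_integral mN) //; last 2 first.
- by apply: emeasurable_funM => //; apply: mq; exact: measurable_riesz.
- by move=> x _; rewrite mule_ge0 ?poweR_ge0 ?lee_fin.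
apply: (@le_trans _ _ (\int[mu]_(x in setT `\` N) (((8 * C) `^ q)%:E *
    (T1 x `^ q * (r x `^ ((alpha - Q) * q) * v x)%:E + T2 x `^ q * (v x)%:E)))).
  apply: ge0_le_integral => //.
  - by move=> x _; rewrite mule_ge0 ?poweR_ge0 ?lee_fin.
  - apply: measurable_funTS; apply: emeasurable_funM => //.
    by apply: mq; exact: measurable_riesz.
  - by apply: measurable_funTS; apply: emeasurable_funM => //; exact: emeasurable_funD.
  - move=> x /rTN rx.
    apply: (@le_trans _ _ (((4 * C)%:E * ((r x `^ (alpha - Q))%:E * T1 x + T2 x)) `^ q * (v x)%:E)).
      by apply: lee_wpmul2r; [rewrite lee_fin|apply: poweR_le; rewrite ?(ltW q0)//; exact: If].
    have C40 : (0 <= 4 * C)%R by rewrite mulr_ge0 ?(ltW C0).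
    have C40' : 0 <= (4 * C)%:E by rewrite lee_fin.
    have rp0 : 0 <= (r x `^ (alpha - Q))%:E by rewrite lee_fin powR_ge0.
    have a10 : 0 <= (r x `^ (alpha - Q))%:E * T1 x by rewrite mule_ge0.
    rewrite (poweRM _ C40' (adde_ge0 a10 (T20 x))).
    apply: (@le_trans _ _ (((4 * C)%:E `^ q * ((2 `^ q)%:E * (((r x `^ (alpha - Q))%:E * T1 x) `^ q + T2 x `^ q))) * (v x)%:E)).
      apply: lee_wpmul2r; first by rewrite lee_fin.
      by apply: lee_wpmul2l; [exact: poweR_ge0|apply: poweR_add_le => //; exact: ltW].
    rewrite muleA poweR_EFin -EFinM -powRM//.
    rewrite (_ : 4 * C * 2 = 8 * C)%R; last by ring.
    rewrite -muleA; apply: lee_wpmul2l; first by rewrite lee_fin powR_ge0.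
    rewrite (ge0_muleDl _ (poweR_ge0 _ _) (poweR_ge0 _ _)); apply: leeD2r.
    rewrite poweRM// poweR_EFin -powRrM.
    by rewrite (muleC _ (T1 x `^ q)) -muleA.
rewrite ge0_integralZl//; last 3 first.
- by apply: measurable_funTS; exact: emeasurable_funD.
- by move=> x _; rewrite adde_ge0.
- by rewrite lee_fin powR_ge0.
rewrite EFinM -muleA; apply: lee_wpmul2l; first by rewrite lee_fin powR_ge0.
apply: (@le_trans _ _ (\int[mu]_x (T1 x `^ q * (r x `^ ((alpha - Q) * q) * v x)%:E + T2 x `^ q * (v x)%:E))).
  apply: ge0_subset_integral => //; first exact: emeasurable_funD.
  by move=> x _; rewrite adde_ge0.
rewrite ge0_integralD// mulr_natl mulr2n EFinD ge0_muleDl ?lee_fin ?mulr_ge0 ?powR_ge0//.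
by apply: leeD; [exact: T1_bound|exact: T2_bound].
Qed.

End sufficiency.

Lemma riesz_bounded_of_conditions (A : R) : (0 < A)%R ->
  (forall t, (0 < t)%R ->
  (\int[mu]_(x in [set x | r x < t]%R) (r x `^ (p' * Q) * U x `^ (- p') * w x)%:E) `^ p'^-1 *
  (\int[mu]_(x in ~` [set x | r x < t]%R) (r x `^ ((alpha - Q) * q) * v x)%:E) `^ q^-1 <= A%:E) ->
  (forall t, (0 < t)%R ->
  (\int[mu]_(x in [set x | r x < t]%R) (v x)%:E) `^ q^-1 *
  (\int[mu]_(x in ~` [set x | r x < t]%R) (r x `^ (alpha * p') * U x `^ (- p') * w x)%:E) `^ p'^-1 <= A%:E) ->
  exists2 C : R, (0 < C)%R & forall (f : T -> R) (M : R),
    measurable_fun setT f -> (forall x, 0 <= f x <= M)%R ->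
    (forall x y, (r x <= r y)%R -> (f y <= f x)%R) ->
    (\int[mu]_x (riesz f x `^ q * (v x)%:E)) `^ q^-1 <=
    C%:E * (\int[mu]_x (f x `^ p * w x)%:E) `^ p^-1.
Proof.
move=> A0 cond2 cond3.
have [B B0 avg] := decreasing_le_tail_average mr mw r0 w0 null_sphere W_lty W_gt0 w_infinite p1.
have [C C0 KC] := ball_potential_upper mr mrho r0 rho0 a0 aQ c00 mu_ball mu_rball tri1 tri2.
pose D := ((8 * C) `^ q * (2 * (2 * (4 * A) `^ q)))%R.
have D0 : (0 < D)%R.
  apply: mulr_gt0; first by rewrite powR_gt0// mulr_gt0.
  by do 2?[apply: mulr_gt0 => //]; rewrite powR_gt0// mulr_gt0.
exists (D `^ q^-1 * B `^ p^-1)%R; first by rewrite mulr_gt0 ?powR_gt0.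
move=> f M mf fM fdec; have [h [mh h0 fh hB]] := avg f M mf fM fdec.
have f0 x : (0 <= f x)%R by have /andP[] := fM x.
have Ih0 : 0 <= \int[mu]_x (h x `^ p * w x)%:E.
  by apply: integral_ge0 => x _; rewrite lee_fin mulr_ge0 ?powR_ge0.
have If0 : 0 <= \int[mu]_x (f x `^ p * w x)%:E.
  by apply: integral_ge0 => x _; rewrite lee_fin mulr_ge0 ?powR_ge0.
have := riesz_tail_bound A0 cond2 cond3 mh h0 C0 mf f0 fh KC; rewrite -/D => H.
apply: (@le_trans _ _ ((D%:E * (\int[mu]_x (h x `^ p * w x)%:E) `^ (q / p)) `^ q^-1)).
  apply: poweR_le; rewrite ?invr_ge0 ?(ltW q0)//.
  by apply: integral_ge0 => x _; rewrite mule_ge0 ?poweR_ge0 ?lee_fin.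
rewrite poweRM ?poweR_ge0 ?lee_fin ?(ltW D0)// poweR_EFin EFinM -muleA.
apply: lee_wpmul2l; first by rewrite lee_fin powR_ge0.
rewrite -poweRrM (_ : q / p / q = p^-1)%R; last by field; rewrite !gt_eqF.
apply: (le_trans (poweR_le _ Ih0 hB)); first by rewrite invr_ge0 ltW.
by rewrite poweRM ?lee_fin ?(ltW B0)// poweR_EFin.
Qed.

(** * Necessity: test functions on balls and annuli *)

Section necessity.
Variable K : R.
Hypothesis K0 : (0 < K)%R.
Hypothesis bounded : forall fbar : R -> R,
  (forall s, 0 <= s -> 0 <= fbar s)%R ->
  (forall s t, 0 <= s -> s <= t -> fbar t <= fbar s)%R ->
  (\int[mu]_x (riesz (fbar \o r) x `^ q * (v x)%:E)) `^ q^-1 <=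
    K%:E * (\int[mu]_x (fbar (r x) `^ p * w x)%:E) `^ p^-1.

(** Boundedness gives [c * n * X <= K * (B * n) ^ (1/p)], where [X] is the second factor of the
    conclusion; cancelling [n ^ (1/p)] leaves [n ^ (1/p')]. This is legitimate because [n] is a real
    number and [n = 0] is treated apart. *)
Let test_bound (fbar : R -> R) (D : set T) (phi : T -> R) (n c B : R) :
  measurable_fun setT (fbar \o r) ->
  (forall s, 0 <= s -> 0 <= fbar s)%R ->
  (forall s t, 0 <= s -> s <= t -> fbar t <= fbar s)%R ->
  measurable D -> measurable_fun setT phi -> (forall x, 0 <= phi x)%R ->
  (0 <= n)%R -> (0 < c)%R -> (0 < B)%R ->
  \int[mu]_x (fbar (r x) `^ p * w x)%:E <= (B * n)%:E ->
  (forall x, D x -> (c * n * phi x)%:E <= riesz (fbar \o r) x) ->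
  n%:E `^ p'^-1 * (\int[mu]_(x in D) (phi x `^ q * v x)%:E) `^ q^-1 <=
    (K * B `^ p^-1 / c)%:E.
Proof.
move=> mf fbar0 fbar_dec mD mphi phi0 n0 c_gt0 B0 normf lowf.
set X := (_ `^ q^-1).
move: n0; rewrite le_eqVlt => /predU1P[n0|n0].
  by rewrite -n0 poweR0r ?invr_neq0 ?gt_eqF// mul0e lee_fin !mulr_ge0 ?powR_ge0 ?invr_ge0 ?(ltW K0) ?(ltW c_gt0).
have cn0 : (0 < c * n)%R by rewrite mulr_gt0.
have rf0 x : 0 <= riesz (fbar \o r) x.
  by apply: integral_ge0 => y _; rewrite lee_fin mulr_ge0 ?powR_ge0 ?fbar0.
have key : (c * n)%:E * X <= (K * (B * n) `^ p^-1)%:E.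
  rewrite [leRHS]EFinM; apply: (@le_trans _ _ (K%:E * (\int[mu]_x (fbar (r x) `^ p * w x)%:E) `^ p^-1)); last first.
    rewrite -poweR_EFin; apply: lee_wpmul2l; first by rewrite lee_fin ltW.
    apply: poweR_le; rewrite ?invr_ge0 ?(ltW p0)//.
    by apply: integral_ge0 => x _; rewrite lee_fin mulr_ge0 ?powR_ge0.
  apply: le_trans (bounded fbar0 fbar_dec).
  have -> : (c * n)%:E = ((c * n)%:E `^ q) `^ q^-1.
    by rewrite poweRK ?gt_eqF// lee_fin ltW.
  rewrite -poweRM ?poweR_ge0//; last first.
    by apply: integral_ge0 => x _; rewrite lee_fin mulr_ge0 ?powR_ge0.
  have Xi0 : 0 <= \int[mu]_(x in D) (phi x `^ q * v x)%:E.
    by apply: integral_ge0 => x _; rewrite lee_fin mulr_ge0 ?powR_ge0.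
  apply: poweR_le; [by rewrite invr_ge0 ltW|by rewrite mule_ge0 ?poweR_ge0|].
  have mphiq : measurable_fun setT (fun x => phi x `^ q * v x)%R.
    by apply: measurable_funM => //; exact: measurable_fun_powR.
  rewrite poweR_EFin -(integralZ_EFin mu) ?powR_ge0//; last first.
    by move=> x; rewrite mulr_ge0 ?powR_ge0.
  have mrz : measurable_fun setT (fun x => riesz (fbar \o r) x `^ q * (v x)%:E).
    apply: emeasurable_funM; last exact/measurable_EFinP.
    apply: (@measurableT_comp _ _ _ _ _ _ (fun x => x `^ q) _ _ (measurable_poweR _)).
    by apply: measurable_riesz => // x; exact: fbar0.
  apply: (@le_trans _ _ (\int[mu]_(x in D) (riesz (fbar \o r) x `^ q * (v x)%:E))).
    apply: ge0_le_integral => //.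
    - by move=> x _; rewrite lee_fin !mulr_ge0 ?powR_ge0.
    - by apply: measurable_funTS; apply/measurable_EFinP; exact: measurable_funM.
    - exact: measurable_funTS.
    - move=> x Dx; rewrite mulrA EFinM; apply: lee_wpmul2r; first by rewrite lee_fin.
      rewrite -powRM ?(ltW cn0)// -poweR_EFin; apply: poweR_le; first exact: ltW.
        by rewrite lee_fin mulr_ge0// ltW.
      exact: lowf.
  apply: ge0_subset_integral => //.
  by move=> x _; rewrite mule_ge0 ?poweR_ge0// lee_fin.
rewrite -lee_pdivlMl// in key.
apply: (le_trans (lee_wpmul2l (poweR_ge0 _ _) key)).
rewrite poweR_EFin -!EFinM lee_fin powRM ?(ltW B0) ?(ltW n0)//.
have nE : n = (n `^ p'^-1 * n `^ p^-1)%R.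
  rewrite -powRD; last by rewrite (gt_eqF n0) implybT.
  rewrite (_ : _ + _ = 1)%R ?powRr1 ?(ltW n0)//.
  by rewrite /p' invf_div; field; rewrite gt_eqF.
rewrite le_eqVlt; apply/orP; left; apply/eqP.
have := powR_gt0 p'^-1 n0; have := powR_gt0 p^-1 n0; move: nE.
move: (n `^ p'^-1)%R (n `^ p^-1)%R => y z nE z0 y0.
by rewrite nE; field; rewrite !gt_eqF.
Qed.

Section annulus.
Variables (a b gam : R).
Hypotheses (a_gt0 : (0 < a)%R) (gam0 : (0 < gam)%R).
Let E := [set x | a <= r x < b]%R.
Let mE : measurable E.
Proof.
rewrite (_ : E = [set x | a <= r x]%R `&` [set x | r x < b]%R).
  exact: measurableI.
by apply/seteqP; split => x; rewrite /E /=; [case/andP|case=> -> ->].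
Qed.

(** On the annulus [r < b], and [U] is at least W(a), which is positive because the inner radius
    is. *)
Let annulus_fin (s u : R) : (0 <= s)%R -> (0 <= u)%R ->
  \int[mu]_(x in E) (r x `^ s * U x `^ (- u) * w x)%:E < +oo.
Proof.
move=> s0 u0; pose M := (b `^ s * wmass mu r w a `^ (- u))%R.
have M0 : (0 <= M)%R by rewrite mulr_ge0 ?powR_ge0.
apply: (@le_lt_trans _ _ (\int[mu]_(x in E) (M * w x)%:E)).
  apply: le_integral_fun; first exact: mE.
  - by do 2?[apply: measurable_funM => //].
  - by apply: measurable_funM => //; exact: mw.
  - by move=> x; rewrite !mulr_ge0 ?powR_ge0.
  - move=> x /= /andP[ax xb]; apply: (ler_wpM2r (w0 x)).
    apply: (ler_pM (powR_ge0 _ _) (powR_ge0 _ _)).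
      exact: (powR_le s0 (r0 x) (ltW xb)).
    apply: powR_le_neg; rewrite ?oppr_le0//; first exact: (wmass_gt0 w0 W_lty W_gt0).
    exact: (wmass_le mr mw w0 W_lty).
rewrite (integralZ_EFin mu)//; apply: lte_mul_pinfty; rewrite ?lee_fin//.
apply: le_lt_trans (W_lty b); apply: le_integral_subset => //.
by move=> x /= /andP[].
Qed.

(** The density of f_E for kappa = [r ^ gam]; [gam] is [Q] for condition (ii) and [alpha] for
    (iii). *)
Let g x := (r x `^ (gam * (p' - 1)) * U x `^ (- p') * w x * \1_E x)%R.

Let mg : measurable_fun setT g.
Proof. by do 3?[apply: measurable_funM => //]. Qed.
Let g0 x : (0 <= g x)%R.
Proof. by rewrite !mulr_ge0 ?powR_ge0. Qed.
Let gexp : (0 <= gam * (p' - 1))%R.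
Proof. by rewrite mulr_ge0 ?subr_ge0 ?(ltW gam0)// ltW. Qed.

Let tail s := \int[mu]_(y in [set y | s <= r y]%R) (g y)%:E.
Let tail0 s : 0 <= tail s.
Proof. by apply: integral_ge0 => y _; rewrite lee_fin. Qed.
Let tail_fin s : tail s \is a fin_num.
Proof.
rewrite ge0_fin_numE//; apply: le_lt_trans (annulus_fin gexp (ltW p'0)).
rewrite -integral_mul_indic; exact: le_integral_subset.
Qed.
Let fbar s := fine (tail s).
Let fbar0 s : (0 <= s)%R -> (0 <= fbar s)%R. Proof. by move=> _; exact: fine_ge0. Qed.
Let fbar_dec s t : (0 <= s)%R -> (s <= t)%R -> (fbar t <= fbar s)%R.
Proof.
move=> _ st; rewrite -lee_fin !fineK//; apply: le_integral_subset => //.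
by move=> x /=; exact: le_trans.
Qed.
Let mtail : measurable_fun setT (fun x => tail (r x)).
Proof. exact: measurable_tail_integral. Qed.
Let mfbar : measurable_fun setT (fbar \o r).
Proof. exact: measurableT_comp (fine_measurable measurableT) mtail. Qed.

Let N := \int[mu]_(x in E) (r x `^ (gam * p') * U x `^ (- p') * w x)%:E.
Let B : R := (2 * (4 * (4 `^ 1 / (1 - 2 `^ (1 - p'))) `^ p'^-1) `^ p)%R.

(** With [h] as chosen in the proof, [g] is [h * U^-1 * w], so [fbar] is the tail average of [h];
    and [(p' - 1) * p = p'] makes [h ^ p * w] the integrand of [N]. *)
Let norm_fbar : \int[mu]_x (fbar (r x) `^ p * w x)%:E <= B%:E * N.
Proof.
pose h x := (r x `^ (gam * (p' - 1)) * U x `^ (1 - p') * \1_E x)%R.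
have mh : measurable_fun setT h by do 2?[apply: measurable_funM => //].
have h0 x : (0 <= h x)%R by rewrite !mulr_ge0 ?powR_ge0.
have := tail_average_bound mr mw r0 w0 null_sphere W_lty W_gt0 p1 mh h0.
rewrite -/p' -/B [X in _ <= _ * X -> _](_ : _ = N).
  apply: le_trans; rewrite le_eqVlt; apply/orP; left; apply/eqP.
  apply: eq_integral => x _; rewrite [LHS]EFinM -poweR_EFin /fbar fineK//.
  congr (_ `^ _ * _); apply: eq_integral => y _; congr EFin; rewrite /g /h -/(U y).
  have pE : (1 - p' + -1 = - p')%R by ring.
  have -> : (U y `^ (- p') = U y `^ (1 - p') * U y `^ (- 1))%R.
    by rewrite -powRD pE// oppr_eq0 (gt_eqF p'0).
  ring.
rewrite /N -[RHS]integral_mul_indic; apply: eq_integral => x _; congr EFin.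
have pp : ((p' - 1) * p = p')%R.
  by rewrite /p'; field; rewrite gt_eqF.
rewrite /h !powRM ?mulr_ge0 ?powR_ge0// -!powRrM.
rewrite (_ : gam * (p' - 1) * p = gam * p')%R; last by rewrite -mulrA pp.
rewrite (_ : (1 - p') * p = - p')%R; last by rewrite -[in RHS]pp; ring.
rewrite (_ : \1_E x `^ p = \1_E x)%R; first by ring.
by rewrite indicE; case: (_ \in _); rewrite ?powR1 ?powR0 ?gt_eqF.
Qed.

(** After the exchange of integrals, the lower bound for the ball potential adds a factor
    [r y ^ gam] to the density, raising the exponent from [gam * (p' - 1)] to [gam * p']. The
    potential is thus at least [c * phi x * N], and [test_bound] applies with [n = N]. *)
Lemma annulus_test (D : set T) (phi : T -> R) (c : R) :
  measurable D -> measurable_fun setT phi -> (forall x, 0 <= phi x)%R -> (0 < c)%R ->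
  (forall x y, D x -> E y ->
    (c * phi x * r y `^ gam)%:E <= ball_potential mu r rho Q alpha x (r y)) ->
  N `^ p'^-1 * (\int[mu]_(x in D) (phi x `^ q * v x)%:E) `^ q^-1 <=
    (K * B `^ p^-1 / c)%:E.
Proof.
move=> mD mphi phi0 c_gt0 H.
have N0 : 0 <= N by apply: integral_ge0 => x _; rewrite lee_fin !mulr_ge0 ?powR_ge0.
have Nfin : N \is a fin_num.
  by rewrite ge0_fin_numE//; apply: annulus_fin; [apply: mulr_ge0|]; exact: ltW.
have B0 : (0 < B)%R.
  rewrite mulr_gt0// powR_gt0// mulr_gt0// powR_gt0//; exact: (tailC_gt0 p'1).
have normf := norm_fbar; rewrite -(fineK Nfin) -EFinM in normf.
rewrite -(fineK Nfin); apply: (@test_bound fbar) => //; first exact: fine_ge0.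
move=> x Dx; have mU1 : measurable_fun setT (fun y => r y `^ (gam * p') * U y `^ (- p') * w y * \1_E y)%R.
  by do 3?[apply: measurable_funM => //].
have g10 y : (0 <= r y `^ (gam * p') * U y `^ (- p') * w y * \1_E y)%R.
  by rewrite !mulr_ge0 ?powR_ge0.
have -> : riesz (fbar \o r) x = \int[mu]_y ((g y)%:E * ball_potential mu r rho Q alpha x (r y)).
  rewrite -(riesz_tail_fubini mu Q alpha mr mrho x mg g0).
  by apply: eq_integral => z _; rewrite EFinM /= /fbar fineK.
rewrite mulrAC EFinM fineK//.
rewrite /N -(integral_mul_indic mu E (fun y => r y `^ (gam * p') * U y `^ (- p') * w y)%R).
rewrite -(integralZ_EFin mu)//; last first.
  by rewrite mulr_ge0 ?(ltW c_gt0).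
apply: ge0_le_integral => //.
- by move=> y _; rewrite lee_fin mulr_ge0// mulr_ge0 ?(ltW c_gt0).
- by apply/measurable_EFinP; apply: measurable_funM.
- apply: emeasurable_funM; first exact/measurable_EFinP.
  exact: measurable_ball_potential.
move=> y _; have K_ge0 : 0 <= ball_potential mu r rho Q alpha x (r y).
  by apply: integral_ge0 => z _; rewrite lee_fin powR_ge0.
have [Ey|nEy] := pselect (E y); last first.
  by rewrite /g indicE memNset// !mulr0 mul0e.
rewrite /g indicE mem_set// !mulr1.
apply: le_trans (lee_wpmul2l _ (H x y Dx Ey)); last first.
  by rewrite lee_fin !mulr_ge0 ?powR_ge0.
rewrite -EFinM lee_fin le_eqVlt; apply/orP; left; apply/eqP.
have gE : (gam * (p' - 1) + gam = gam * p')%R by ring.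
have -> : (r y `^ (gam * p') = r y `^ (gam * (p' - 1)) * r y `^ gam)%R.
  by rewrite -powRD gE// mulf_eq0 (gt_eqF gam0) (gt_eqF p'0).
ring.
Qed.

End annulus.

Let mcompl t : measurable (~` [set x | r x < t]%R).
Proof. exact: measurableC. Qed.

Lemma conditions_of_riesz_bounded : exists2 A : R, (0 < A)%R &
  [/\ forall t, (0 < t)%R ->
    (\int[mu]_(x in [set x | r x < t]%R) (w x)%:E) `^ (- p^-1) *
    (\int[mu]_(x in [set x | r x < t]%R) (r x `^ (alpha * q) * v x)%:E) `^ q^-1 <= A%:E,
  forall t, (0 < t)%R ->
    (\int[mu]_(x in [set x | r x < t]%R) (r x `^ (p' * Q) * U x `^ (- p') * w x)%:E) `^ p'^-1 *
    (\int[mu]_(x in ~` [set x | r x < t]%R) (r x `^ ((alpha - Q) * q) * v x)%:E) `^ q^-1 <= A%:E &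
  forall t, (0 < t)%R ->
    (\int[mu]_(x in [set x | r x < t]%R) (v x)%:E) `^ q^-1 *
    (\int[mu]_(x in ~` [set x | r x < t]%R) (r x `^ (alpha * p') * U x `^ (- p') * w x)%:E) `^ p'^-1 <= A%:E].
Proof.
pose c := ((2 * c0) `^ (alpha - Q))%R.
have c_gt0 : (0 < c)%R by rewrite powR_gt0// mulr_gt0.
pose B : R := (2 * (4 * (4 `^ 1 / (1 - 2 `^ (1 - p'))) `^ p'^-1) `^ p)%R.
pose A1 := (K * B `^ p^-1 / c)%R.
pose A2 := (K / c)%R.
have A10 : (0 <= A1)%R by rewrite !mulr_ge0 ?powR_ge0 ?invr_ge0 ?(ltW K0) ?(ltW c_gt0).
have A20 : (0 < A2)%R by rewrite divr_gt0.
exists (A1 + A2)%R; first by rewrite ltr_wpDl.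
have c02 : (0 < 2 * c0)%R by rewrite mulr_gt0.
have rho_le m x y : (r x <= m)%R -> (r y <= m)%R -> (rho x y <= 2 * c0 * m)%R.
  move=> xm ym; apply: (le_trans (tri1 x y)).
  rewrite (_ : 2 * c0 * m = c0 * (m + m))%R; last by ring.
  by rewrite ler_wpM2l ?lerD// ltW.
(* If [x] and the ball both lie within radius [m], all [rho]-distances are at most [2 * c0 * m]. The
   three conditions use this one bound, with [m] equal to the radius [t], to the radius of the outer
   point of [D], and to that of the outer point of the annulus. *)
have pot_ge m x s : (0 < m)%R -> (0 <= s)%R -> (r x <= m)%R -> (s <= m)%R ->
    (c * m `^ (alpha - Q) * s `^ Q)%:E <= ball_potential mu r rho Q alpha x s.
  move=> m0 s0 xm sm.
  rewrite /c -powRM ?(ltW c02) ?(ltW m0)//.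
  apply: (ball_potential_ge mr mrho r0 rho0 a0 aQ mu_ball mu_rball) => //; first exact: mulr_gt0.
  by move=> z zs; apply: rho_le => //; exact: le_trans sm.
have potQ x : (0 < r x)%R -> (r x `^ (alpha - Q) * r x `^ Q = r x `^ alpha)%R.
  by move=> rx; rewrite -powRD ?subrK// (gt_eqF rx) implybT.
have p'V : (0 < p'^-1)%R by rewrite invr_gt0.
split => t t0.
(* Condition (i): the indicator of the ball, with [n = 1] and W(t) in the role of [B]. Its potential
   inside the ball is at least [c * t ^ alpha], hence at least [c * r x ^ alpha]. *)
- pose fbar s : R := if (s < t)%R then 1%R else 0%R.
  have fbar0 s : (0 <= s)%R -> (0 <= fbar s)%R by rewrite /fbar; case: ifP.
  have fbar_dec s u : (0 <= s)%R -> (s <= u)%R -> (fbar u <= fbar s)%R.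
    by rewrite /fbar => _ su; case: (ltP u t) => ut; [rewrite (le_lt_trans su ut)|case: ifP].
  have fE : fbar \o r = \1_[set x | r x < t]%R.
    apply/funext => x; rewrite /fbar /= indicE; case: ifPn => xt; first by rewrite mem_set.
    by rewrite memNset//=; apply/negP.
  have mf : measurable_fun setT (fbar \o r) by rewrite fE; exact: measurable_indic.
  have wt0 := W_gt0 t0; have wE := wmassE w0 W_lty t.
  have wm0 : (0 < wmass mu r w t)%R by exact: (wmass_gt0 w0 W_lty W_gt0).
  have nf : \int[mu]_x (fbar (r x) `^ p * w x)%:E = (wmass mu r w t)%:E.
    rewrite -wE -[RHS]integral_mul_indic; apply: eq_integral => x _; congr EFin.
    rewrite -[fbar (r x)]/((fbar \o r) x) fE indicE mulrC.
    by case: (_ \in _); rewrite ?powR1 ?powR0 ?gt_eqF.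
  have low x : [set x | r x < t]%R x -> (c * 1 * (r x `^ alpha))%:E <= riesz (fbar \o r) x.
    move=> /= xt; rewrite mulr1.
    apply: (@le_trans _ _ (\int[mu]_(z in [set z | r z < t]%R) (rho x z `^ (alpha - Q))%:E)); last first.
      rewrite /riesz fE -integral_mul_indic le_eqVlt; apply/orP; left; apply/eqP.
      by apply: eq_integral => z _; rewrite mulrC.
    rewrite -(integral_closed_ball mr null_sphere); last 2 first.
    + by apply: measurable_fun_powR; exact: measurable_rho.
    + by move=> z; exact: powR_ge0.
    apply: le_trans (pot_ge t x t t0 (ltW t0) (ltW xt) (lexx _)).
    rewrite lee_fin -mulrA ler_wpM2l ?(ltW c_gt0)//.
    rewrite -powRD ?subrK; last by rewrite (gt_eqF t0) implybT.
    by apply: powR_le => //; exact: ltW.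
  have := @test_bound fbar _ (fun x => r x `^ alpha)%R 1 c (wmass mu r w t) mf fbar0 fbar_dec (mlt t)
     (mrp alpha) (fun x => powR_ge0 _ _) ler01 c_gt0 wm0.
  rewrite nf mulr1 lexx => /(_ isT low).
  rewrite poweR_EFin powR1 mul1e wE.
  under eq_integral do rewrite -powRrM.
  move=> H.
  rewrite poweR_EFin; apply: (le_trans (lee_wpmul2l _ H)); first by rewrite lee_fin powR_ge0.
  rewrite -EFinM lee_fin powRN [leLHS](_ : _ = A2)%R; first by rewrite lerDr.
  by rewrite /A2; field; rewrite !gt_eqF// powR_gt0.
- set X := (\int[mu]_(x in ~` _) _) `^ q^-1.
  have [cc cc0 ccP] := @le_poweR_mul_bound _ X (A1 + A2) p'^-1 (poweR_ge0 _ _) (addr_ge0 A10 (ltW A20)) p'V.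
  apply/ccP; first by apply: integral_ge0 => x _; rewrite lee_fin !mulr_ge0 ?powR_ge0.
  have mG : measurable_fun setT (fun x => r x `^ (p' * Q) * U x `^ (- p') * w x)%R.
    by do 2?[apply: measurable_funM => //].
  have G0 x : (0 <= r x `^ (p' * Q) * U x `^ (- p') * w x)%R.
    by rewrite !mulr_ge0 ?powR_ge0.
  (* Condition (ii): annuli need a positive inner radius, so the null set [r = 0] is first removed;
     the annuli between [r x] and [t] then exhaust the punctured ball. *)
  pose E0 := [set x | 0 < r x < t]%R.
  have mE0 : measurable E0.
    rewrite (_ : E0 = ~` [set x | r x = 0]%R `&` [set x | r x < t]%R).
      by apply: measurableI => //; apply: measurableC; exact: measurable_eq_fun.
    apply/seteqP; split => x; rewrite /E0 /=.
      by case/andP => x0 xt; split => //; apply/eqP; rewrite gt_eqF.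
    by case=> /eqP x0 ->; rewrite lt_neqAle eq_sym x0 r0.
  rewrite (_ : \int[mu]_(x in _) _ = \int[mu]_(x in E0) (r x `^ (p' * Q) * U x `^ (- p') * w x)%:E); last first.
    rewrite (@integral_split _ _ _ mu _ _ E0)// -[RHS]adde0; congr (_ + _).
      by congr (integral _ _ _); apply/seteqP; split => x; rewrite /E0 /=; [case|case/andP => -> ->].
    apply/eqP; rewrite eq_le; apply/andP; split; last first.
      by apply: integral_ge0 => x _; rewrite lee_fin.
    rewrite -(sphere_integral 0 mG); apply: le_integral_subset => //.
    + by apply: measurableI => //; exact: measurableC.
    + exact: measurable_eq_fun.
    + move=> x [/= xt /negP]; rewrite xt andbT -leNgt => x0.
      by apply/eqP; rewrite eq_le x0 r0.
  apply: (@integral_upsets_le _ _ _ _ r) => //.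
  + by apply: measurable_funTS; exact/measurable_EFinP.
  + by move=> x _; rewrite lee_fin.
  move=> x /= /andP[rx xt].
  rewrite (_ : _ `&` _ = [set y | r x <= r y < t]%R); last first.
    apply/seteqP; split => y; rewrite /E0 /=.
      by case=> /andP[_ yt] xy; apply/andP.
    case/andP => xy yt; split => //; apply/andP; split => //.
    exact: lt_le_trans xy.
  apply/ccP; first by apply: integral_ge0 => y _; rewrite lee_fin.
  rewrite (mulrC p' Q) /X.
  under [X in _ * X `^ _]eq_integral do rewrite powRrM.
  apply: (@le_trans _ _ A1%:E); last by rewrite lee_fin lerDl ltW.
  apply: annulus_test => // [y|y z /= /negP ty /andP[xz zt]]; first exact: powR_ge0.
  rewrite -leNgt in ty; have zy : (r z <= r y)%R by apply: ltW; exact: lt_le_trans ty.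
  by apply: pot_ge => //; exact: lt_le_trans ty.
- rewrite muleC; set X := (\int[mu]_(x in [set _ | _]) _) `^ q^-1.
  have [cc cc0 ccP] := @le_poweR_mul_bound _ X (A1 + A2) p'^-1 (poweR_ge0 _ _) (addr_ge0 A10 (ltW A20)) p'V.
  apply/ccP; first by apply: integral_ge0 => x _; rewrite lee_fin !mulr_ge0 ?powR_ge0.
  have mG : measurable_fun setT (fun x => r x `^ (alpha * p') * U x `^ (- p') * w x)%R.
    by do 2?[apply: measurable_funM => //].
  have G0 x : (0 <= r x `^ (alpha * p') * U x `^ (- p') * w x)%R.
    by rewrite !mulr_ge0 ?powR_ge0.
  apply: (@integral_upsets_le _ _ _ _ (fun x => - r x)%R) => //.
  + exact: measurable_funN.
  + by apply: measurable_funTS; exact/measurable_EFinP.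
  + by move=> x _; rewrite lee_fin.
  move=> x xt.
  have man : measurable [set y | t <= r y < r x + 1]%R.
    rewrite (_ : [set y | _] = [set y | t <= r y]%R `&` [set y | r y < r x + 1]%R).
      exact: measurableI.
    by apply/seteqP; split => y /= => [/andP[]|[-> ->]].
  (* Condition (iii): the exterior is exhausted outwards. The summand 1 makes the closed sublevel
     set of [x] fit into an annulus that is open on the outside. *)
  apply: (@le_trans _ _ (\int[mu]_(y in [set y | t <= r y < r x + 1]%R)
      (r y `^ (alpha * p') * U y `^ (- p') * w y)%:E)).
    apply: le_integral_subset => //.
    + by apply: measurableI => //; apply: measurable_ge_fun; exact: measurable_funN.
    + move=> y [/= /negP]; rewrite -leNgt lerN2 => -> yx /=; lra.
  apply/ccP; first by apply: integral_ge0 => y _; rewrite lee_fin.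
  rewrite /X (_ : \int[mu]_(y in [set y | r y < t]%R) (v y)%:E =
     \int[mu]_(y in [set y | r y < t]%R) (cst 1%R y `^ q * v y)%:E); last first.
    by apply: eq_integral => y _; rewrite powR1 mul1r.
  apply: (@le_trans _ _ A1%:E); last by rewrite lee_fin lerDl ltW.
  apply: annulus_test => // y z /= yt /andP[tz zx]; rewrite mulr1.
  have rz : (0 < r z)%R by exact: lt_le_trans tz.
  rewrite -(potQ z rz) mulrA; apply: pot_ge => //.
  by apply: ltW; exact: lt_le_trans tz.
Qed.

End necessity.

End radial_riesz.

(** * Triangular form of the group law *)

Section homogeneous_C1.
Context {R : realType} {V : normedModType R}.
Local Open Scope ring_scope.
Variables (f : V -> R) (u : V) (c mu lam : R) (delta : R -> V -> V).
Hypothesis df : forall Z, derivable f Z u.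
Hypothesis cDf : {for 0, continuous (fun Z => 'D_u f Z)}.
Hypothesis fline : forall h, f (h *: u) = c * h.
Hypotheses (lam_mu : lam <= mu) (c_eq0 : lam < mu -> c = 0).
Hypothesis f_delta : forall t Z, 0 < t -> f (delta t Z) = t `^ lam * f Z.
Hypothesis delta_line : forall t Z h, 0 < t ->
  delta t (Z + h *: u) = delta t Z + (t `^ mu * h) *: u.
Hypothesis delta0 : forall Z, delta t Z @[t --> 0^'+] --> (0 : V).
Hypothesis mu0 : 0 < mu.

Let derive_line (W : V) (k : R) :
  is_derive k 1 (fun s : R => f (W + s *: u)) ('D_u f (W + k *: u)).
Proof.
have e : (fun h : R => h^-1 *: (((fun s : R => f (W + s *: u)) \o shift k) (h *: 1) - f (W + k *: u))) =
         (fun h : R => h^-1 *: ((f \o shift (W + k *: u)) (h *: u) - f (W + k *: u))).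
  apply/funext => h /=; congr (_ *: (f _ - _)).
  by rewrite [_%:A]mulr1 scalerDl addrCA addrA.
by split; [rewrite /derivable e; exact: df|rewrite /derive e].
Qed.

Let Df0 : 'D_u f 0 = c.
Proof.
apply/cvg_lim => //; apply: cvg_near_cst; near=> h.
have h0 : h != 0 by near: h; exact: nbhs_dnbhs_neq.
rewrite /= addr0 fline -[X in f X](scale0r u) fline mulr0 subr0.
by rewrite /GRing.scale /= mulrCA mulVf ?mulr1.
Unshelve. all: by end_near. Qed.

(* The derivative along [u] is homogeneous of degree [lam - mu <= 0], so it
   equals its value at the origin, up to a factor tending to a constant. *)
Let affine_pos Z h : 0 < h -> f (Z + h *: u) = f Z + c * h.
Proof.
move=> h0; apply/eqP; rewrite -subr_eq0 -normr_le0; apply/ler_addgt0Pr => e e0.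
rewrite add0r; have eh0 : 0 < e / h by rewrite divr_gt0.
have /cvgrPdist_lt/(_ _ eh0) := cDf; rewrite Df0 => /nbhs_ballP[d d0 dD].
have d20 : 0 < d / 2 by rewrite divr_gt0.
have hu : t `^ mu * (h * `|u|) @[t --> 0^'+] --> (0 : R).
  by rewrite -[X in _ --> X](mul0r (h * `|u|)); apply: cvgMr_tmp; exact: powR_cvg0.
near (0 : R)^'+ => t.
have t0 : 0 < t by near: t; exact: nbhs_right_gt.
have t1 : t <= 1 by near: t; apply: nbhs_right_le.
have dZ : `|delta t Z| < d / 2.
  near: t; have /cvgrPdist_lt/(_ _ d20) := (delta0 Z); apply: filterS => t.
  by rewrite sub0r normrN.
have dU : t `^ mu * (h * `|u|) < d / 2.
  near: t; have /cvgrPdist_lt/(_ _ d20) := hu; apply: filterS => t.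
  by rewrite sub0r normrN => /(le_lt_trans (ler_norm _)).
have th0 : 0 < t `^ mu * h by rewrite mulr_gt0 ?powR_gt0.
(* The mean value theorem is applied after dilating by a small [t], on a short segment near the
   origin; scaling back by homogeneity leaves the factor [t ^ (mu - lam)]. *)
have [|] := @MVT R (fun s => f (delta t Z + s *: u)) (fun s => 'D_u f (delta t Z + s *: u)) _ _ th0 (fun s _ => derive_line _ s).
  by apply: derivable_within_continuous => s _; exact: (@ex_derive _ _ _ _ _ _ _ (derive_line _ s)).
move=> k /[!in_itv]/= /andP[k0 k1]; rewrite scale0r addr0 subr0 -delta_line// !f_delta// -mulrBr => E.
have tl0 : t `^ lam != 0 by rewrite gt_eqF// powR_gt0.
have {}E : f (Z + h *: u) - f Z = 'D_u f (delta t Z + k *: u) * (t `^ (mu - lam) * h).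
  rewrite -[LHS](mulKf tl0) E powRB; last by rewrite (gt_eqF t0) implybT.
  by field.
(* Either [lam = mu] and the factor is 1, or [c = 0]. *)
have cE : c = c * t `^ (mu - lam).
  move: lam_mu; rewrite le_eqVlt => /predU1P[->|/c_eq0 ->]; last by rewrite mul0r.
  by rewrite subrr powRr0 mulr1.
rewrite opprD addrA E (_ : _ - _ = ('D_u f (delta t Z + k *: u) - c) * (t `^ (mu - lam) * h)); last first.
  by rewrite mulrBl (mulrA c) -cE.
rewrite normrM [X in _ * X]ger0_norm; last by rewrite mulr_ge0 ?powR_ge0// ltW.
have : `|'D_u f (delta t Z + k *: u) - c| < e / h.
  rewrite distrC; apply: dD; rewrite -ball_normE /= sub0r normrN.
  apply: (le_lt_trans (ler_normD _ _)); rewrite (splitr d) ltrD//.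
  apply: le_lt_trans dU; rewrite normrZ gtr0_norm// mulrA ler_wpM2r//; exact: ltW.
rewrite ltr_pdivlMr// => /ltW; apply: le_trans.
rewrite ler_wpM2l// ger_pMl//.
by rewrite -(powRr0 t) ger_powR ?t0// subr_ge0.
Unshelve. all: by end_near. Qed.

(** The source of the triangular form of the group law: it is applied to an eigencoordinate of the
    product, with [lam] the eigenvalue of that coordinate and [mu] that of the direction [u].
    Negative [h] are reached by exchanging the end points. *)
Lemma homogeneous_C1_affine Z h : f (Z + h *: u) = f Z + c * h.
Proof.
have [h0|h0|->] := ltgtP h 0; last by rewrite scale0r mulr0 !addr0.
  have hN : 0 < - h by rewrite oppr_gt0.
  have := affine_pos (Z + h *: u) hN; rewrite -addrA -scalerDl subrr scale0r addr0.
  by move=> ->; rewrite mulrN subrK.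
exact: affine_pos.
Qed.

End homogeneous_C1.

Lemma cvg_bigsum (R : numFieldType) (V : normedModType R) (T : Type)
    (F : set_system T) {FF : Filter F} (I : finType) (f : I -> T -> V) (l : I -> V) :
  (forall i, f i x @[x --> F] --> l i) ->
  (\sum_i f i x)%R @[x --> F] --> (\sum_i l i)%R.
Proof. by move=> fl; apply: (cvg_big add_continuous). Qed.

(** * Coordinates in an eigenbasis of the dilation generator *)

Section eigenbasis.
Context {R : realType} {n : nat}.
Local Open Scope ring_scope.
Variables (P A : 'M[R]_n) (D : 'rV[R]_n).
Hypotheses (uP : P \in unitmx) (PA : P *m A = diag_mx D *m P).

Definition ecoord (i : 'I_n) (X : 'rV[R]_n) : R := (X *m invmx P) 0 i.

Lemma ecoordD i X Y : ecoord i (X + Y) = ecoord i X + ecoord i Y.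
Proof. by rewrite /ecoord mulmxDl mxE. Qed.

Lemma ecoordZ i a X : ecoord i (a *: X) = a * ecoord i X.
Proof. by rewrite /ecoord -scalemxAl mxE. Qed.

Lemma ecoord_row i j : ecoord i (row j P) = (i == j)%:R.
Proof. by rewrite /ecoord -row_mul mulmxV// !mxE eq_sym. Qed.

Lemma ecoord_line i j X h : ecoord i (X + h *: row j P) = ecoord i X + (i == j)%:R * h.
Proof. by rewrite ecoordD ecoordZ ecoord_row mulrC. Qed.

Lemma ecoord_sum X : X = \sum_i ecoord i X *: row i P.
Proof. by rewrite -[LHS](mulmxKV uP) mulmx_sum_row. Qed.

Lemma ecoord_inj X Y : (forall i, ecoord i X = ecoord i Y) -> X = Y.
Proof.
move=> XY; rewrite [X]ecoord_sum [Y]ecoord_sum.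
by apply: eq_bigr => i _; rewrite XY.
Qed.

Lemma continuous_ecoord i : continuous (ecoord i).
Proof.
have -> : ecoord i = (fun X => \sum_j X 0 j * invmx P j i).
  by apply/funext => X; rewrite /ecoord mxE.
move=> X; apply: (@cvg_bigsum R R^o _ (nbhs X) _ 'I_n
  (fun j (Y : 'rV_n) => Y 0 j * invmx P j i) (fun j => X 0 j * invmx P j i)) => j.
by apply: cvgMr_tmp; exact: coord_continuous.
Qed.

Lemma row_ecoord_neq0 i : row i P != 0.
Proof.
apply/eqP => /(congr1 (ecoord i)); rewrite ecoord_row eqxx /ecoord mul0mx mxE.
by move/eqP; rewrite oner_eq0.
Qed.

Lemma eigenbasis_eigenvalue i : eigenvalue A (D 0 i).
Proof.
apply/eigenvalueP; exists (row i P); last exact: row_ecoord_neq0.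
rewrite -row_mul PA mul_diag_mx; apply/rowP => j; by rewrite !mxE.
Qed.

Lemma eigenbasis_trace : \tr A = \sum_i D 0 i.
Proof.
have -> : A = invmx P *m (diag_mx D *m P) by rewrite -PA mulKmx.
by rewrite mxtrace_mulC mulmxK// mxtrace_diag.
Qed.

(** Partial sums of the matrix series are combinations of the fixed spectral projections [E i], with
    partial sums of scalar exponential series as coefficients, so only scalar convergence is
    needed. *)
Lemma expmx_eigenbasis s :
  expmx (s *: A) = invmx P *m diag_mx (\row_i expR (s * D 0 i)) *m P.
Proof.
have AE : A = invmx P *m diag_mx D *m P by rewrite -mulmxA -PA mulKmx.
pose E i := invmx P *m diag_mx (delta_mx 0 i) *m P : 'M[R]_n.
have diagE (v : 'rV[R]_n) : invmx P *m diag_mx v *m P = \sum_i v 0 i *: E i.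
  rewrite {1}[v]row_sum_delta linear_sum/= mulmx_sumr mulmx_suml.
  by apply: eq_bigr => i _; rewrite linearZ/= -scalemxAr -scalemxAl.
have powE k : (s *: A) ^+ k = invmx P *m diag_mx (\row_i (s * D 0 i) ^+ k) *m P.
  elim: k => [|k IH].
    rewrite expr0 (_ : diag_mx _ = 1%:M) ?mulmx1 ?mulVmx//.
    by apply/matrixP => i j; rewrite !mxE expr0.
  rewrite exprS IH -[LHS]/(_ *m _) AE -!scalemxAl -!mulmxA (mulKVmx uP).
  rewrite scalemxAr; congr (_ *m _); rewrite !mulmxA scalemxAl; congr (_ *m _).
  apply/matrixP => i j; rewrite mul_diag_mx !mxE exprS.
  by case: eqP => [->|_]; rewrite ?mulr1n ?mulr0n ?mulr0// mulrA.
apply/cvg_lim => //.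
rewrite diagE (_ : series _ = (fun m => \sum_i series (exp_coeff (s * D 0 i)) m *: E i)).
  apply: cvg_bigsum => i; rewrite mxE; apply: cvgZr_tmp.
  exact: is_cvg_series_exp_coeff.
apply/funext => m; rewrite /series /=.
under [RHS]eq_bigr do rewrite scaler_suml.
rewrite exchange_big/=; apply: eq_bigr => k _.
rewrite powE diagE scaler_sumr; apply: eq_bigr => i _.
by rewrite mxE scalerA /exp_coeff/= mulrC.
Qed.

Lemma ecoord_dilation t X i : 0 < t ->
  ecoord i (X *m expmx (ln t *: A)) = t `^ D 0 i * ecoord i X.
Proof.
move=> t0; rewrite expmx_eigenbasis /ecoord !mulmxA mulmxK// mul_mx_diag !mxE.
by rewrite mulrC /powR gt_eqF// (mulrC (ln t)).
Qed.

Lemma dilation_line t X i h : 0 < t ->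
  (X + h *: row i P) *m expmx (ln t *: A) =
  X *m expmx (ln t *: A) + (t `^ D 0 i * h) *: row i P.
Proof.
move=> t0; apply: ecoord_inj => j.
rewrite ecoord_line !ecoord_dilation// ecoord_line mulrDr; congr (_ + _).
by case: eqP => [->|_]; rewrite ?mul1r// !mul0r mulr0.
Qed.

Lemma cvg_dilation0 X : (forall i, 0 < D 0 i) ->
  X *m expmx (ln t *: A) @[t --> 0^'+] --> (0 : 'rV[R]_n).
Proof.
move=> D0.
have H : (\sum_i (t `^ D 0 i * ecoord i X) *: row i P) @[t --> 0^'+] --> (0 : 'rV[R]_n).
  have Z0 : \sum_(i < n) (0 : 'rV[R]_n) = 0 by rewrite big1.
  rewrite -[X in _ --> X]Z0.
  apply: (@cvg_bigsum R 'rV[R]_n R 0^'+ _ 'I_n (fun i t => (t `^ D 0 i * ecoord i X) *: row i P) (fun=> 0)) => i; rewrite -[X in _ --> X](scale0r (row i P)).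
  apply: cvgZr_tmp; rewrite -[X in _ --> X](mul0r (ecoord i X)).
  by apply: cvgMr_tmp; exact: powR_cvg0.
apply: cvg_trans H; apply: near_eq_cvg; near=> t.
rewrite [RHS]ecoord_sum; apply: eq_bigr => i _; rewrite ecoord_dilation//.

Unshelve. all: by end_near. Qed.

End eigenbasis.

Lemma diagonalizable_eigenbasis {R : realType} {n} (A : 'M[R]_n) :
  diagonalizable A -> exists (P : 'M[R]_n) (D : 'rV[R]_n),
    P \in unitmx /\ (P *m A = diag_mx D *m P)%R.
Proof.
by move=> [P uP /diagonalizable_forPex[D /(simmxP uP) PA]]; exists P, D.
Qed.

Lemma is_derive_comp_linear (R : realType) (V W : normedModType R) (L : W -> R)
    (F : V -> W) (Z u : V) :
  continuous L -> (forall x y, L (x + y) = L x + L y)%R ->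
  (forall a x, L (a *: x) = a * L x)%R -> derivable F Z u ->
  is_derive Z u (L \o F) (L ('D_u F Z)).
Proof.
move=> cL LD LZ dF.
have e : (fun h : R => h^-1 *: ((L \o F \o shift Z) (h *: u) - (L \o F) Z))%R =
    L \o (fun h : R => h^-1 *: ((F \o shift Z) (h *: u) - F Z))%R.
  apply/funext => h /=; rewrite LZ LD; congr (_ * (_ + _))%R.
  by rewrite -[(- F Z)%R]scaleN1r LZ mulN1r.
have c : (fun h : R => h^-1 *: ((L \o F \o shift Z) (h *: u) - (L \o F) Z))%R @ (0%R : R)^' -->
    L ('D_u F Z).
  by rewrite e; apply: continuous_cvg; [exact: cL|exact: dF].
by split; [apply/cvg_ex; eexists; exact: c|exact/cvg_lim].
Qed.

(** * The group law in eigencoordinates *)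

Section group_structure.
Context {R : realType} {n : nat} {G : PointedTopGroup.type}.
Variable H : homogeneous_group R n G.
Variables (P : 'M[R]_n) (D : 'rV[R]_n).
Hypotheses (uP : P \in unitmx) (PA : (P *m dil_gen H = diag_mx D *m P)%R).
Local Open Scope ring_scope.

Lemma expG0 : expG H 0 = 1%g.
Proof.
have := expG_oneparam H 0 0 0; rewrite addr0 scale0r => e.
by apply: (mulgI (expG H 0)); rewrite -e mulg1.
Qed.

Let E t := expmx (ln t *: dil_gen H).
Let D0 i : 0 < D 0 i.
Proof. exact: (dil_gen_gt0 (eigenbasis_eigenvalue uP PA i)). Qed.

Definition lmulG (X Y : 'rV[R]_n) := logG H (expG H X * expG H Y)%g.

Lemma lmulG0r X : lmulG X 0 = X.
Proof. by rewrite /lmulG expG0 mulg1 expGK. Qed.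

Lemma lmulG0l X : lmulG 0 X = X.
Proof. by rewrite /lmulG expG0 mul1g expGK. Qed.

Lemma dilation_expG t X : dilation H t (expG H X) = expG H (X *m E t).
Proof. by rewrite /dilation expGK. Qed.

Lemma lmulG_dilation t X Y : 0 < t -> lmulG (X *m E t) (Y *m E t) = lmulG X Y *m E t.
Proof.
move=> t0; have [_ dM] := dil_automorphism H t0.
rewrite /lmulG -!dilation_expG -[X in logG H X]dM.
by rewrite /= expGK.
Qed.

Let F (Z : 'rV[R]_n * 'rV[R]_n) := lmulG Z.1 Z.2.

(** Both factors are treated at once, as a map on pairs with the dilations acting diagonally. On the
    axis of [u] the other factor is neutral, so the [i]-th coordinate is linear there with slope
    [(i == j)]. When the eigenvalue of [i] is strictly the smaller one, [i] and [j] differ and the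
    slope is 0, as the affine lemma demands. *)
Let lmulG_affine i j (u : 'rV[R]_n * 'rV[R]_n) Z h :
  (u = (0, row j P) \/ u = (row j P, 0)) -> D 0 i <= D 0 j ->
  ecoord P i (F (Z + h *: u)) = ecoord P i (F Z) + (i == j)%:R * h.
Proof.
move=> uE ij; pose f := ecoord P i \o F.
have smF := smooth_mulG H.
have dF W : is_derive W u f (ecoord P i ('D_u F W)).
  apply: is_derive_comp_linear.
  - exact: continuous_ecoord.
  - exact: ecoordD.
  - exact: ecoordZ.
  - by have [_] := smF [::] W Logic.I; exact.
have DfE : (fun W => 'D_u f W) = ecoord P i \o (fun W => 'D_u F W).
  by apply/funext => W; exact: derive_val.
apply: (@homogeneous_C1_affine R _ f u (i == j)%:R (D 0 j) (D 0 i)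
  (fun t Z => (Z.1 *m E t, Z.2 *m E t))) => //.
- rewrite DfE; apply: continuous_comp; last exact: continuous_ecoord.
  by have [] := smF [:: u] 0 Logic.I.
- move=> k; rewrite /f /= /F; case: uE => ->.
    by rewrite /= scaler0 lmulG0l ecoordZ ecoord_row// mulrC.
  by rewrite /= scaler0 lmulG0r ecoordZ ecoord_row// mulrC.
- by move=> ltij; case: eqP => // eij; rewrite eij ltxx in ltij.
- by move=> t W t0; rewrite /f /= /F lmulG_dilation// (ecoord_dilation uP PA).
- move=> t W k t0; case: uE => -> /=; congr (_, _).
  + by rewrite /= !scaler0 !addr0.
  + exact: (dilation_line uP PA).
  + exact: (dilation_line uP PA).
  + by rewrite /= !scaler0 !addr0.
- move=> W; exact: (cvg_pair (cvg_dilation0 uP PA W.1 D0) (cvg_dilation0 uP PA W.2 D0)).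
Qed.

Lemma lmulG_line_r i j X Y h : D 0 i <= D 0 j ->
  ecoord P i (lmulG X (Y + h *: row j P)) = ecoord P i (lmulG X Y) + (i == j)%:R * h.
Proof.
move=> ij; have := @lmulG_affine i j (0, row j P) (X, Y) h (or_introl erefl) ij.
by rewrite /F /= scaler0 addr0.
Qed.

Lemma lmulG_line_l i j X Y h : D 0 i <= D 0 j ->
  ecoord P i (lmulG (X + h *: row j P) Y) = ecoord P i (lmulG X Y) + (i == j)%:R * h.
Proof.
move=> ij; have := @lmulG_affine i j (row j P, 0) (X, Y) h (or_intror erefl) ij.
by rewrite /F /= scaler0 addr0.
Qed.

Lemma hdim_eigenbasis : hdim H = \sum_i D 0 i.
Proof. exact: (eigenbasis_trace uP PA). Qed.

Lemma continuous_lmulG : continuous (fun Z : 'rV[R]_n * 'rV[R]_n => lmulG Z.1 Z.2).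
Proof. by have smF := smooth_mulG H => Z; have [c _] := smF [::] Z Logic.I; exact: c. Qed.

End group_structure.

(** * Iterated Lebesgue integration *)

Section borel_product.

(** Countability is needed on one side only: for each [B i], all open sets whose product with [B i]
    lies in [O] are merged into one open set, leaving a countable union of rectangles. This places
    open sets of a product topology in the product sigma-algebra. *)
Lemma measurable_open_prod (T1 : ptopologicalType) d2 (T2 : measurableType d2)
    (I : countType) (B : I -> set T2) (O : set (borel T1 * T2)) :
  (forall i, measurable (B i)) ->
  (forall x y, O (x, y) -> exists (i : I) (V : set T1),
     [/\ open V, V x, B i y & forall x' y', V x' -> B i y' -> O (x', y')]) ->
  measurable O.
Proof.
move=> mB HO.
pose V i : set T1 := \bigcup_(W in [set W : set T1 | open W /\
  forall x y, W x -> B i y -> O (x, y)]) W.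
have -> : O = \bigcup_i ((V i : set (borel T1)) `*` B i).
  apply/seteqP; split => [[x y] Oxy|[x y] [i _ [[W [_ WO] Wx] Bi]]]; last exact: WO.
  have [i [W [oW Wx Bi WO]]] := HO _ _ Oxy.
  by exists i => //; split => //; exists W.
apply: countable_bigcupT_measurable => [|i]; first exact: countableP.
apply: measurableX => //; apply: sub_sigma_algebra.
by apply: bigcup_open => W [].
Qed.

Lemma measurable_fun_borel d (T1 : measurableType d) (T2 : ptopologicalType)
    (f : T1 -> borel T2) :
  (forall O : set T2, open O -> measurable (f @^-1` O)) -> measurable_fun setT f.
Proof.
move=> H; apply: (@measurability _ _ _ _ setT f (@open T2)) => // _ [U oU <-].
by rewrite setTI; exact: H.
Qed.

Lemma measurable_borel_open (T : ptopologicalType) (O : set T) :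
  open O -> measurable (O : set (borel T)).
Proof. exact: sub_sigma_algebra. Qed.

End borel_product.

Section lebesgue_affine.
Context {R : realType}.
Notation leb := (@lebesgue_measure R).

(** The image of Lebesgue measure under the affine map, multiplied by [c], gives half-open intervals
    their length, hence is Lebesgue measure by uniqueness. *)
Lemma lebesgue_integral_affine (c a : R) (f : R -> \bar R) : (0 < c)%R ->
  measurable_fun [set: R] f -> (forall x, 0 <= f x) ->
  c%:E * \int[leb]_h f (c * h + a)%R = \int[leb]_h f h.
Proof.
move=> c0 mf f0.
pose phi : measurableTypeR R -> measurableTypeR R := fun h => (c * h + a)%R.
have mphi : measurable_fun setT phi.
  by apply: measurable_funD => //; exact: measurable_funM.
have cnn : (0 <= c)%R by exact: ltW.
pose nu : {measure set (measurableTypeR R) -> \bar R} := mscale (NngNum cnn) (pushforward leb phi).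
have nuE X : measurable X -> leb X = nu mphi X.
  apply: lebesgue_measure_unique => _ [[x y] _ <-].
  rewrite [RHS](_ : _ = c%:E * leb (phi @^-1` `]x, y]%classic))//.
  rewrite (_ : phi @^-1` _ = `](x - a) / c, (y - a) / c]%classic)%R; last first.
    apply/seteqP; split => z /=; rewrite !in_itv/= ltr_pdivrMr// ler_pdivlMr// ltrBlDr lerBrDr mulrC//.
  rewrite !lebesgue_measure_itv/= !lte_fin ltr_pM2r ?invr_gt0// ltrD2r.
  case: ifP => _; last by rewrite mule0.
  rewrite -!EFinB -EFinM; congr EFin; field; exact: lt0r_neq0.
rewrite [RHS](eq_measure_integral (nu mphi)); last by move=> A mA _; exact: nuE.
rewrite /nu ge0_integral_mscale//=; congr (_ * _)%E.
by rewrite (ge0_integral_pushforward mphi).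
Qed.

End lebesgue_affine.

Section iterated_integral.
Context {R : realType} {n : nat}.
Variable P : 'M[R]_n.
Hypothesis uP : P \in unitmx.
Notation Vb := (borel 'rV[R]_n).
Notation leb := (@lebesgue_measure R).

Lemma measurable_line i :
  measurable_fun setT (fun z : Vb * measurableTypeR R => (z.1 + z.2 *: row i P)%R : Vb).
Proof.
apply: measurable_fun_borel => U oU.
pose B (q : rat * rat) : set (measurableTypeR R) := `]ratr q.1, ratr q.2[%classic.
apply: (@measurable_open_prod _ _ _ _ B) => [q|X h /= Uh].
  exact: measurable_itv.
have c : continuous (fun z : 'rV[R]_n * R^o => z.1 + z.2 *: row i P)%R.
  move=> z; apply: cvgD; first exact: cvg_fst.
  by apply: cvgZr_tmp; exact: cvg_snd.
have : nbhs (X, h : R^o) ((fun z : 'rV[R]_n * R^o => z.1 + z.2 *: row i P)%R @^-1` U).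
  by apply: c; exact: open_nbhs_nbhs.
move=> [[V W] /= [nV nW] VW].
move: nW => /nbhs_ballP[e /= e0 eW].
have [q1] : exists q1, ratr q1 \in `](h - e)%R, h[.
  by apply: rat_in_itvoo; rewrite ltrBlDr ltrDl.
rewrite in_itv/= => /andP[hq1 q1h].
have [q2] : exists q2, ratr q2 \in `]h, (h + e)%R[.
  by apply: rat_in_itvoo; rewrite ltrDl.
rewrite in_itv/= => /andP[hq2 q2h].
exists (q1, q2), (interior V); split.
- exact: open_interior.
- exact: nV.
- by rewrite /B /= in_itv/= q1h hq2.
move=> X' h' VX'; rewrite /B /= in_itv/= => /andP[qh hq].
apply: (VW (X', h')); split => /=; first exact: interior_subset.
apply: eW; rewrite /ball /= ltr_distl; apply/andP; split; lra.
Qed.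

(** The head of [s] is the innermost direction, and the coordinates outside [s] end up frozen at 0.
    Over all indices it plays the role of Lebesgue measure on the Lie algebra; as an explicit
    iteration it is invariant under triangular maps by one-dimensional translation invariance
    alone. *)
Fixpoint iterated_integral (s : seq 'I_n) (f : 'rV[R]_n -> \bar R) : \bar R :=
  if s is i :: s' then
    iterated_integral s' (fun X => \int[leb]_h f (X + h *: row i P)%R)
  else f 0%R.
Local Notation J := iterated_integral.

Lemma measurable_line_integral_param d (T : measurableType d) (F : T * Vb -> \bar R) i :
  measurable_fun setT F -> (forall z, 0 <= F z) ->
  measurable_fun setT (fun z : T * Vb => \int[leb]_h F (z.1, z.2 + h *: row i P)%R).
Proof.
move=> mF F0.
pose g (u : (T * Vb) * measurableTypeR R) := F (u.1.1, (u.1.2 + u.2 *: row i P)%R : Vb).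
apply: (@measurable_fun_fubini_tonelli_F _ _ _ _ _ leb g) => [|z]; last exact: F0.
apply: measurableT_comp mF _; apply: measurable_fun_pair => /=.
  exact: (measurableT_comp measurable_fst measurable_fst).
have mp : measurable_fun setT (fun u : (T * Vb) * measurableTypeR R => (u.1.2, u.2)).
  apply: measurable_fun_pair => //=.
  exact: (measurableT_comp measurable_snd measurable_fst).
exact: (measurableT_comp (@measurable_line i) mp).
Qed.

Lemma measurable_line_integral (f : Vb -> \bar R) i :
  measurable_fun setT f -> (forall z, 0 <= f z) ->
  measurable_fun setT (fun X : Vb => \int[leb]_h f (X + h *: row i P)%R).
Proof.
move=> mf f0.
pose g (u : Vb * measurableTypeR R) := f ((u.1 + u.2 *: row i P)%R : Vb).
apply: (@measurable_fun_fubini_tonelli_F _ _ _ _ _ leb g) => [|z]; last exact: f0.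
exact: measurableT_comp mf (@measurable_line i).
Qed.

Lemma measurable_on_line (f : Vb -> \bar R) i X : measurable_fun setT f ->
  measurable_fun [set: R] (fun h => f (X + h *: row i P)%R).
Proof.
move=> mf.
have mg : measurable_fun setT (fun u : Vb * measurableTypeR R => f ((u.1 + u.2 *: row i P)%R : Vb)).
  exact: measurableT_comp mf (@measurable_line i).
exact: (measurableT_comp mg (pair1_measurable (X : Vb))).
Qed.

Let line_ge0 (f : 'rV[R]_n -> \bar R) i X : (forall z, 0 <= f z) ->
  0 <= \int[leb]_h f (X + h *: row i P)%R.
Proof. by move=> f0; apply: integral_ge0. Qed.

Lemma eq_iterated_integral s f g : f =1 g -> J s f = J s g.
Proof. by move=> /funext ->. Qed.

Lemma iterated_integral_ge0 s f : (forall X, 0 <= f X) -> 0 <= J s f.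
Proof. by elim: s f => [|i s IH] f f0 //=; apply: IH => X; exact: line_ge0. Qed.

Lemma iterated_integral0 s : J s (fun=> 0) = 0.
Proof.
elim: s => //= i s IH; rewrite -[RHS]IH; apply: eq_iterated_integral => X.
exact: integral0.
Qed.

Lemma iterated_integral_fubini d (T : measurableType d)
    (mu : {sigma_finite_measure set T -> \bar R}) s (F : T * Vb -> \bar R) :
  measurable_fun setT F -> (forall z, 0 <= F z) ->
  \int[mu]_x J s (fun X => F (x, X)) = J s (fun X => \int[mu]_x F (x, X)).
Proof.
elim: s F => [//|i s IH] F mF F0 /=.
rewrite (IH (fun z => \int[leb]_h F (z.1, z.2 + h *: row i P)%R)); last 2 first.
- exact: measurable_line_integral_param.
- by move=> z; apply: integral_ge0.
apply: eq_iterated_integral => X /=.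
apply: (@fubini_tonelli _ _ _ _ _ mu leb (fun u : T * measurableTypeR R => F (u.1, (X + u.2 *: row i P)%R : Vb))) => //.
apply: measurableT_comp mF _; apply: measurable_fun_pair => //=.
have mz : measurable_fun setT (fun u : T * measurableTypeR R => (X : Vb, u.2)).
  by apply: measurable_fun_pair => //=; exact: measurable_cst.
exact: (measurableT_comp (@measurable_line i) mz).
Qed.

(* [f] is required to depend only on the coordinates integrated over, and [T]
   is unipotent triangular with respect to the order of integration. *)
Lemma iterated_integral_triangular (leD : rel 'I_n) (T : 'rV[R]_n -> 'rV[R]_n) s f :
  sorted leD s -> transitive leD -> uniq s ->
  (forall i j X h, leD j i ->
    ecoord P i (T (X + h *: row j P)) = ecoord P i (T X) + (i == j)%:R * h)%R ->
  reflexive leD ->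
  measurable_fun setT (f : Vb -> \bar R) -> (forall X, 0 <= f X) ->
  (forall X Y, (forall i, i \in s -> ecoord P i X = ecoord P i Y) -> f X = f Y) ->
  J s (f \o T) = J s f.
Proof.
move=> + trD + TP reflD; elim: s f => [|i s IH] f /=.
  by move=> _ _ _ _ fconst; apply: fconst => i; rewrite in_nil.
move=> srt /andP[is_ us] mf f0 fdep.
pose f1 X := \int[leb]_h f (X + h *: row i P)%R.
have lei j : j \in i :: s -> leD i j.
  rewrite inE => /predU1P[->|js]; first exact: reflD.
  by have /allP := order_path_min trD srt; apply.
rewrite -[RHS](IH f1) //; last 4 first.
- exact: path_sorted srt.
- exact: measurable_line_integral.
- by move=> X; apply: integral_ge0.
- move=> X Y XY; rewrite /f1.
  (* Translating by the difference of the [i]-th coordinates shows that the inner integral no longer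
     depends on coordinate [i], as the induction requires. *)
  rewrite -[LHS](@lebesgue_integral_affine R 1 (ecoord P i Y - ecoord P i X)%R)//; last first.
    exact: measurable_on_line.
  rewrite mul1e; apply: eq_integral => h _; apply: fdep => j.
  rewrite inE !ecoord_line// mul1r => /predU1P[->|js].
    by rewrite eqxx !mul1r; ring.
  rewrite XY//; case: eqP => [ji|_]; last by rewrite !mul0r.
  by rewrite -ji js in is_.
(* Since [i] comes first in the order, a move by [h] along row [i] changes, among the coordinates of
   [T] listed in [i :: s], only the [i]-th, and by exactly [h]. Hence the inner integral of [f \o T]
   is [f1] at [T X]. *)
apply: eq_iterated_integral => X; rewrite /f1 /=; apply: eq_integral => h _.
apply: fdep => j js; rewrite ecoord_line//.
by rewrite TP// lei.
Qed.

Lemma iterated_integralZ s f (c : R) : (0 <= c)%R ->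
  measurable_fun setT (f : Vb -> \bar R) -> (forall X, 0 <= f X) ->
  J s (fun X => c%:E * f X) = c%:E * J s f.
Proof.
move=> c0; elim: s f => [//|i s IH] f mf f0 /=.
rewrite -IH; last 2 first.
- exact: measurable_line_integral.
- by move=> X; exact: line_ge0.
apply: eq_iterated_integral => X; rewrite ge0_integralZl//.
exact: measurable_on_line.
Qed.

Lemma iterated_integral_scale (a : 'I_n -> R) (T : Vb -> Vb) s f :
  (forall i, 0 < a i)%R -> measurable_fun setT T ->
  (forall i X h, T (X + h *: row i P)%R = (T X + (a i * h) *: row i P)%R) ->
  T 0%R = 0%R ->
  measurable_fun setT (f : Vb -> \bar R) -> (forall X, 0 <= f X) ->
  (\prod_(i <- s) a i)%:E * J s (f \o T) = J s f.
Proof.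
move=> a0 mT Tlin T0; elim: s f => [|i s IH] f mf f0 /=.
  by rewrite big_nil mul1e T0.
pose f1 X := \int[leb]_h f (X + h *: row i P)%R.
have mf1 : measurable_fun setT (f1 : Vb -> \bar R) by exact: measurable_line_integral.
have f10 X : 0 <= f1 X by exact: line_ge0.
rewrite -[RHS](IH f1)// big_cons mulrC EFinM -muleA; congr (_ * _).
rewrite -iterated_integralZ; last 3 first.
- exact: ltW.
- exact: (@measurable_line_integral (f \o T) i (measurableT_comp mf mT) (fun z => f0 _)).
- by move=> X; exact: integral_ge0.
apply: eq_iterated_integral => X /=.
rewrite -[RHS](@lebesgue_integral_affine R (a i) 0%R _ (a0 i)); last 2 first.
- exact: measurable_on_line.
- by move=> h; exact: f0.
by congr (_ * _); apply: eq_integral => h _; rewrite addr0 Tlin.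
Qed.

(** The scalar [c] serves the induction: integrating one coordinate leaves the cube in the others
    with [2 * c] in place of [c]. *)
Lemma iterated_integral_cube s (c : R) : (0 <= c)%R -> uniq s ->
  J s (fun X => (c * \1_[set Y | forall i, i \in s -> `|ecoord P i Y| < 1]%R X)%:E) =
  (c * 2 ^+ size s)%:E.
Proof.
elim: s c => [|i s IH] c c0 /=.
  by rewrite indicE mem_set ?mulr1.
move=> /andP[is_ us]; rewrite exprS mulrA -(IH _ _ us) ?mulr_ge0//.
apply: eq_iterated_integral => X.
set Q := [set Y | forall j, j \in s -> _].
rewrite (eq_integral (fun h : measurableTypeR R => (c * \1_Q X)%:E * (\1_(`](- 1 - ecoord P i X)%R, (1 - ecoord P i X)%R[%classic : set R) h)%:E)); last first.
  move=> h _; rewrite -EFinM -mulrA; congr (_ * _)%:E.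
  rewrite !indicE -natrM mulnb; congr (_%:R); congr nat_of_bool.
  apply/idP/idP.
  - move=> /set_mem H; apply/andP; split; apply/mem_set.
    + move=> j js; have := H j; rewrite inE js orbT => /(_ erefl).
      rewrite ecoord_line//; case: eqP => [ji|_]; last by rewrite mul0r addr0.
      by rewrite -ji js in is_.
    + have := H i (mem_head _ _); rewrite ecoord_line// eqxx mul1r /= in_itv/= ltr_norml.
      by move=> /andP[? ?]; apply/andP; split; lra.
  - move=> /andP[/set_mem HQ /set_mem]; rewrite /= in_itv/= => /andP[h1 h2].
    apply/mem_set => j; rewrite inE ecoord_line// => /predU1P[->|js].
      by rewrite eqxx mul1r ltr_norml; apply/andP; split; lra.
    case: eqP => [ji|_]; last by rewrite mul0r addr0; exact: HQ.
    by rewrite -ji js in is_.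
rewrite ge0_integralZl//; last 2 first.
- by apply/measurable_EFinP; exact: measurable_indic.
- by rewrite lee_fin mulr_ge0.
rewrite integral_indic// setIT.
rewrite [X in _ * X](_ : _ = 2%:E); last first.
  apply: (etrans (lebesgue_measure_itv _)) => /=; rewrite lte_fin ifT; last by lra.
  by rewrite -EFinB; congr EFin; ring.
by rewrite -EFinM mulrAC.
Qed.

End iterated_integral.

(** * Haar measure of balls *)

Lemma measurable_fun_lt d (T : measurableType d) (R : realType) (f : T -> R) :
  (forall a, measurable [set x | (f x < a)%R]) -> measurable_fun setT f.
Proof.
move=> H; apply: (@measurability _ _ _ _ setT f (@RGenCInfty.G R)).
  exact: RGenCInfty.measurableE.
move=> _ [_ [a ->] <-]; rewrite setTI.
rewrite (_ : _ @^-1` _ = ~` [set x | (f x < a)%R]); first exact: measurableC.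
by apply/seteqP; split => x /=; rewrite in_itv/= andbT leNgt => /negP.
Qed.

Definition rational_ball (R : realType) n (i : 'rV[rat]_n * nat) : set 'rV[R]_n :=
  ball (map_mx (@ratr R) i.1 : 'rV[R]_n) (i.2.+1%:R^-1)%R.

Lemma rational_ball_base (R : realType) n (X : 'rV[R]_n) (U : set 'rV[R]_n) : nbhs X U ->
  exists i, rational_ball i X /\ rational_ball i `<=` U.
Proof.
move=> /nbhs_ballP[e /= e0 eU].
have [k ke] : exists k : nat, (k.+1%:R^-1 < e / 2 :> R)%R.
  have := @near_infty_natSinv_lt R (PosNum (divr_gt0 e0 (ltr0Sn _ 1)))%R => -[N _ HN].
  by exists N; apply: HN => /=.
have dq j : exists c : rat, (`|ratr c - X 0 j| < k.+1%:R^-1)%R.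
  have k0 : (0 < k.+1%:R^-1 :> R)%R by rewrite invr_gt0.
  have [c] : exists c, ratr c \in `]X 0 j - k.+1%:R^-1, X 0 j + k.+1%:R^-1[%R.
    by apply: rat_in_itvoo; rewrite ltrBlDr -addrA ltrDl addr_gt0.
  by rewrite in_itv/= -ltr_distl => ?; exists c.
have [c Hc] := choice dq.
exists (\row_j c j, k); split => /=.
  by split=> [|i j] /=; [rewrite invr_gt0|rewrite ord1 /ball /= !mxE].
move=> Y [_ HY]; apply: eU; split=> // i j; rewrite ord1 {i} /ball /=.
have := HY ord0 j; rewrite /ball /= !mxE => h1; have h2 := Hc j.
rewrite (_ : X ord0 j - Y ord0 j = - (ratr (c j) - X ord0 j) + (ratr (c j) - Y ord0 j))%R; last by ring.
apply: le_lt_trans (ler_normD _ _) _; rewrite normrN.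
by rewrite (splitr e) (lt_trans (ltrD h2 h1))// ltrD.
Qed.

Section group_topology.
Context {R : realType} {n : nat} {G : PointedTopGroup.type}.
Variable H : homogeneous_group R n G.

Lemma continuous_mulG : continuous (fun z : G * G => (z.1 * z.2)%g).
Proof.
have -> : (fun z : G * G => (z.1 * z.2)%g) =
    expG H \o (fun Z => lmulG H Z.1 Z.2) \o (fun z : G * G => (logG H z.1, logG H z.2)).
  by apply/funext => z /=; rewrite /lmulG !logGK.
move=> z; apply: continuous_comp; last first.
  by apply: continuous_comp; [exact: continuous_lmulG|exact: continuous_expG].
have c1 : continuous (fun z : G * G => logG H z.1).
  by move=> u; apply: continuous_comp; [exact: cvg_fst|exact: continuous_logG].
have c2 : continuous (fun z : G * G => logG H z.2).
  by move=> u; apply: continuous_comp; [exact: cvg_snd|exact: continuous_logG].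
exact: (cvg_pair (c1 z) (c2 z)).
Qed.

Lemma continuous_invG : continuous (fun x : G => (x^-1)%g).
Proof.
have -> : (fun x : G => (x^-1)%g) =
    expG H \o (fun X => logG H ((expG H X)^-1)%g) \o logG H.
  by apply/funext => x /=; rewrite !logGK.
move=> x; apply: continuous_comp; first exact: continuous_logG.
apply: continuous_comp; last exact: continuous_expG.
by have smF := smooth_invG H; have [c _] := smF [::] (logG H x) Logic.I; exact: c.
Qed.

Lemma continuous_mul_of (T : topologicalType) (f g : T -> G) :
  continuous f -> continuous g -> continuous (fun x => f x * g x)%g.
Proof.
move=> cf cg x; apply: (@continuous_comp _ _ _ (fun x => (f x, g x)) (fun z : G * G => (z.1 * z.2)%g)).
  exact: (cvg_pair (cf x) (cg x)).
exact: continuous_mulG.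
Qed.

Lemma continuous_inv_of (T : topologicalType) (f : T -> G) :
  continuous f -> continuous (fun x => (f x)^-1)%g.
Proof. by move=> cf x; apply: continuous_comp; [exact: cf|exact: continuous_invG]. Qed.

(** The homeomorphism [L] transports the countable base of rational balls to [T2], which is what
    [measurable_open_prod] asks for. *)
Lemma measurable_open_borel_prod (T1 T2 : ptopologicalType) (L : T2 -> 'rV[R]_n)
    (E : 'rV[R]_n -> T2) (O : set (T1 * T2)) :
  continuous L -> continuous E -> cancel L E -> cancel E L -> open O ->
  measurable (O : set (borel T1 * borel T2)).
Proof.
move=> cL cE LE EL oO.
pose B (i : 'rV[rat]_n * nat) : set (borel T2) :=
  L @^-1` rational_ball i.
apply: (@measurable_open_prod _ _ (borel T2) ('rV[rat]_n * nat)%type B) => [i|x y Oxy].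
  apply: measurable_borel_open; apply: open_comp => [u _|]; first exact: cL.
  exact: (@ball_open R 'rV[R]_n).
have [[V W] /= [nV nW] VW] : nbhs (x, y) O by exact: open_nbhs_nbhs.
have nW' : nbhs (L y) (E @^-1` W) by apply: cE; rewrite LE.
have [i [Bi iW]] := rational_ball_base nW'.
exists i, (interior V); split => //; first exact: open_interior.
move=> x' y' Vx' By'; apply: (VW (x', y')); split => /=; first exact: interior_subset.
by have := iW _ By'; rewrite /= LE.
Qed.

Lemma measurable_open_group_prod (T : ptopologicalType) (O : set (T * G)) : open O ->
  measurable (O : set (borel T * borel G)).
Proof.
exact: (measurable_open_borel_prod (@continuous_logG _ _ _ H) (@continuous_expG _ _ _ H) (@logGK _ _ _ H) (@expGK _ _ _ H)).
Qed.

Lemma measurable_open_algebra_prod (T : ptopologicalType) (O : set (T * 'rV[R]_n)) : open O ->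
  measurable (O : set (borel T * borel 'rV[R]_n)).
Proof. by apply: (@measurable_open_borel_prod _ _ id id) => //; move=> ?; exact: cvg_id. Qed.

Lemma continuous_measurable_fun_borel (T : ptopologicalType) (f : T -> R) :
  continuous f -> measurable_fun [set: borel T] f.
Proof.
move=> cf; apply: measurable_fun_lt => a; apply: measurable_borel_open.
rewrite (_ : [set x | _] = f @^-1` [set y | (y < a)%R])//.
by apply: open_comp => [? _|]; [exact: cf|exact: open_lt].
Qed.

Lemma measurable_quasi_distance (r : G -> R) : continuous r ->
  measurable_fun setT (fun z : borel G * borel G => r (z.1 * z.2^-1)%g).
Proof.
move=> cr; apply: measurable_fun_lt => a.
apply: (@measurable_open_group_prod G [set z : G * G | (r (z.1 * z.2^-1)%g < a)%R]).
rewrite (_ : [set x | _] = (fun z : G * G => r (z.1 * z.2^-1)%g) @^-1` [set y | (y < a)%R])//.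
apply: open_comp => [z _|]; last exact: open_lt.
apply: (@continuous_comp _ _ _ (fun z : G * G => (z.1 * z.2^-1)%g) r); last exact: cr.
by apply: continuous_mul_of; [|apply: continuous_inv_of] => {}z; [exact: cvg_fst|exact: cvg_snd].
Qed.

End group_topology.

(** Attaches the sigma-finite structure to a measure without changing it, so that Tonelli's theorem
    applies to a Haar measure given as a plain measure. *)
Lemma sigma_finite_measure_of d (T : measurableType d) (R : realType)
   (mu : {measure set T -> \bar R}) : sigma_finite setT mu ->
  exists nu : {sigma_finite_measure set T -> \bar R},
    (nu : {measure set T -> \bar R}) = mu.
Proof.
move=> sf.
pose H1 := isSFinite.Build d T R mu (sfinite_measure_sigma_finite sf).
pose H2 := isSigmaFinite.Build d T R mu sf.
exists (HB.pack_for {sigma_finite_measure set T -> \bar R} (Measure.sort mu) H1 H2).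
exact: eq_measure.
Qed.

(** * Sigma-finiteness of the Haar measure *)

Section chart_boxes.
Context {R : realType} {n : nat} {G : PointedTopGroup.type}.
Variable H : homogeneous_group R n G.
Variable P : 'M[R]_n.
Hypothesis uP : P \in unitmx.

(** The inverse is there because uniqueness of Haar measure compares the measure of a set with the
    chart volume of its inverse; the box with [k = 1] bounds the inverted unit cube used in that
    comparison. *)
Definition chart_box (k : R) : set G :=
  [set x | forall i, (- k <= ecoord P i (logG H (x^-1)%g) <= k)%R].

Let coord_box (k : R) : set 'rV[R]_n := [set X | forall i, (- k <= ecoord P i X <= k)%R].

Let compact_coord_box k : compact (coord_box k).
Proof.
have -> : coord_box k = (fun c : 'rV[R]_n => c *m P)%R @`
    [set c : 'rV[R]_n | forall i, `[(- k)%R, k]%classic (c ord0 i)].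
  apply/seteqP; split => [X HX|_ [c Hc <-] i].
    exists (X *m invmx P)%R; last by rewrite mulmxKV.
    by move=> i /=; rewrite in_itv/=; exact: HX.
  by have := Hc i; rewrite /ecoord mulmxK//= in_itv.
apply: continuous_compact; last first.
  by apply: (@rV_compact R n (fun=> `[(- k)%R, k]%classic)) => i; exact: segment_compact.
apply: continuous_subspaceT.
have -> : (fun c : 'rV[R]_n => c *m P)%R = (fun c => \sum_i c ord0 i *: row i P)%R.
  by apply/funext => c; rewrite mulmx_sum_row.
move=> c; apply: (@cvg_bigsum R 'rV[R]_n _ (nbhs c) _ 'I_n
  (fun i (c : 'rV_n) => (c ord0 i *: row i P)%R) (fun i => (c ord0 i *: row i P)%R)) => i.
by apply: cvgZr_tmp; exact: coord_continuous.
Qed.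

Let continuous_log_inv : continuous (fun x : G => logG H (x^-1)%g).
Proof.
move=> x; apply: (@continuous_comp _ _ _ (fun x : G => (x^-1)%g) (logG H)).
  exact: (continuous_invG H).
exact: continuous_logG.
Qed.

Lemma compact_chart_box k : compact (chart_box k).
Proof.
have -> : chart_box k = (fun X => (expG H X)^-1)%g @` coord_box k.
  apply/seteqP; split => [x Hx|_ [X HX <-]].
    by exists (logG H (x^-1)%g) => //; rewrite logGK invgK.
  by rewrite /chart_box /= invgK expGK.
apply: continuous_compact; last exact: compact_coord_box.
apply: continuous_subspaceT; apply: continuous_inv_of; [exact: H|exact: continuous_expG].
Qed.

Lemma measurable_chart_box k : measurable (chart_box k : set (borel G)).
Proof.
have cb : closed (chart_box k).
  apply: (@closed_comp _ _ (fun x : G => logG H (x^-1)%g) (coord_box k)).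
    by move=> x _; exact: continuous_log_inv.
  by apply: compact_closed; [exact: norm_hausdorff|exact: compact_coord_box].
rewrite -[X in measurable X]setCK; apply: measurableC.
by apply: measurable_borel_open; rewrite openC.
Qed.

Lemma haar_sigma_finite (r : G -> R) (mu : {measure set (borel G) -> \bar R}) :
  normalized_haar r mu -> sigma_finite setT mu.
Proof.
move=> hmu; exists (fun k => chart_box k%:R).
  apply/seteqP; split => // x _.
  pose S := (\sum_i `|ecoord P i (logG H (x^-1)%g)|)%R.
  have S0 : (0 <= S)%R by exact: sumr_ge0.
  exists (Num.bound S) => // i; rewrite -ler_norml ltW//.
  by apply: le_lt_trans (archi_boundP S0); rewrite /S (bigD1 i)//= lerDl sumr_ge0.
by move=> k; split; [exact: measurable_chart_box|exact/(haar_compact hmu)/compact_chart_box].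
Qed.

End chart_boxes.

(** * Comparison of the Haar measure with the chart volume *)

Section haar_balls.
Context {R : realType} {n : nat} {G : PointedTopGroup.type}.
Variable H : homogeneous_group R n G.
Variables (P : 'M[R]_n) (D : 'rV[R]_n).
Hypotheses (uP : P \in unitmx) (PA : (P *m dil_gen H = diag_mx D *m P)%R).
Variables (r : G -> R) (mu : {sigma_finite_measure set (borel G) -> \bar R}).
Hypotheses (hr : homogeneous_norm H r) (hmu : normalized_haar r mu).
Notation Vb := (borel 'rV[R]_n).

(** Eigenvalues are listed in decreasing order: the innermost integration follows the largest one,
    and a move in that direction leaves all other coordinates of a product unchanged. *)
Let leD : rel 'I_n := fun i j => (D 0%R j <= D 0%R i)%R.
Let s := sort leD (enum 'I_n).
Let J := iterated_integral P s.

Let leD_trans : transitive leD.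
Proof. by move=> j i k ij jk; exact: le_trans jk ij. Qed.

Let leD_refl : reflexive leD.
Proof. by move=> i; exact: lexx. Qed.

Let s_sorted : sorted leD s.
Proof. by apply: sort_sorted => i j; exact: le_total. Qed.

Let s_uniq : uniq s.
Proof. by rewrite sort_uniq enum_uniq. Qed.

Let mem_s i : i \in s.
Proof. by rewrite mem_sort mem_enum. Qed.

Let J_lmul (X : 'rV[R]_n) (f : Vb -> \bar R) : measurable_fun setT f ->
  (forall Y, 0 <= f Y) -> J (fun Y => f (lmulG H X Y)) = J f.
Proof.
move=> mf f0; apply: (@iterated_integral_triangular R n P uP leD (lmulG H X) s f) => //.
  by move=> i j Y h ij; apply: (lmulG_line_r uP PA).
by move=> Y Z YZ; congr f; apply: (ecoord_inj uP) => i; exact: YZ.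
Qed.

Let J_rmul (X : 'rV[R]_n) (f : Vb -> \bar R) : measurable_fun setT f ->
  (forall Y, 0 <= f Y) -> J (fun Y => f (lmulG H Y X)) = J f.
Proof.
move=> mf f0; apply: (@iterated_integral_triangular R n P uP leD (fun Y => lmulG H Y X) s f) => //.
  by move=> i j Y h ij; apply: (lmulG_line_l uP PA).
by move=> Y Z YZ; congr f; apply: (ecoord_inj uP) => i; exact: YZ.
Qed.

Let chi (A : set G) (X : 'rV[R]_n) : \bar R := (\1_A (expG H X))%:E.

Let chi_ge0 A X : 0 <= chi A X.
Proof. by rewrite lee_fin. Qed.

Let open_exp (A : set G) : open A -> open (expG H @^-1` A).
Proof. by move=> oA; apply: open_comp => // X _; exact: continuous_expG. Qed.

Let measurable_chi A : open A -> measurable_fun setT (chi A : Vb -> \bar R).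
Proof.
move=> oA; apply/measurable_EFinP.
rewrite (_ : (fun X => _) = \1_(expG H @^-1` A : set Vb))//.
by apply: measurable_indic; apply: measurable_borel_open; exact: open_exp.
Qed.

Let J_lmulG x A : open A -> J (chi [set y | A (x * y)%g]) = J (chi A).
Proof.
move=> oA; rewrite -(@J_lmul (logG H x) (chi A))//; last exact: measurable_chi.
by apply: eq_iterated_integral => Y; rewrite /chi /lmulG !logGK !indicE; congr (_%:R%:E).
Qed.

Let J_rmulG x A : open A -> J (chi [set y | A (y * x)%g]) = J (chi A).
Proof.
move=> oA; rewrite -(@J_rmul (logG H x) (chi A))//; last exact: measurable_chi.
by apply: eq_iterated_integral => Y; rewrite /chi /lmulG !logGK !indicE; congr (_%:R%:E).
Qed.

Let integral_fiber (A : set G) (B : G -> set G) (c : \bar R) : open A ->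
  (forall x, A x -> J (chi (B x)) = c) ->
  \int[mu]_x J (fun X => (\1_[set z : borel G * Vb | A z.1 /\ B z.1 (expG H z.2)] (x, X))%:E) = c * mu A.
Proof.
move=> oA HB.
rewrite -(@integral_cst _ _ _ mu A (measurable_borel_open oA)) [RHS]integral_mkcond.
apply: eq_integral => x _; rewrite patchE; case: ifPn => [/set_mem Ax|/negP nA].
  rewrite /cst -(HB _ Ax); apply: eq_iterated_integral => X; rewrite /chi !indicE.
  by congr (nat_of_bool _)%:R%:E; apply/idP/idP => /set_mem h; apply/mem_set => //; case: h.
rewrite -[RHS](iterated_integral0 P s); apply: eq_iterated_integral => X.
by rewrite indicE memNset//= => -[Ax _]; apply: nA; apply/mem_set.
Qed.

(* Uniqueness of Haar measure, up to the inversion that accounts for the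
   unknown modular function. *)
Lemma haar_chart_volume (A B : set G) : open A -> open B ->
  J (chi B) * mu A = J (chi [set x | A (x^-1)%g]) * mu B.
Proof.
move=> oA oB.
(* Both sides are double integrals. Over [F1], right invariance of [J] gives [J (chi B)] for every
   [x] in [A]; over [F2], left invariance gives the chart volume of the inverse of [A] for every [x]
   in [B]. In the other order, left translation by [expG H X] carries the section of [F1] at [X]
   onto that of [F2]. *)
pose F1 : set (borel G * Vb) := [set z | A z.1 /\ B (expG H z.2 * z.1)%g].
pose F2 : set (borel G * Vb) := [set z | B z.1 /\ A ((expG H z.2)^-1 * z.1)%g].
have c1 : continuous (fun z : G * 'rV[R]_n => z.1) by move=> z; exact: cvg_fst.
have c2 : continuous (fun z : G * 'rV[R]_n => expG H z.2).
  by move=> z; apply: continuous_comp; [exact: cvg_snd|exact: continuous_expG].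
have m1 : measurable F1.
  apply: (@measurable_open_algebra_prod R n G [set z : G * 'rV[R]_n | A z.1 /\ B (expG H z.2 * z.1)%g]).
  apply: (@openI _ ((fun z : G * 'rV[R]_n => z.1) @^-1` A)
    ((fun z : G * 'rV[R]_n => expG H z.2 * z.1)%g @^-1` B)).
    by apply: open_comp => // z _; exact: c1.
  by apply: open_comp => // z _; exact: (continuous_mul_of H c2 c1).
have m2 : measurable F2.
  apply: (@measurable_open_algebra_prod R n G [set z : G * 'rV[R]_n | B z.1 /\ A ((expG H z.2)^-1 * z.1)%g]).
  apply: (@openI _ ((fun z : G * 'rV[R]_n => z.1) @^-1` B)
    ((fun z : G * 'rV[R]_n => (expG H z.2)^-1 * z.1)%g @^-1` A)).
    by apply: open_comp => // z _; exact: c1.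
  by apply: open_comp => // z _; exact: (continuous_mul_of H (continuous_inv_of H c2) c1).
rewrite -(@integral_fiber A (fun x => [set y | B (y * x)%g]))//; last first.
  by move=> x _; exact: J_rmulG.
have oA' : open [set x | A (x^-1)%g].
  by apply: open_comp => // x _; exact: (continuous_invG H).
rewrite -(@integral_fiber B (fun x => [set y | A (y^-1 * x)%g]))//; last first.
  move=> x _; rewrite -(J_lmulG (x^-1)%g oA'); congr (J (chi _)).
  by apply/seteqP; split => y /=; rewrite invgM invgK.
rewrite (@iterated_integral_fubini _ _ P _ _ mu s (fun z => (\1_F1 z)%:E)); last 2 first.
- by apply/measurable_EFinP; exact: measurable_indic.
- by move=> z; rewrite lee_fin.
rewrite (@iterated_integral_fubini _ _ P _ _ mu s (fun z => (\1_F2 z)%:E)); last 2 first.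
- by apply/measurable_EFinP; exact: measurable_indic.
- by move=> z; rewrite lee_fin.
apply: eq_iterated_integral => X.
have mF (F : set (borel G * Vb)) : measurable F -> measurable [set x | F (x, X)].
  move=> mF; have := @measurable_ysection _ _ _ _ F X mF.
  by rewrite ysectionE.
have intF (F : set (borel G * Vb)) : measurable F ->
    \int[mu]_x (\1_F (x, X))%:E = mu [set x | F (x, X)].
  move=> mF'; rewrite -[in RHS](setIT [set x | F (x, X)]) -(integral_indic mu measurableT (mF _ mF')).
  by apply: eq_integral => x _; rewrite !indicE; congr (nat_of_bool _)%:R%:E;
    apply/idP/idP => /set_mem h; exact/mem_set.
rewrite !intF// -(haar_left_invariant hmu (expG H X)); last exact: mF.
congr (mu _); apply/seteqP; split => [_ [y [Ay By] <-]|y [By Ay]].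
  by split => //=; rewrite mulKg.
by exists ((expG H X)^-1 * y)%g; [split => //=; rewrite mulVKg|rewrite mulVKg].
Qed.

Let openB a : open [set y : G | (r y < a)%R].
Proof.
rewrite (_ : [set x | _] = r @^-1` [set y | (y < a)%R])//.
by apply: open_comp => [? _|]; [exact: (continuous_hnorm hr)|exact: open_lt].
Qed.

Let vol (a : R) := J (chi [set y | (r y < a)%R]).

Let openGB x a : open (gball r x a).
Proof.
rewrite (_ : gball r x a = (fun y => x * y^-1)%g @^-1` [set y | (r y < a)%R])//.
apply: open_comp => // y _.
by apply: (continuous_mul_of H) => {}y; [exact: cvg_cst|exact: (continuous_invG H)].
Qed.

(** Uniqueness is applied to this ball and the unit ball. The inverse of [gball r x a] consists of
    the [y] with [r (x * y) < a], a left translate of the centred ball, and [J] is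
    left-invariant. *)
Let mu_gball_vol x a : vol 1 * mu (gball r x a) = vol a.
Proof.
have gB : gball r 1%g 1 = [set y | (r y < 1)%R].
  by apply/seteqP; split => y /=; rewrite /gball /= mul1g (hnormV hr).
rewrite /vol -gB haar_chart_volume// (haar_unit_ball hmu) mule1.
rewrite -(J_lmulG x (openB a)); congr (J (chi _)).
by apply/seteqP; split => y /=; rewrite /gball /= invgK.
Qed.

(** The dilation multiplies each eigencoordinate by [a] to its eigenvalue, and the eigenvalues add
    up to the trace of the generator. *)
Let vol_scale a : (0 < a)%R -> vol a = (a `^ hdim H)%:E * vol 1.
Proof.
move=> a0; pose T (X : Vb) : Vb := (X *m expmx (ln a *: dil_gen H))%R.
have Tlin i X h : T (X + h *: row i P)%R = (T X + (a `^ D 0 i * h) *: row i P)%R.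
  exact: (dilation_line uP PA).
have mT : measurable_fun setT T.
  apply: measurable_fun_borel => O oO; apply: measurable_borel_open.
  apply: open_comp => // X _.
  have -> : T = (fun c : 'rV[R]_n => \sum_i c ord0 i *: row i (expmx (ln a *: dil_gen H)))%R.
    by apply/funext => c; rewrite /T mulmx_sum_row.
  apply: (@cvg_bigsum R 'rV[R]_n _ (nbhs X) _ 'I_n
    (fun i (c : 'rV_n) => (c ord0 i *: row i _)%R) (fun i => (X ord0 i *: row i _)%R)) => i.
  by apply: cvgZr_tmp; exact: coord_continuous.
rewrite /vol /J -(@iterated_integral_scale R n P (fun i => a `^ D 0 i)%R T s (chi [set y | (r y < a)%R]))//.
- rewrite (hdim_eigenbasis uP PA); congr (_%:E * _).
    rewrite (perm_big (enum 'I_n)) ?perm_sort//= big_enum/=.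
    apply: (big_ind2 (fun u v => u = a `^ v)%R) => [|u1 u2 v1 v2 -> ->|//].
      by rewrite powRr0.
    by rewrite powRD// (gt_eqF a0) implybT.
  apply: eq_iterated_integral => X; rewrite /chi /= /T -dilation_expG !indicE.
  congr (nat_of_bool _)%:R%:E; apply/idP/idP => /set_mem /=.
    rewrite (hnorm_dilation hr)// => h; apply/mem_set => /=.
    by move: h; rewrite gtr_pMr.
  by move=> h; apply/mem_set; rewrite /= (hnorm_dilation hr)// gtr_pMr.
- by move=> i; exact: powR_gt0.
- by rewrite /T mul0mx.
- exact: measurable_chi.
Qed.

(** Uniqueness applied to the inverted open coordinate cube: [vol 1] times the Haar measure of that
    set is [2 ^ n], and that measure is finite by compactness. So neither factor vanishes, and
    [vol 1] cannot be infinite. *)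
Let vol1_gt0_fin : 0 < vol 1 < +oo.
Proof.
pose C := [set Y : 'rV[R]_n | forall i, i \in s -> (`|ecoord P i Y| < 1)%R].
pose A : set G := [set x | C (logG H (x^-1)%g)].
have oC : open C.
  rewrite openE => X HX;
  apply: (@filter_forall _ 'I_n (fun i Y => i \in s -> (`|ecoord P i Y| < 1)%R) (nbhs X)) => i.
  have : nbhs X ((fun Y => `|ecoord P i Y|%R) @^-1` [set y | (y < 1)%R]).
    apply: open_nbhs_nbhs; split; last exact: HX.
    apply: open_comp => [Y _|]; last exact: open_lt.
    exact: (@cvg_norm _ R^o _ _ _ (ecoord P i) _ (@continuous_ecoord R n P i Y)).
  by apply: filterS.
have oA : open A.
  apply: open_comp => // x _.
  by apply: (@continuous_comp _ _ _ (fun x : G => (x^-1)%g) (logG H));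
    [exact: (continuous_invG H)|exact: continuous_logG].
have := haar_chart_volume oA (openB 1%R).
rewrite (_ : mu [set y | (r y < 1)%R] = 1%E); last first.
  rewrite -[RHS](haar_unit_ball hmu); congr (mu _).
  by apply/seteqP; split => y /=; rewrite /gball /= mul1g (hnormV hr).
rewrite mule1 (_ : J (chi [set x | A (x^-1)%g]) = (2 ^+ n)%:E); last first.
  have := @iterated_integral_cube R n P uP s 1%R ler01 s_uniq.
  rewrite mul1r [size s](_ : _ = n) => [<-|]; last by rewrite size_sort size_enum_ord.
  apply: eq_iterated_integral => X; rewrite mul1r /chi !indicE.
  by congr (nat_of_bool _)%:R%:E; apply/idP/idP => /set_mem h; apply/mem_set;
    move: h; rewrite /A /= invgK expGK.
rewrite -/(vol 1) => e.
have v0 : 0 <= vol 1 by apply: iterated_integral_ge0.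
have muA : mu A < +oo.
  apply: le_lt_trans (haar_compact hmu (@compact_chart_box R n G H P uP 1%R)).
  apply: le_measure; rewrite ?inE; [exact: measurable_borel_open|exact: measurable_chart_box|].
  by move=> x Ax i; rewrite -ler_norml ltW// Ax.
have e0 : vol 1 * mu A != 0 by rewrite e eqe gt_eqF// exprn_gt0.
have muA0 : 0 < mu A.
  by rewrite lt_neqAle measure_ge0 andbT eq_sym; apply: contra_neq e0 => ->; rewrite mule0.
apply/andP; split.
  by rewrite lt_neqAle v0 andbT eq_sym; apply: contra_neq e0 => ->; rewrite mul0e.
by rewrite ltey; apply/eqP => v; move: e; rewrite v gt0_mulye.
Qed.

Lemma haar_gball x a : (0 < a)%R -> mu (gball r x a) = (a `^ hdim H)%:E.
Proof.
move=> a0; have := mu_gball_vol x a; rewrite (vol_scale a0) muleC.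
have /andP[v0 voo] := vol1_gt0_fin.
have -> : vol 1 = (fine (vol 1))%:E by rewrite fineK// ge0_fin_numE// ltW.
have f0 : fine (vol 1) != 0%R by rewrite gt_eqF// fine_gt0// v0.
case: (mu _) => [m||].
- by rewrite -!EFinM => -[e]; congr _%:E; exact: (mulIf f0 e).
- by rewrite gt0_mulye// lte_fin fine_gt0// v0.
- by rewrite gt0_mulNye// lte_fin fine_gt0// v0.
Qed.

End haar_balls.

(** * Two-weight characterization *)

Lemma ereal_sup_lty_bound (R : realType) (F : R -> \bar R) :
  ereal_sup [set F t | t in [set t : R | (0 < t)%R]] < +oo <->
  exists2 A : R, (0 < A)%R & forall t, (0 < t)%R -> F t <= A%:E.
Proof.
split=> [|[A A0 FA]]; last first.
  by apply: le_lt_trans (ltry A); apply: ge_ereal_sup => _ [t t0 <-]; exact: FA.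
set S := ereal_sup _ => Soo.
have FS t : (0 < t)%R -> F t <= S by move=> t0; apply: ereal_sup_ubound; exists t.
exists (Num.max 1 (fine S))%R; first by rewrite lt_max ltr01.
move=> t t0; apply: le_trans (FS _ t0) _.
by case: S Soo {FS} => [s|//|] _; rewrite ?leNye// lee_fin le_max lexx orbT.
Qed.

Section homogeneous_riesz.
Context {R : realType} {n : nat} {G : PointedTopGroup.type}.
Variables (H : homogeneous_group R n G) (r : G -> R).
Variables (mu : {sigma_finite_measure set (borel G) -> \bar R}).
Variables (alpha p q : R) (v w : borel G -> R).
Let Q := hdim H.
Let p' := (p / (p - 1))%R.
Hypotheses (hr : homogeneous_norm H r) (hmu : normalized_haar r mu).
Hypotheses (a0 : (0 < alpha)%R) (aQ : (alpha < Q)%R) (p1 : (1 < p)%R) (pq : (p <= q)%R).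
Hypotheses (wv : weight v) (ww : weight w).
Hypothesis wint_fin : forall t : R, (0 < t)%R -> wint r mu w t < +oo.
Hypothesis w_infinite : \int[mu]_x (w x)%:E = +oo.

Let rho (x y : borel G) : R := r (x * y^-1)%g.

Let gball1E t : gball r 1%g t = [set x | r x < t]%R.
Proof. by apply/seteqP; split => x; rewrite /gball /= mul1g (hnormV hr). Qed.

Let mr : measurable_fun [set: borel G] r.
Proof. exact: continuous_measurable_fun_borel (continuous_hnorm hr). Qed.

Let mrho : measurable_fun setT (fun z : borel G * borel G => rho z.1 z.2).
Proof. exact: (measurable_quasi_distance H (continuous_hnorm hr)). Qed.

Let mu_rball x a : (0 < a)%R -> mu [set y | rho x y < a]%R = (a `^ Q)%:E.
Proof.
have [P [D [uP PA]]] := diagonalizable_eigenbasis (dil_gen_diag H).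
exact: (haar_gball uP PA hr hmu).
Qed.

Let mu_ball a : (0 < a)%R -> mu [set x | r x < a]%R = (a `^ Q)%:E.
Proof. by move=> a_gt0; rewrite -gball1E -(mu_rball 1%g a_gt0). Qed.

Let w_fin t : (0 < t)%R -> \int[mu]_(x in [set x | r x < t]%R) (w x)%:E < +oo.
Proof. by move=> t0; rewrite -gball1E; exact: wint_fin. Qed.

Let wintE t : wint r mu w t = (wmass mu r w t)%:E.
Proof.
rewrite /wint gball1E /wmass; have [t0|t0] := ltP 0%R t.
  by rewrite fineK// ge0_fin_numE ?w_fin//; apply: integral_ge0 => x _; rewrite lee_fin ltW// ww.2.
rewrite (_ : [set x | _] = set0) ?integral_set0//.
apply/seteqP; split => // x /= xt.
by have := lt_le_trans xt t0; rewrite ltNge (hnorm_ge0 hr).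
Qed.

Let Lpnorm_ge0 (rho' : G -> R) (s : R) (f : G -> \bar R) : (forall x, 0 <= f x) ->
  Lpnorm mu rho' s f = (\int[mu]_x (f x `^ s * (rho' x)%:E)) `^ s^-1.
Proof.
by move=> f0; congr poweR; apply: eq_integral => x _; rewrite gee0_abs.
Qed.

Let Lpnorm_EFin (rho' : G -> R) (s : R) (f : G -> R) : (forall x, (0 <= f x)%R) ->
  Lpnorm mu rho' s (EFin \o f) = (\int[mu]_x (f x `^ s * rho' x)%:E) `^ s^-1.
Proof.
by move=> f0; rewrite Lpnorm_ge0// => x; rewrite lee_fin.
Qed.

Let riesz_ge0 (f : G -> R) x : (forall x, (0 <= f x)%R) ->
  0 <= riesz_potential r mu Q alpha f x.
Proof.
by move=> f0; apply: integral_ge0 => y _; rewrite lee_fin mulr_ge0 ?powR_ge0.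
Qed.

Let weight_integralE (D : set (borel G)) (b : R) :
  \int[mu]_(x in D) ((r x `^ b)%:E * wint r mu w (r x) `^ (- p') * (w x)%:E) =
  \int[mu]_(x in D) (r x `^ b * wmass mu r w (r x) `^ (- p') * w x)%:E.
Proof. by apply: eq_integral => x _; rewrite wintE. Qed.

Let F1 t := (\int[mu]_(x in gball r 1%g t) (w x)%:E) `^ (- p^-1) *
  (\int[mu]_(x in gball r 1%g t) (r x `^ (alpha * q) * v x)%:E) `^ q^-1.

Let F2 t :=
  (\int[mu]_(x in gball r 1%g t) ((r x `^ (p' * Q))%:E *
     wint r mu w (r x) `^ (- p') * (w x)%:E)) `^ p'^-1 *
  (\int[mu]_(x in ~` gball r 1%g t) (r x `^ ((alpha - Q) * q) * v x)%:E) `^ q^-1.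

Let F3 t := (\int[mu]_(x in gball r 1%g t) (v x)%:E) `^ q^-1 *
  (\int[mu]_(x in ~` gball r 1%g t) ((r x `^ (alpha * p'))%:E *
     wint r mu w (r x) `^ (- p') * (w x)%:E)) `^ p'^-1.

Lemma bounded_dec_riesz_iff :
  bounded_dec r mu p q w v (riesz_potential r mu Q alpha) <->
  [/\ ereal_sup [set F1 t | t in [set t : R | (0 < t)%R]] < +oo,
      ereal_sup [set F2 t | t in [set t : R | (0 < t)%R]] < +oo
    & ereal_sup [set F3 t | t in [set t : R | (0 < t)%R]] < +oo].
Proof.
have [c0 c0_gt0 qtri] := hnorm_quasi_triangle hr.
have tri1 x y : (rho x y <= c0 * (r x + r y))%R.
  by apply: le_trans (qtri _ _) _; rewrite (hnormV hr).
have tri2 x y : (r x <= c0 * (rho x y + r y))%R.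
  by rewrite -[x in leLHS](mulgVK y); exact: qtri.
have rho0 x y : (0 <= rho x y)%R by exact: (hnorm_ge0 hr).
have [mv v0] := wv; have [mw w0] := ww.
have e1 := ereal_sup_lty_bound F1; have e2 := ereal_sup_lty_bound F2.
have e3 := ereal_sup_lty_bound F3.
split=> [[K K0 bd]|[_ /e2[A2 A20 cond2] /e3[A3 A30 cond3]]].
  have [|A A0 [c1 c2 c3]] := @conditions_of_riesz_bounded _ _ _ _ _ _ _ _ _ _ _ _ _ mr mrho (hnorm_ge0 hr) rho0
    a0 aQ c0_gt0 mu_ball mu_rball tri1 mw w0 mv v0 p1 pq w_fin K K0.
    move=> fbar fbar0 fbar_dec.
    have f0 x : (0 <= (fbar \o r) x)%R by apply: fbar0; exact: (hnorm_ge0 hr).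
    have := bd (fbar \o r); rewrite Lpnorm_ge0; last by move=> x; exact: riesz_ge0.
    by rewrite Lpnorm_EFin//; apply; exists fbar.
  split.
  - by apply/e1; exists A; [exact: A0|move=> t t0]; rewrite /F1 !gball1E; exact: c1.
  - by apply/e2; exists A; [exact: A0|move=> t t0]; rewrite /F2 !gball1E weight_integralE; exact: c2.
  - by apply/e3; exists A; [exact: A0|move=> t t0]; rewrite /F3 !gball1E weight_integralE; exact: c3.
have A_gt0 : (0 < A2 + A3)%R by exact: addr_gt0.
have [t t0|t t0|C C0 bd] := @riesz_bounded_of_conditions _ _ _ _ _ _ _ _ _ _ _ _ _ mr mrho (hnorm_ge0 hr) rho0
  a0 aQ c0_gt0 mu_ball mu_rball tri1 tri2 mw w0 mv v0 p1 pq w_fin w_infinite (A2 + A3)%R A_gt0.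
- have := cond2 t t0; rewrite /F2 !gball1E weight_integralE => /le_trans; apply.
  by rewrite lee_fin lerDl ltW.
- have := cond3 t t0; rewrite /F3 !gball1E weight_integralE => /le_trans; apply.
  by rewrite lee_fin lerDr ltW.
exists C => // f [fbar [fbar0 fbar_dec fE]].
have f0 x : (0 <= f x)%R by rewrite fE; apply: fbar0; exact: (hnorm_ge0 hr).
rewrite Lpnorm_ge0 => [|x]; last exact: riesz_ge0.
rewrite Lpnorm_EFin//; apply: (bd f (fbar 0%R)).
(* [fbar] is monotone only on nonnegative arguments; freezing it at [fbar 0] below 0 gives a
   nonincreasing function on the whole line, hence measurability of [f]. The value [fbar 0] also
   serves as the upper bound for [f]. *)
- have -> : f = (fun s => fbar (Num.max 0 s)%R) \o r.
    by apply/funext => x /=; rewrite fE max_r// (hnorm_ge0 hr).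
  apply: measurableT_comp mr; apply: nonincreasing_measurable => // s t st.
  by apply: fbar_dec; [rewrite le_max lexx|rewrite ge_max !le_max lexx st orbT].
- by move=> x; rewrite f0 fE fbar_dec// (hnorm_ge0 hr).
- by move=> x y xy; rewrite !fE fbar_dec// (hnorm_ge0 hr).
Qed.

End homogeneous_riesz.

Unset Implicit Arguments.
Set Strict Implicit.

Theorem theorem3p1 (R : realType) (n : nat) (G : PointedTopGroup.type)
  (H : homogeneous_group R n G) (r : G -> R)
  (mu : {measure set (borel G) -> \bar R})
  (alpha p q : R) (v w : G -> R)
  (Q := hdim H) (p' := (p / (p - 1))%R)
  (B := fun t : R => gball r 1%g t) (W := wint r mu w) :
  homogeneous_norm H r -> normalized_haar r mu ->
  (0 < alpha < Q)%R -> (1 < p)%R -> (p <= q)%R ->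
  weight v -> weight w ->
  (forall t : R, (0 < t)%R -> W t < +oo) ->
  \int[mu]_x (w x)%:E = +oo ->
  DC_tail r mu Q alpha p w \/ DC r mu v ->
  (bounded_dec r mu p q w v (riesz_potential r mu Q alpha) <->
   [/\ ereal_sup [set (\int[mu]_(x in B t) (w x)%:E) `^ (- p^-1) *
          (\int[mu]_(x in B t) (r x `^ (alpha * q) * v x)%:E) `^ q^-1
          | t in [set t : R | (0 < t)%R]] < +oo,
       ereal_sup [set
          (\int[mu]_(x in B t) ((r x `^ (p' * Q))%:E *
             W (r x) `^ (- p') * (w x)%:E)) `^ p'^-1 *
          (\int[mu]_(x in ~` B t)
             (r x `^ ((alpha - Q) * q) * v x)%:E) `^ q^-1
          | t in [set t : R | (0 < t)%R]] < +oo
     & ereal_sup [set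
          (\int[mu]_(x in B t) (v x)%:E) `^ q^-1 *
          (\int[mu]_(x in ~` B t) ((r x `^ (alpha * p'))%:E *
             W (r x) `^ (- p') * (w x)%:E)) `^ p'^-1
          | t in [set t : R | (0 < t)%R]] < +oo]).
Proof.
move=> hr hmu /andP[a0 aQ] p1 pq wv ww Wfin Winf _.
have [P [D [uP _]]] := diagonalizable_eigenbasis (dil_gen_diag H).
have [nu enu] := sigma_finite_measure_of (haar_sigma_finite H uP hmu).
by subst mu; exact: bounded_dec_riesz_iff.
Qed.
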